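(* Let $x_0\in\mathcal H$. Assume the master-equation hypothesis and the minimizer hypothesis (both defined in the context) for the functional $G:\mathcal P_2(\mathcal H)\to\mathbb R$ and the covariance $Q$. Then there is a constant $C_*<\infty$, independent of $K,N,\varepsilon$, such that for all $K,N\ge1$ and $0<\varepsilon<1$ for which the projected particle value $v_\varepsilon^{K,N}$ is a classical solution of the projected particle HJB equation and satisfies the particle regularity hypothesis (defined in the context), $$0\le \frac1N v_\varepsilon^{K,N}(0,\Pi_K\mathbf x_0)-\mathcal V_0\le \frac{L_{\varepsilon,K}}{2N}+C_*\Big(\varepsilon^{2/\alpha}\operatorname{Tr}(Q)+\Delta_K^{\mathrm{proj}}\Big)^{\alpha/2}+\frac\varepsilon2D_{CM,K}^2(\mu^\star)+\frac{\varepsilon K}{\alpha}\log\frac1\varepsilon ,$$ where $\Pi_K\mathbf x_0=(\Pi_Kx_0,\dots,\Pi_Kx_0)\in(\mathcal H_K)^N$.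
   Context: $\mathcal H$ is a separable Hilbert space; $\mathcal P_2(\cdot)$ denotes probability measures with finite second moment, with 2-Wasserstein metric $\mathcal W_2$; $M_2(\mu)=\int\|x\|^2\mu(dx)$. $Q$ is a symmetric, positive-definite, trace-class operator on $\mathcal H$ with orthonormal eigenbasis $(e_j)_{j\ge1}$ and eigenvalues $\lambda_j>0$. $\mathcal H_K=\operatorname{span}\{e_1,\dots,e_K\}$, $\Pi_K$ is the orthogonal projection onto $\mathcal H_K$, $\iota_K:\mathcal H_K\hookrightarrow\mathcal H$ the embedding, $Q_K=\Pi_KQ\Pi_K$ on $\mathcal H_K$, $\|h\|_{Q_K}=\|Q_K^{-1/2}h\|$. $\mu^N_{\mathbf x}=\frac1N\sum_i\delta_{x_i}$; $G_K(\nu)=G((\iota_K)_\#\nu)$; $\mathcal V_0=\inf_{\mu\in\mathcal P_2(\mathcal H)}G(\mu)$. $\partial_\mu$ is the Lions derivative, $\partial_x\partial_\mu$ its spatial derivative, $\partial^2_{\mu\mu}$ the second Lions derivative. Projected particle value: $v_\varepsilon^{K,N}(t,\mathbf x)=\inf_{\theta^1,\dots,\theta^N}\mathbb E[N G_K(\mu^N_{\mathbf X^K_1})+\frac\varepsilon2\sum_i\int_t^1\|\theta^i_s\|^2_{Q_K}ds]$ over progressively measurable finite-energy $\mathcal H_K$-valued controls, with $X^{K,i}_s=x_i+\int_t^s\theta^i_rdr+W^{K,i}_s-W^{K,i}_t$ and independent $Q_K$-Wiener processes $W^{K,i}$; equivalently $v_\varepsilon^{K,N}(t,\mathbf x)=-\varepsilon\log\mathbb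 E[\exp(-\frac N\varepsilon G_K(\mu^N_{\mathbf x+\Delta\mathbf W^K_{1-t}}))]$, where $\Delta\mathbf W^K_\tau$ has $N$ independent $\mathcal N(0,\tau Q_K)$ components. Projected particle HJB: $\partial_tv+\frac12\sum_i\operatorname{Tr}(Q_KD^2_{x_i}v)-\frac1{2\varepsilon}\sum_i\|Q_K^{1/2}D_{x_i}v\|^2=0$ on $[0,1)\times(\mathcal H_K)^N$, $v(1,\mathbf x)=NG_K(\mu^N_{\mathbf x})$. Projected mean-field value: $V_\varepsilon^K(t,\nu)=\inf_\theta\{G_K(\mathcal L(X_1))+\mathbb E[\frac\varepsilon2\int_t^1\|\theta_s\|^2_{Q_K}ds]\}$ over adapted finite-energy $\mathcal H_K$-valued controls, where $X_s=\xi+\int_t^s\theta_rdr+W^K_s-W^K_t$, $\mathcal L(\xi)=\nu$, $W^K$ a $Q_K$-Wiener process. Master-equation hypothesis: $G$ is bounded below, continuous, and $|G(\mu)|\le C_G(1+M_2(\mu))$. For every $\varepsilon>0$, $K\ge1$, $V_\varepsilon^K$ is a solution of $$\partial_tV+\tfrac12\int\operatorname{Tr}(Q_K\partial_x\partial_\mu V(t,\nu)(x))\nu(dx)-\tfrac1{2\varepsilon}\int\|Q_K^{1/2}\partial_\mu V(t,\nu)(x)\|^2\nu(dx)=0$$ on $[0,1)\times\mathcal P_2(\mathcal H_K)$, continuous up to $t=1$ with $V(1,\nu)=G_K(\nu)$; on $[0,1)\times\mathcal P_2(\mathcal H_K)$ the derivatives $\partial_tV,\partial_\mu V,\partial_x\partial_\mu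 V,\partial^2_{\mu\mu}V$ exist in the classical Lions sense, and Carmona--Delarue chain-rule regularity holds: the versions of $\partial_\mu V,\partial_x\partial_\mu V$ are continuous at support points of the measure argument and locally bounded on bounded subsets of $[0,1)\times\mathcal P_2(\mathcal H_K)\times\mathcal H_K$. There is $C_{\varepsilon,K}<\infty$ with $\|\partial_\mu V(t,\nu)(x)\|+\|\partial_x\partial_\mu V(t,\nu)(x)\|_{\mathrm{op}}\le C_{\varepsilon,K}(1+\|x\|+M_2(\nu)^{1/2})$ for $t\in[0,1)$. For every $R<\infty$, $\tau<1$ there is $C_{\varepsilon,K,R,\tau}<\infty$ with $\|\partial_\mu V(t,\nu)(x)-\partial_\mu V(t,\nu')(x')\|\le C_{\varepsilon,K,R,\tau}(\|x-x'\|+\mathcal W_2(\nu,\nu'))$ for $t\in[0,\tau]$, $\|x\|\vee\|x'\|\le R$, $M_2(\nu)\vee M_2(\nu')\le R$. Finally there is $L_{\varepsilon,K}<\infty$ with $|\int\operatorname{Tr}(Q_K\partial^2_{\mu\mu}V(t,\nu)(y)(y))\nu(dy)|\le L_{\varepsilon,K}$ for all $(t,\nu)\in[0,1)\times\mathcal P_2(\mathcal H_K)$. Particle regularity hypothesis for $v_\varepsilon^{K,N}$: its spatial gradients are locally Lipschitz in $\mathbf x$ on compact time intervals in $[0,1)$, and there is $C_{\varepsilon,K,N}<\infty$ with $\sum_i\|D_{x_i}v_\varepsilon^{K,N}(t,\mathbf x)\|\le C_{\varepsilon,K,N}(1+\|\mathbf x\|)$ for $t\in[0,1)$. Minimizer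 hypothesis: $\mathcal V_0$ is attained by some $\mu^\star\in\mathcal P_2(\mathcal H)$, and there are $\alpha\in(0,1]$ and $L_G<\infty$ with $|G(\mu)-G(\nu)|\le L_G(1+\mathcal W_2(\mu,\nu)+M_2(\mu)+M_2(\nu))\mathcal W_2(\mu,\nu)^\alpha$ for all $\mu,\nu\in\mathcal P_2(\mathcal H)$. For $X\sim\mu^\star$: $\Delta_K^{\mathrm{proj}}=\mathbb E\|(I-\Pi_K)X\|^2$ and $D^2_{CM,K}(\mu^\star)=\sum_{j=1}^K\lambda_j^{-1}\mathbb E[(X_j-x_{0,j})^2]$, with $X_j=\langle X,e_j\rangle$, $x_{0,j}=\langle x_0,e_j\rangle$. *)

(* Defs.v *)
From HB Require Import structures.
From mathcomp Require Import all_boot all_order all_algebra.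
From mathcomp Require Import all_classical all_reals all_analysis.
Set Implicit Arguments.
Unset Strict Implicit.
Unset Printing Implicit Defensive.
Import Order.TTheory GRing.Theory Num.Theory.
Import numFieldNormedType.Exports.
Local Open Scope classical_set_scope.
Local Open Scope ring_scope.

Notation borel T := (g_sigma_algebraType (@open T)).

(* The norm which the library puts on 'M[R]_(m, n) is the sup norm; it is used
   only for the topology and for differentiability.  All quantitative norms
   on vectors, and on N-tuples of vectors (the rows of an N x K matrix), are
   the Euclidean ones below. *)
Section euclidean.
Context {R : realType} {m n : nat}.

Definition mdot (x y : 'M[R]_(m, n)) : R := \sum_i \sum_j x i j * y i j.

Definition enorm (x : 'M[R]_(m, n)) : R := Num.sqrt (mdot x x).

End euclidean.

Definition opnorm {R : realType} {n : nat} (A : 'M[R]_n) : R :=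
  sup [set enorm (u *m A) | u in [set u : 'rV[R]_n | enorm u <= 1]].

(* [nrm] is the norm of the space, passed explicitly so that the definitions
   apply both to H with its own norm and to 'rV[R]_K with [enorm]. *)
Section wasserstein.
Context {R : realType} {T : normedModType R}.
Variable nrm : T -> R.

Definition P2 (mu : probability (borel T) R) : Prop :=
  (\int[mu]_x (nrm x ^+ 2)%:E < +oo)%E.

Definition M2 (mu : probability (borel T) R) : R := \int[mu]_x (nrm x ^+ 2).

Definition coupling (mu nu : probability (borel T) R)
    (pi : probability (borel T * borel T)%type R) : Prop :=
  forall A : set (borel T), measurable A ->
    pi (A `*` setT) = mu A /\ pi (setT `*` A) = nu A.

Definition W2 (mu nu : probability (borel T) R) : R :=
  Num.sqrt (fine (ereal_inf
    [set (\int[pi]_z (nrm ((z.1 : T) - (z.2 : T)) ^+ 2)%:E)%E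
      | pi in coupling mu nu])).

Definition msupport (mu : probability (borel T) R) : set T :=
  [set x | forall U : set T, open U -> U x -> (0 < mu U)%E].

End wasserstein.

Section hilbert.
Context {R : realType} {H : completeNormedModType R}.

Record is_inner_product (dot : H -> H -> R) : Prop := {
  dot_sym : forall x y, dot x y = dot y x;
  dot_linear : forall (a : R) x y z, dot (a *: x + y) z = a * dot x z + dot y z;
  dot_norm : forall x, dot x x = `|x| ^+ 2 }.

Definition separable : Prop := exists A : set H, countable A /\ dense A.

Variables (dot : H -> H -> R) (Q : {linear H -> H}) (e : nat -> H)
  (lam : nat -> R).

Record orthonormal_basis : Prop := {
  basis_orthonormal : forall i j, dot (e i) (e j) = (i == j)%:R;
  basis_total : forall x, series (fun j => dot x (e j) *: e j) @ \oo --> x }.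

(* For a positive operator, being trace class means that the series of its
   diagonal entries in an orthonormal basis converges; its sum is the trace. *)
Record covariance_operator : Prop := {
  cov_continuous : continuous Q;
  cov_sym : forall x y, dot (Q x) y = dot x (Q y);
  cov_pos : forall x, x != 0 -> 0 < dot (Q x) x;
  cov_eigen : forall j, Q (e j) = lam j *: e j;
  cov_eigen_gt0 : forall j, 0 < lam j;
  cov_trace_class : cvgn (series (fun j => dot (Q (e j)) (e j))) }.

Definition traceop : R := limn (series (fun j => dot (Q (e j)) (e j))).

(* H_K = span (e 0, ..., e K.-1) is represented by 'rV[R]_K through coordinates
   in (e j)_(j < K); [embed] is the inclusion of H_K in H and [projHK] is the
   orthogonal projection onto H_K. *)
Definition embed (K : nat) (c : 'rV[R]_K) : H := \sum_(j < K) c 0 j *: e j.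

Definition projHK (K : nat) (x : H) : 'rV[R]_K := \row_(j < K) dot x (e j).

Definition QK (K : nat) : 'M[R]_K := \matrix_(i, j) dot (Q (e j)) (e i).

(* Q_K is diagonal with entries (lam j)_(j < K) in these coordinates, which
   gives its powers 1/2 and -1/2. *)
Definition QKsqrt (K : nat) (h : 'rV[R]_K) : 'rV[R]_K :=
  \row_(j < K) (Num.sqrt (lam j) * h 0 j).

Definition QKinvsqrt (K : nat) (h : 'rV[R]_K) : 'rV[R]_K :=
  \row_(j < K) ((Num.sqrt (lam j))^-1 * h 0 j).

Definition normQK (K : nat) (h : 'rV[R]_K) : R := enorm (QKinvsqrt h).

Lemma embed_continuous K : continuous (@embed K).
Proof.
apply: (@continuous_big H 'I_K +%R 0 xpredT) => [|j _ x].
  exact: add_continuous.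
apply: (@continuousZr_tmp _ _ _ (fun c : 'rV[R]_K => c 0 j) (e j) x).
exact: coord_continuous.
Qed.

Lemma embed_measurable K :
  measurable_fun setT (@embed K : borel 'rV[R]_K -> borel H).
Proof.
apply: (@measurability _ _ (borel 'rV[R]_K) (borel H) setT (@embed K) (@open H)
  erefl) => _ [U oU <-].
rewrite setTI; apply: sub_sigma_algebra.
by apply: open_comp => // x _; exact: embed_continuous.
Qed.

Definition embed_mfun K : borel 'rV[R]_K -> borel H := @embed K.

HB.instance Definition _ K := isMeasurableFun.Build _ _ (borel 'rV[R]_K)
  (borel H) (@embed_mfun K) (@embed_measurable K).

Definition GK (G : probability (borel H) R -> R) (K : nat)
    (nu : probability (borel 'rV[R]_K) R) : R :=
  G (distribution nu (@embed_mfun K)).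

End hilbert.

(* The uniform measure on the rows of x (with multiplicity); [mnormalize] takes
   a default probability measure, used only when N = 0. *)
Section empirical.
Context {R : realType} {N K : nat}.
Variable x : 'M[R]_(N, K).

Definition sum_dirac (A : set (borel 'rV[R]_K)) : \bar R :=
  (\sum_(i < N) \d_(row i x : borel 'rV[R]_K) A)%E.

Let sum_dirac0 : sum_dirac set0 = 0%E.
Proof. by rewrite /sum_dirac big1. Qed.

Let sum_dirac_ge0 A : (0 <= sum_dirac A)%E.
Proof. by apply: sume_ge0 => i _; exact: measure_ge0. Qed.

Let sum_dirac_sigma_additive : semi_sigma_additive sum_dirac.
Proof.
move=> F mF tF mUF.
rewrite [X in X @ _ --> _](_ : _ = (fun n => \sum_(i < N)
  \sum_(0 <= k < n) \d_(row i x : borel 'rV[R]_K) (F k))%E); last first.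
  by apply/funext => n; rewrite exchange_big.
apply: cvg_nnesum => [i _|i _].
  by near=> n; apply: sume_ge0 => k _; exact: measure_ge0.
exact: measure_semi_sigma_additive.
Unshelve. all: by end_near. Qed.

HB.instance Definition _ := isMeasure.Build _ _ _ sum_dirac
  sum_dirac0 sum_dirac_ge0 sum_dirac_sigma_additive.

Definition empirical : probability (borel 'rV[R]_K) R :=
  mnormalize sum_dirac (\d_(0 : borel 'rV[R]_K)).

Lemma empiricalE (A : set (borel 'rV[R]_K)) : (0 < N)%N ->
  empirical A = ((N%:R^-1)%:E * sum_dirac A)%E.
Proof.
move=> N0.
have mass : sum_dirac setT = N%:R%:E.
  rewrite /sum_dirac (eq_bigr (fun=> 1%E)) => [|i _]; last by rewrite diracT.
  by rewrite sumEFin sumr_const card_ord.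
have E : (sum_dirac setT == 0%E) || (sum_dirac setT == +oo%E) = false.
  by rewrite mass eqe pnatr_eq0 (gtn_eqF N0).
rewrite /empirical /= /mnormalize ifF; last exact: E.
by rewrite muleC; congr (_%:E * _)%E; congr (_^-1); move/(congr1 fine): mass.
Qed.

End empirical.

Section control.
Context {R : realType} {d : measure_display} {Omega : measurableType d}.
Variables (P : probability Omega R) (F : R -> set (set Omega)).

Record filtration : Prop := {
  filtration_sigma : forall s : R, 0 <= s <= 1 -> sigma_algebra setT (F s);
  filtration_sub : forall s : R, 0 <= s <= 1 -> F s `<=` measurable;
  filtration_incr : forall s u : R, 0 <= s -> s <= u -> u <= 1 -> F s `<=` F u }.

Definition measurable_at (T : ptopologicalType) (s : R) (X : Omega -> T) :=
  measurable_fun setT (X : g_sigma_algebraType (F s) -> borel T).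

Definition has_law (T : ptopologicalType) (X : Omega -> T)
    (mu : probability (borel T) R) : Prop :=
  forall A : set (borel T), measurable A -> P (X @^-1` A) = mu A.

(* W has N independent components (its rows), each a Wiener process with
   covariance S relative to F: its increments are independent of the past, and
   each nonzero linear functional c of W u - W s is centred Gaussian with
   variance (u - s) \sum_i <S c_i, c_i>. *)
Record wiener_process (N K : nat) (S : 'M[R]_K)
    (W : R -> Omega -> 'M[R]_(N, K)) : Prop := {
  wiener0 : {ae P, forall w, W 0 w = 0};
  wiener_continuous : forall w,
    {within [set s : R | 0 <= s <= 1], continuous (W ^~ w)};
  wiener_adapted : forall s : R, 0 <= s <= 1 -> measurable_at s (W s);
  wiener_indep : forall s u : R, 0 <= s -> s <= u -> u <= 1 ->
    forall (A : set Omega) (B : set (borel 'M[R]_(N, K))),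
      F s A -> measurable B ->
      P (A `&` [set w | B (W u w - W s w)])
      = (P A * P [set w | B (W u w - W s w)%R])%E;
  wiener_gaussian : forall s u : R, 0 <= s -> s < u -> u <= 1 ->
    forall c : 'M[R]_(N, K), c != 0 -> forall B : set R, measurable B ->
      P [set w | B (mdot c (W u w - W s w))]
      = normal_prob 0 (Num.sqrt ((u - s) * \tr (c *m S *m c^T))) B }.

(* Controls and states are N-tuples of vectors of H_K (rows), N = 1 being the
   mean-field problem. *)
Definition progressive (N K : nat) (t : R)
    (theta : R -> Omega -> 'M[R]_(N, K)) : Prop :=
  forall s : R, t <= s <= 1 ->
    measurable_fun (`[t, s]%classic `*` setT)
      (fun z : R * g_sigma_algebraType (F s) =>
        theta z.1 z.2 : borel 'M[R]_(N, K)).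

Definition state (N K : nat) (W : R -> Omega -> 'M[R]_(N, K)) (t : R)
    (xi : Omega -> 'M[R]_(N, K)) (theta : R -> Omega -> 'M[R]_(N, K))
    (s : R) (w : Omega) : 'M[R]_(N, K) :=
  xi w
  + \matrix_(i, j) \int[lebesgue_measure]_(r in `[t, s]) theta r w i j
  + (W s w - W t w).

Definition energy (lam : nat -> R) (N K : nat) (t : R)
    (theta : R -> Omega -> 'M[R]_(N, K)) (w : Omega) : \bar R :=
  (\sum_(i < N) \int[lebesgue_measure]_(s in `[t, 1%R])
     (normQK lam (row i (theta s w)) ^+ 2)%:E)%E.

Definition admissible (lam : nat -> R) (N K : nat) (t : R)
    (theta : R -> Omega -> 'M[R]_(N, K)) : Prop :=
  progressive t theta /\ (\int[P]_w energy lam t theta w < +oo)%E.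

Definition particle_value (lam : nat -> R) (eps : R) (N K : nat)
    (W : R -> Omega -> 'M[R]_(N, K)) (g : probability (borel 'rV[R]_K) R -> R)
    (t : R) (x : 'M[R]_(N, K)) : R :=
  fine (ereal_inf
    [set (\int[P]_w ((N%:R * g (empirical (state W t (cst x) theta 1 w)))%:E
                     + (eps / 2)%:E * energy lam t theta w))%E
      | theta in admissible lam t]).

Definition meanfield_value (lam : nat -> R) (eps : R) (K : nat)
    (W : R -> Omega -> 'rV[R]_K) (g : probability (borel 'rV[R]_K) R -> R)
    (t : R) (nu : probability (borel 'rV[R]_K) R) : R :=
  fine (ereal_inf
    [set c | exists (xi : Omega -> 'rV[R]_K) (theta : R -> Omega -> 'rV[R]_K)
        (X1 : {mfun Omega >-> borel 'rV[R]_K}),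
      [/\ measurable_at t xi, has_law xi nu, admissible lam t theta,
          (forall w, X1 w = state W t xi theta 1 w) &
          c = ((g (distribution P X1))%:E
               + \int[P]_w ((eps / 2)%:E * energy lam t theta w))%E]]).

End control.

(* Functions of time are only considered on [0, 1[, so that the derivative at
   0 is one-sided. *)
Section time_derivative.
Context {R : realType}.

Definition time_quotient (f : R -> R) (t s : R) : R := (s - t)^-1 * (f s - f t).

Definition time_derivable (f : R -> R) (t : R) : Prop :=
  cvg (time_quotient f t @ within [set s | 0 <= s < 1] t^').

Definition Dt (f : R -> R) (t : R) : R :=
  lim (time_quotient f t @ within [set s | 0 <= s < 1] t^').

End time_derivative.

Section particle_system.
Context {R : realType} {N K : nat}.
Implicit Types v : R -> 'M[R]_(N, K) -> R.

Definition grad v (t : R) (x : 'M[R]_(N, K)) (i : 'I_N) : 'rV[R]_K :=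
  \row_j 'D_(delta_mx i j) (v t) x.

Definition hess v (t : R) (x : 'M[R]_(N, K)) (i : 'I_N) : 'M[R]_K :=
  \matrix_(j, l) 'D_(delta_mx i l) (fun y => grad v t y i 0 j) x.

Definition continuous_before1 (f : R -> 'M[R]_(N, K) -> R) : Prop :=
  {within [set z : R * 'M[R]_(N, K) | 0 <= z.1 < 1],
    continuous (fun z => f z.1 z.2)}.

Record regular_C12 v : Prop := {
  C12_dt : forall (t : R) x, 0 <= t < 1 -> time_derivable (v ^~ x) t;
  C12_dt_cont : continuous_before1 (fun (t : R) x => Dt (v ^~ x) t);
  C12_grad : forall (t : R) x i j, 0 <= t < 1 -> derivable (v t) x (delta_mx i j);
  C12_grad_cont : forall i j, continuous_before1 (fun (t : R) x => grad v t x i 0 j);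
  C12_hess : forall (t : R) x i j k l, 0 <= t < 1 ->
    derivable (fun y => grad v t y i 0 j) x (delta_mx k l);
  C12_hess_cont : forall i j k l, continuous_before1
    (fun (t : R) x => 'D_(delta_mx k l) (fun y => grad v t y i 0 j) x) }.

Record HJB_classical_solution (lam : nat -> R) (S : 'M[R]_K) (eps : R)
    (g : probability (borel 'rV[R]_K) R -> R) v : Prop := {
  HJB_regular : regular_C12 v;
  HJB_continuous : {within [set z : R * 'M[R]_(N, K) | 0 <= z.1 <= 1],
    continuous (fun z => v z.1 z.2)};
  HJB_equation : forall (t : R) x, 0 <= t < 1 ->
    Dt (v ^~ x) t + 2^-1 * (\sum_i \tr (S *m hess v t x i))
    - (2 * eps)^-1 * (\sum_i enorm (QKsqrt lam (grad v t x i)) ^+ 2) = 0;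
  HJB_terminal : forall x, v 1 x = N%:R * g (empirical x) }.

Record particle_regularity v : Prop := {
  particle_lipschitz : forall r tau : R, tau < 1 -> exists C : R,
    forall (t : R) x y, 0 <= t <= tau -> enorm x <= r -> enorm y <= r ->
    forall i, enorm (grad v t x i - grad v t y i) <= C * enorm (x - y);
  particle_growth : exists C : R, forall (t : R) x, 0 <= t < 1 ->
    \sum_i enorm (grad v t x i) <= C * (1 + enorm x) }.

End particle_system.

Section master_equation.
Context {R : realType} {d : measure_display} {Omega : measurableType d}.
Variable P : probability Omega R.
Context {K : nat}.
Local Notation prob := (probability (borel 'rV[R]_K) R).
Local Notation E := (@enorm R 1 K).

Definition square_integrable (X : Omega -> 'rV[R]_K) : Prop :=
  (\int[P]_w (enorm (X w) ^+ 2)%:E < +oo)%E.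

Definition L2norm (X : Omega -> 'rV[R]_K) : R :=
  Num.sqrt (\int[P]_w (enorm (X w) ^+ 2)).

(* g is the Lions derivative of U at mu: at each square-integrable X of law
   mu, the lift Y |-> U (law of Y) is Frechet differentiable on L^2(Omega; H_K)
   with gradient g \o X, where g is in L^2(mu). *)
Definition is_lions_derivative (U : prob -> R) (mu : prob)
    (g : 'rV[R]_K -> 'rV[R]_K) : Prop :=
  [/\ measurable_fun setT (g : borel 'rV[R]_K -> borel 'rV[R]_K),
      (\int[mu]_x (enorm (g x) ^+ 2)%:E < +oo)%E &
      forall X : {mfun Omega >-> borel 'rV[R]_K},
        has_law P X mu -> square_integrable X ->
        forall eta : R, 0 < eta -> exists2 delta : R, 0 < delta &
          forall Y : {mfun Omega >-> borel 'rV[R]_K}, square_integrable Y ->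
            L2norm (Y \- X) <= delta ->
            `|U (distribution P Y) - U mu
              - \int[P]_w mdot (g (X w)) (Y w - X w)|
            <= eta * L2norm (Y \- X)].

Definition continuous_on_support (n m : nat)
    (f : R -> prob -> 'rV[R]_K -> 'M[R]_(n, m)) : Prop :=
  forall (t : R) nu x, 0 <= t < 1 -> P2 E nu -> msupport nu x ->
    forall eta : R, 0 < eta -> exists2 delta : R, 0 < delta &
      forall (t' : R) nu' x', 0 <= t' < 1 -> P2 E nu' ->
        `|t' - t| < delta -> W2 E nu' nu < delta -> enorm (x' - x) < delta ->
        enorm (f t' nu' x' - f t nu x) < eta.

Definition locally_bounded (n m : nat)
    (f : R -> prob -> 'rV[R]_K -> 'M[R]_(n, m)) : Prop :=
  forall r : R, exists C : R, forall (t : R) nu x,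
    0 <= t < 1 -> P2 E nu -> M2 E nu <= r -> enorm x <= r ->
    enorm (f t nu x) <= C.

(* dmu t nu x is the version of the derivative of V t in the measure argument,
   'J (dmu t nu) x its spatial derivative (the Jacobian matrix acting on
   rows), and d2mu t nu x y the second Lions derivative, with row i the Lions
   derivative of nu |-> (dmu t nu x)_i. *)
Record master_solution (lam : nat -> R) (S : 'M[R]_K) (eps L : R)
    (g : prob -> R) (V : R -> prob -> R)
    (dmu : R -> prob -> 'rV[R]_K -> 'rV[R]_K)
    (d2mu : R -> prob -> 'rV[R]_K -> 'rV[R]_K -> 'M[R]_K) : Prop := {
  master_continuous : forall (t : R) nu, 0 <= t <= 1 -> P2 E nu ->
    forall eta : R, 0 < eta -> exists2 delta : R, 0 < delta &
      forall (t' : R) nu', 0 <= t' <= 1 -> P2 E nu' ->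
        `|t' - t| < delta -> W2 E nu' nu < delta ->
        `|V t' nu' - V t nu| < eta;
  master_terminal : forall nu, P2 E nu -> V 1 nu = g nu;
  master_dt : forall (t : R) nu, 0 <= t < 1 -> P2 E nu -> time_derivable (V ^~ nu) t;
  master_dmu : forall (t : R) nu, 0 <= t < 1 -> P2 E nu ->
    is_lions_derivative (V t) nu (dmu t nu);
  master_dxdmu : forall (t : R) nu x, 0 <= t < 1 -> P2 E nu ->
    differentiable (dmu t nu) x;
  master_d2mu : forall (t : R) nu x i, 0 <= t < 1 -> P2 E nu ->
    is_lions_derivative (fun nu' => dmu t nu' x 0 i) nu
      (fun y => row i (d2mu t nu x y));
  master_dmu_cont : continuous_on_support dmu;
  master_dxdmu_cont :
    continuous_on_support (fun (t : R) nu x => 'J (dmu t nu) x);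
  master_dmu_bounded : locally_bounded dmu;
  master_dxdmu_bounded : locally_bounded (fun (t : R) nu x => 'J (dmu t nu) x);
  master_pde : forall (t : R) nu, 0 <= t < 1 -> P2 E nu ->
    Dt (V ^~ nu) t
    + 2^-1 * \int[nu]_x \tr (S *m 'J (dmu t nu) x)
    - (2 * eps)^-1 * \int[nu]_x enorm (QKsqrt lam (dmu t nu x)) ^+ 2 = 0;
  master_growth : exists C : R, forall (t : R) nu x, 0 <= t < 1 -> P2 E nu ->
    enorm (dmu t nu x) + opnorm ('J (dmu t nu) x)
    <= C * (1 + enorm x + Num.sqrt (M2 E nu));
  master_lipschitz : forall r tau : R, tau < 1 -> exists C : R,
    forall (t : R) nu nu' x x', 0 <= t <= tau -> P2 E nu -> P2 E nu' ->
      M2 E nu <= r -> M2 E nu' <= r -> enorm x <= r -> enorm x' <= r ->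
      enorm (dmu t nu x - dmu t nu' x') <= C * (enorm (x - x') + W2 E nu nu');
  master_d2mu_integrable : forall (t : R) nu, 0 <= t < 1 -> P2 E nu ->
    nu.-integrable setT (fun y => (\tr (S *m d2mu t nu y y))%:E);
  master_d2mu_bound : forall (t : R) nu, 0 <= t < 1 -> P2 E nu ->
    `|\int[nu]_y \tr (S *m d2mu t nu y y)| <= L }.

End master_equation.

Section hypotheses.
Context {R : realType} {H : completeNormedModType R}.
Variables (dot : H -> H -> R) (Q : {linear H -> H}) (e : nat -> H)
  (lam : nat -> R) (G : probability (borel H) R -> R).
Local Notation nrm := (fun x : H => `|x|).

Definition V0 : R := inf [set G mu | mu in P2 nrm].

Section stochastic_basis.
Context {d : measure_display} {Omega : measurableType d}.
Variables (P : probability Omega R) (F : R -> set (set Omega))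
  (W : forall N K : nat, R -> Omega -> 'M[R]_(N, K)).

(* The filtered probability space on which all control problems are posed: it
   carries N independent Q_K-Wiener processes for all N and K, and enough
   randomness at time 0 to realise all laws on H. *)
Record stochastic_basis : Prop := {
  basis_filtration : filtration F;
  basis_wiener : forall N K, wiener_process P F (QK dot Q e K) (W N K);
  basis_rich : forall mu : probability (borel H) R,
    exists2 xi : Omega -> H, measurable_at F 0 xi & has_law P xi mu }.

Definition vKN (eps : R) (K N : nat) : R -> 'M[R]_(N, K) -> R :=
  particle_value P F lam eps (W N K) (GK e G (K := K)).

Definition VK (eps : R) (K : nat) : R -> probability (borel 'rV[R]_K) R -> R :=
  meanfield_value P F lam eps (W 1 K) (GK e G (K := K)).

Record master_hypothesis (L : R -> nat -> R) : Prop := {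
  G_bounded_below : exists m : R, forall mu, P2 nrm mu -> m <= G mu;
  G_continuous : forall mu, P2 nrm mu -> forall eta : R, 0 < eta ->
    exists2 delta : R, 0 < delta & forall nu, P2 nrm nu ->
      W2 nrm nu mu < delta -> `|G nu - G mu| < eta;
  G_growth : exists C : R, forall mu, P2 nrm mu -> `|G mu| <= C * (1 + M2 nrm mu);
  G_master : forall (eps : R) (K : nat), 0 < eps -> (0 < K)%N ->
    exists dmu d2mu, master_solution P lam (QK dot Q e K) eps (L eps K)
      (GK e G (K := K)) (VK eps (K := K)) dmu d2mu }.

End stochastic_basis.

Record minimizer_hypothesis (mustar : probability (borel H) R) (alpha : R)
    : Prop := {
  minimizer_P2 : P2 nrm mustar;
  minimizer_attains : G mustar = V0;
  minimizer_alpha : 0 < alpha <= 1;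
  minimizer_holder : exists L : R, forall mu nu, P2 nrm mu -> P2 nrm nu ->
    `|G mu - G nu|
    <= L * (1 + W2 nrm mu nu + M2 nrm mu + M2 nrm nu) * W2 nrm mu nu `^ alpha }.

(* Expectations of functions of X with X of law mu. *)
Definition Delta_proj (mu : probability (borel H) R) (K : nat) : R :=
  \int[mu]_x (`|(x : H) - embed e (projHK dot e K x)| ^+ 2).

Definition D2_CM (x0 : H) (mu : probability (borel H) R) (K : nat) : R :=
  \sum_(j < K) (lam j)^-1 * \int[mu]_x ((dot x (e j) - dot x0 (e j)) ^+ 2).

End hypotheses.

(* Main.v *)
(** Every control costs at least N V0, hence the lower bound.

    For the upper bound compare v with u(t, x) = N V(t, mu^N_x), where V is the
    mean-field value.  Lions derivatives at empirical measures turn into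
    partial derivatives of u, so the master equation says that u solves the
    particle equation up to the term (2N)^-1 sum_i Tr(Q_K d2mu V(x_i)(x_i)),
    which is bounded by L / 2; the maximum principle then gives
    v <= u + L / 2 (1 - t).

    It remains to bound V(0, delta_{Pi x0}) by one explicit control.  With
    X ~ mustar known at time 0 and delta = eps^(2 / alpha), take the drift
    Pi (X - x0) - (1 - delta) / (1 - (1 - delta) t) B_t, where B is the part of
    the state driven by the noise.  It steers Pi x0 to Pi X + B_1, where B_1
    has covariance delta Q_K, and costs at most D2_CM + K ln (1 / delta).
    Hence the final law is close to mustar in W2, and the Hoelder bound on G
    concludes.  The drift is frozen on a time grid, so that no stochastic
    differential equation has to be solved; this costs a factor 2 in the
    covariance of B_1. *)
From HB Require Import structures.
Require Import Defs.
From mathcomp Require Import all_boot all_order all_algebra.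
From mathcomp Require Import all_classical all_reals all_analysis.
From mathcomp Require Import ring lra measurable_realfun.
Set Implicit Arguments.
Unset Strict Implicit.
Unset Printing Implicit Defensive.
Import Order.TTheory GRing.Theory Num.Theory.
Import numFieldNormedType.Exports.
Local Open Scope classical_set_scope.
Local Open Scope ring_scope.

(** * Integrals and measurability *)

(** The Lions derivative is defined through random variables on the given [Omega], whereas particles
    are points. A uniform random label on [Omega] links the two: a configuration becomes a random
    variable whose law is its empirical measure, and moving one particle moves that variable on an
    event of probability 1/N.

    Since v - u is only known to grow at most quadratically from above, a quartic barrier forces a
    maximum; convexity of the Hamiltonian leaves a linear inequality whose drift comes from u alone.

    For the continuous drift put s(t) = 1 - (1 - delta) t. Per unit eigenvalue B_t has variance s(t)
    t, so its energy is the integral of (1 - delta)^2 t / s(t), at most ln (1 / delta). With delta =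
    eps^(2 / alpha) the noise part of the Hoelder error is of order eps, and (eps / 2) K ln (1 /
    delta) is the last term of the bound. A mesh h <= delta^2 gives an Euler factor 1 + h / delta <=
    1 + delta, which the energy absorbs because (1 + delta)(1 - delta) <= 1. *)

Section integral_monotone.
Local Open Scope ereal_scope.
Context {R : realType} {d : measure_display} {T : measurableType d}.
Variable mu : {measure set T -> \bar R}.

(* The integrands of the control problems are not known to be measurable. *)
Lemma ge0_le_integral_nonmeasurable (f g : T -> \bar R) :
  (forall x, 0 <= f x) -> (forall x, f x <= g x) ->
  \int[mu]_x f x <= \int[mu]_x g x.
Proof.
move=> f0 fg.
have g0 x : 0 <= g x := le_trans (f0 x) (fg x).
rewrite !ge0_integralTE//; apply: le_ereal_sup => _ [h /= hf <-].
by exists h => // x; exact: le_trans (hf x) (fg x).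
Qed.

Lemma le_integral_nonmeasurable (f g : T -> \bar R) :
  (forall x, f x <= g x) -> \int[mu]_x f x <= \int[mu]_x g x.
Proof.
move=> fg; rewrite [leLHS]integralE [leRHS]integralE.
apply: leeB; apply: ge0_le_integral_nonmeasurable => // x.
  by rewrite !funeposE ge_max !le_max fg lexx orbT.
by rewrite !funenegE ge_max le_max le_max lexx orbT andbT leeN2 fg.
Qed.

End integral_monotone.

Lemma continuous_borel_measurable {R : realType} (T : ptopologicalType)
    (f : T -> R) :
  continuous f -> measurable_fun setT (f : borel T -> R).
Proof.
move=> cf; apply: (measurability _ (RGenOInfty.measurableE R)).
move=> _ [_ [a ->] <-].
rewrite setTI; apply: sub_sigma_algebra.
by apply: open_comp => //; exact: open_gt.
Qed.

Section matrix_measurable.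
Context {R : realType} {m n : nat}.

Lemma mxcoord_measurable (i : 'I_m) (j : 'I_n) :
  measurable_fun setT (fun M : borel 'M[R]_(m, n) => (M : 'M[R]_(m, n)) i j).
Proof. apply: continuous_borel_measurable; exact: coord_continuous. Qed.

(** The index type is countable, so writing open sets as unions of boxes reduces Borel measurability
    of a matrix-valued map to that of its entries. *)
Let box (q : 'M[rat]_(m, n) * nat) : set 'M[R]_(m, n) :=
  [set M | forall i j, `|M i j - ratr (q.1 i j)| < q.2.+1%:R^-1].

Lemma open_bigcup_box (U : set 'M[R]_(m, n)) : open U ->
  U = \bigcup_(q in [set q | box q `<=` U]) box q.
Proof.
move=> oU; apply/seteqP; split=> [M UM|M [q qU qM]]; last exact: qU.
have /nbhs_ballP[e /= e0 eU] : nbhs M U by exact: open_nbhs_nbhs.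
(* Two points of a box differ by less than twice its radius, so a radius below [e / 2] keeps the box
   around [M] inside the ball. *)
pose k := Num.trunc (2 / e).
have ke : k.+1%:R^-1 < e / 2.
  rewrite invf_plt ?posrE ?divr_gt0// invf_div.
  exact: truncnS_gt.
have k0 : (0 : R) < k.+1%:R^-1 by rewrite invr_gt0.
have P i j : exists q : rat, `|M i j - ratr q| < k.+1%:R^-1.
  move: (k.+1%:R^-1) k0 => c c0.
  have h : M i j - c < M i j + c by lra.
  have [q] := rat_in_itvoo h.
  rewrite in_itv/= => /andP[q1 q2]; exists q.
  by rewrite ltr_distlC; apply/andP; split; lra.
pose q := \matrix_(i, j) sval (cid (P i j)).
have qP i j : `|M i j - ratr (q i j)| < k.+1%:R^-1.
  by rewrite mxE; exact: (svalP (cid (P i j))).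
exists (q, k) => //= M' M'q; apply: eU; split=> // i j.
rewrite /ball /=.
have := qP i j; have := M'q i j => /=.
move: (k.+1%:R^-1) ke => c ke.
rewrite !ltr_norml => /andP[? ?] /andP[? ?].
by apply/andP; split; lra.
Qed.

Lemma mx_measurable_in {d} {T : measurableType d} (D : set T)
    (f : T -> borel 'M[R]_(m, n)) : measurable D ->
  (forall i j, measurable_fun D (fun w => (f w : 'M[R]_(m, n)) i j)) ->
  measurable_fun D f.
Proof.
move=> mD mf.
apply: (@measurability _ _ T (borel 'M[R]_(m, n)) D f (@open 'M[R]_(m, n))
  erefl) => _ [U oU <-].
rewrite (open_bigcup_box oU) preimage_bigcup setI_bigcupr.
rewrite bigcup_mkcond; apply: countable_bigcupT_measurable => [|q].
  exact: countableP.
case: ifP => // _.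
rewrite (_ : D `&` f @^-1` box q = D `&` \bigcap_(ij in [set: 'I_m * 'I_n])
   (D `&` (fun w => (f w : 'M[R]_(m, n)) ij.1 ij.2) @^-1`
     [set x | `|x - ratr (q.1 ij.1 ij.2)| < q.2.+1%:R^-1])); last first.
  apply/seteqP; split=> [w [Dw fw]|w [Dw fw]]; split=> //.
    by move=> ij _; split=> //; exact: fw.
  by move=> i j; have [] := fw (i, j) Logic.I.
apply: measurableI => //.
apply: fin_bigcap_measurable => [|ij _]; first exact: finite_finset.
apply: mf => //.
move: (ratr _) (_^-1) => a c.
rewrite (_ : [set x | _] = `]a - c, a + c[%classic) //.
apply/seteqP; split=> x /=; rewrite in_itv/= ltr_norml.
  by move=> /andP[? ?]; apply/andP; split; lra.
by move=> /andP[? ?]; apply/andP; split; lra.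
Qed.

Lemma mx_measurable {d} {T : measurableType d} (f : T -> borel 'M[R]_(m, n)) :
  (forall i j, measurable_fun setT (fun w => (f w : 'M[R]_(m, n)) i j)) ->
  measurable_fun setT f.
Proof. exact: mx_measurable_in. Qed.

Lemma mdot_measurable {d} {T : measurableType d} (f g : T -> borel 'M[R]_(m, n)) :
  measurable_fun setT f -> measurable_fun setT g ->
  measurable_fun setT (fun w => mdot (f w : 'M[R]_(m, n)) (g w)).
Proof.
move=> mf mg; rewrite /mdot.
apply: measurable_sum => i; apply: measurable_sum => j.
apply: measurable_funM; apply: measurableT_comp (mxcoord_measurable i j) _ => //.
Qed.

End matrix_measurable.

Section density.
Local Open Scope ereal_scope.
Context {R : realType} {d : measure_display} {T : measurableType d}.
Variables (mu nu : {measure set T -> \bar R}) (p : T -> R).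
Hypothesis mp : measurable_fun setT p.
Hypothesis p0 : forall x, (0 <= p x)%R.
Hypothesis nuE : forall A, measurable A -> nu A = \int[mu]_(x in A) (p x)%:E.

Import HBNNSimple.

(** An upper bound is enough for the Gaussian second moment. For a simple function below [f] the two
    integrals agree, by [nuE] on each level set. *)
Lemma integral_density_le (f : T -> R) :
  measurable_fun setT f -> (forall x, 0 <= f x)%R ->
  \int[nu]_x (f x)%:E <= \int[mu]_x (f x * p x)%:E.
Proof.
move=> mf f0; rewrite ge0_integralTE; last by move=> x; rewrite lee_fin.
apply: ge_ereal_sup => _ [h /= hf <-].
apply: (@le_trans _ _ (\int[mu]_x (h x * p x)%:E)); last first.
  apply: ge0_le_integral => //.
  - by move=> x _; rewrite lee_fin mulr_ge0.
  - by apply/measurable_EFinP; exact: measurable_funM.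
  - by apply/measurable_EFinP; exact: measurable_funM.
  - by move=> x _; rewrite lee_fin ler_wpM2r// -lee_fin.
rewrite sintegralE.
under [leRHS]eq_integral.
  move=> x _; rewrite EFinM fimfunE -fsumEFin// ge0_mule_fsuml; last first.
    by move=> r; rewrite EFinM nnfun_muleindic_ge0.
  over.
rewrite [leRHS]ge0_integral_fsum//; last 2 first.
  - move=> r; under eq_fun do rewrite -EFinM.
    by apply/measurable_EFinP; apply: measurable_funM => //; exact: measurable_funM.
  - move=> r x _; rewrite mule_ge0 ?lee_fin//.
    by rewrite -lee_fin EFinM nnfun_muleindic_ge0.
rewrite le_eqVlt; apply/orP; left; apply/eqP.
apply: eq_fsbigr => r; rewrite inE /= => -[x _ hx].
have r0 : (0 <= r)%R by rewrite -hx.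
under eq_integral do rewrite EFinM -muleA.
rewrite ge0_integralZl//.
- rewrite nuE//; congr (_ * _).
  rewrite integral_mkcond; apply: eq_integral => y _.
  rewrite /patch indicE; case: ifPn => _; first by rewrite mul1e.
  by rewrite mul0e.
- under eq_fun do rewrite -EFinM.
  by apply/measurable_EFinP; exact: measurable_funM.
- by move=> y _; rewrite -EFinM lee_fin mulr_ge0.
Qed.

End density.

Section normal_moment.
Context {R : realType}.
Local Notation mu := (@lebesgue_measure R).

(** Integration by parts in differential form: the centred density p satisfies p' = - (x / s^2) p,
    so x^2 p and s^2 p differ by an exact derivative. *)
Lemma normal_pdf_is_derive (s x : R) : 0 < s ->
  is_derive x 1 (fun y : R => - (s ^+ 2 * y * normal_pdf 0 s y))
    (x ^+ 2 * normal_pdf 0 s x - s ^+ 2 * normal_pdf 0 s x).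
Proof.
move=> s0; have sn0 : s != 0 by rewrite gt_eqF.
rewrite normal_pdfE//.
have E : is_derive x 1 (normal_fun 0 s) (- (x / s ^+ 2) * normal_fun 0 s x).
  rewrite /normal_fun.
  have D : is_derive x 1 (fun y : R => - (y - 0) ^+ 2 / (s ^+ 2 *+ 2))
      (- (x / s ^+ 2)).
    apply: is_derive_eq.
    by rewrite /GRing.scale/=; field.
  have := @is_derive1_comp _ (@expR R) _ x _ _ (is_derive_expR _) D.
  by rewrite mulrC.
apply: is_derive_eq.
by rewrite /GRing.scale/=; field.
Qed.

(** Monotone convergence along symmetric intervals, on which the fundamental theorem of calculus
    applies and the two boundary terms combine. *)
Lemma ge0_integral_le_symmetric_itv (f : R -> R) (c : \bar R) :
  measurable_fun setT f -> (forall x, 0 <= f x) ->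
  (forall n, \int[mu]_(x in `[(- n.+1%:R)%R, n.+1%:R%R]) (f x)%:E <= c)%E ->
  (\int[mu]_x (f x)%:E <= c)%E.
Proof.
move=> mf f0 fc.
pose g n := (fun x => (f x)%:E) \_ (`[- n.+1%:R, n.+1%:R]%classic : set R).
have gn n x : g n x = if - n.+1%:R <= x <= n.+1%:R then (f x)%:E else 0%E.
  by rewrite /g patchE mem_setE in_itv.
have -> : (\int[mu]_x (f x)%:E = \int[mu]_x limn (g^~ x))%E.
  apply: eq_integral => x _; apply/esym/cvg_lim => //.
  apply: cvg_near_cst; near=> n; rewrite gn ifT//.
  rewrite -ler_norml; apply: ltW.
  rewrite (lt_le_trans (truncnS_gt _))// ler_nat ltnS.
  by near: n; exact: nbhs_infty_ge.
rewrite monotone_convergence//.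
- apply: lime_le; last by apply: nearW => n; rewrite -integral_mkcond.
  apply: ereal_nondecreasing_is_cvgn => m n mn.
  apply: ge0_le_integral_nonmeasurable => x; rewrite !gn; first by case: ifP => //; rewrite lee_fin.
  case: ifP => [|_]; last by case: ifP => //; rewrite lee_fin.
  move=> /andP[h1 h2]; rewrite ifT//.
  have : m.+1%:R <= n.+1%:R :> R by rewrite ler_nat.
  by move=> h; apply/andP; split; lra.
- move=> n; apply/(measurable_restrictT _ _).1 => //.
  by apply: measurable_funTS; exact/measurable_EFinP.
- by move=> n x _; rewrite gn; case: ifP => //; rewrite lee_fin.
- move=> x _ m n mn; rewrite !gn; case: ifP => [|_]; last by case: ifP => //; rewrite lee_fin.
  move=> /andP[h1 h2]; rewrite ifT//.
  have : m.+1%:R <= n.+1%:R :> R by rewrite ler_nat.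
  by move=> h; apply/andP; split; lra.
Unshelve. all: by end_near. Qed.

Let measurable_sqr : measurable_fun setT (fun x : R => x ^+ 2).
Proof. by apply: continuous_measurable_fun; exact: exprn_continuous. Qed.

Lemma normal_prob_second_moment (s : R) : 0 < s ->
  (\int[normal_prob 0 s]_x (x ^+ 2)%:E <= (s ^+ 2)%:E)%E.
Proof.
move=> s0; have sn0 : s != 0 by rewrite gt_eqF.
have mp := measurable_normal_pdf 0 s.
have p0 := normal_pdf_ge0 0 s.
have cp := continuous_normal_pdf sn0 (m := 0).
have dens := integral_density_le (mu := mu) (nu := normal_prob 0 s) mp p0
  (fun A mA => erefl) measurable_sqr (@sqr_ge0 R).
apply: le_trans dens _.
apply: ge0_integral_le_symmetric_itv => [|x|n].
- by apply: measurable_funM => //; exact: measurable_sqr.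
- by rewrite mulr_ge0// sqr_ge0.
pose F y := - (s ^+ 2 * y * normal_pdf 0 s y).
pose f x := x ^+ 2 * normal_pdf 0 s x - s ^+ 2 * normal_pdf 0 s x.
have dF (x : R) : is_derive x 1 F (f x) by exact: normal_pdf_is_derive.
have n0 : (0 : R) < n.+1%:R by rewrite ltr0n.
have cf : continuous f.
  move=> x; apply: cvgB; apply: cvgM; [exact: exprn_continuous|exact: cp|exact: cvg_cst|exact: cp].
have cF : continuous F.
  move=> x; apply: differentiable_continuous; apply/derivable1_diffP.
  by have [] := dF x.
have ab : - n.+1%:R < n.+1%:R :> R by lra.
have dFLR : derivable_oo_LRcontinuous F (- n.+1%:R) n.+1%:R.
  split=> [x _||]; first by have [] := dF x.
    by apply: cvg_at_right_filter; exact: cF.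
  by apply: cvg_at_left_filter; exact: cF.
have F'f : {in `]- n.+1%:R, n.+1%:R[, F^`()%classic =1 f}.
  by move=> x _; rewrite derive1E; have [] := dF x.
have Fn := continuous_FTC2 ab (continuous_subspaceT cf) dFLR F'f.
have FnE : F n.+1%:R = - (s ^+ 2 * n.+1%:R * normal_pdf 0 s n.+1%:R) by [].
have pN : normal_pdf 0 s (- n.+1%:R) = normal_pdf 0 s n.+1%:R.
  by rewrite normal_pdfE// /normal_fun !subr0 sqrrN.
have FNnE : F (- n.+1%:R) = s ^+ 2 * n.+1%:R * normal_pdf 0 s n.+1%:R.
  by rewrite /F pN; ring.
rewrite FnE FNnE in Fn.
pose I : set R := `[- n.+1%:R, n.+1%:R]%classic.
have mI : measurable I by exact: measurable_itv.
have mf : measurable_fun I f.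
  by apply: measurable_funTS; exact: continuous_measurable_fun.
have intf : mu.-integrable I (EFin \o f).
  apply: continuous_compact_integrable; first exact: segment_compact.
  exact: continuous_subspaceT.
have intp : mu.-integrable I
    (fun x => (s ^+ 2 * normal_pdf 0 s x)%:E).
  under eq_fun do rewrite EFinM.
  apply: integrableZl => //.
  exact: integrableS (integrable_normal_pdf 0 s).
rewrite (_ : (fun x => _) = (fun x => (f x)%:E + (s ^+ 2 * normal_pdf 0 s x)%:E)%E).
  rewrite integralD// Fn.
  (* The boundary term is -2 s^2 a p(a) with a = [n.+1], hence nonpositive. *)
  apply: (@le_trans _ _ (0 + \int[mu]_(x in `[(- n.+1%:R)%R, n.+1%:R%R]) (s ^+ 2 * normal_pdf 0 s x)%:E)%E).
    apply: leeD2r; rewrite -EFinB lee_fin.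
    have : 0 <= s ^+ 2 * n.+1%:R * normal_pdf 0 s n.+1%:R.
      by rewrite mulr_ge0 ?p0// mulr_ge0 ?sqr_ge0//.
    by move=> h; lra.
  rewrite add0e; under eq_integral do rewrite EFinM.
  rewrite ge0_integralZl//; last 3 first.
  - by apply: measurable_funTS; exact/measurable_EFinP.
  - by move=> x _; rewrite lee_fin.
  - by rewrite lee_fin sqr_ge0.
  rewrite -[leRHS]mule1 lee_pmul2l//; last by rewrite lte_fin exprn_gt0.
  rewrite -(integral_normal_pdf 0 s); apply: ge0_subset_integral => //.
  - exact/measurable_EFinP.
  - by move=> x _; rewrite lee_fin.
by apply/funext => x; rewrite -EFinD /f subrK.
Qed.

End normal_moment.

Section law.
Context {R : realType} {d d' : measure_display} {T : measurableType d}
  {T' : measurableType d'}.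
Local Open Scope ereal_scope.

Lemma ge0_integral_law (mu : {measure set T -> \bar R})
    (nu : {measure set T' -> \bar R}) (X : T -> T') (f : T' -> \bar R) :
  measurable_fun setT X ->
  (forall A, measurable A -> mu (X @^-1` A) = nu A) ->
  measurable_fun setT f -> (forall x, 0 <= f x) ->
  \int[nu]_x f x = \int[mu]_w f (X w).
Proof.
move=> mX XE mf f0.
have := ge0_integral_pushforward mX mu measurableT mf (in1W f0).
rewrite preimage_setT => <-.
by apply: eq_measure_integral => A mA _; rewrite -XE.
Qed.

Lemma integral_law (mu : {measure set T -> \bar R})
    (nu : {measure set T' -> \bar R}) (X : T -> T') (f : T' -> \bar R) :
  measurable_fun setT X ->
  (forall A, measurable A -> mu (X @^-1` A) = nu A) ->
  measurable_fun setT f ->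
  \int[nu]_x f x = \int[mu]_w f (X w).
Proof.
move=> mX XE mf; rewrite [LHS]integralE [RHS]integralE.
rewrite (ge0_integral_law mX XE (measurable_funepos mf) (funepos_ge0 f)).
rewrite (ge0_integral_law mX XE (measurable_funeneg mf) (funeneg_ge0 f)).
by congr (_ - _); apply: eq_integral => w _; rewrite ?funeposE ?funenegE.
Qed.

End law.

Section square_integrable_real.
Context {R : realType} {d : measure_display} {T : measurableType d}.
Variable P : probability T R.

Definition L2 (Y : T -> R) : Prop :=
  measurable_fun setT Y /\ P.-integrable setT (fun w => (Y w ^+ 2)%:E).

Lemma L2P (Y : T -> R) : measurable_fun setT Y ->
  (\int[P]_w (Y w ^+ 2)%:E < +oo)%E -> L2 Y.
Proof.
move=> mY Yoo; split=> //; apply/integrableP; split.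
  by apply/measurable_EFinP; exact: measurable_funX.
by under eq_integral do rewrite gee0_abs ?lee_fin ?sqr_ge0//.
Qed.

Lemma L2_mul (Y Z : T -> R) : L2 Y -> L2 Z ->
  P.-integrable setT (fun w => (Y w * Z w)%:E).
Proof.
move=> [mY iY] [mZ iZ].
apply: (@le_integrable _ _ _ _ _ measurableT _
  (fun w => (Y w ^+ 2)%:E + (Z w ^+ 2)%:E)%E); last exact: integrableD.
  by apply/measurable_EFinP; exact: measurable_funM.
move=> w _; rewrite -EFinD !abse_EFin lee_fin [leRHS]ger0_norm ?addr_ge0 ?sqr_ge0//.
rewrite normrM -(real_normK (num_real (Y w))) -(real_normK (num_real (Z w))).
move: `|Y w| (normr_ge0 (Y w)) `|Z w| (normr_ge0 (Z w)) => y y0 z z0; nra.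
Qed.

Lemma L2_cst (c : R) : L2 (fun=> c).
Proof.
split; first exact: measurable_cst.
by apply: finite_measure_integrable_cst.
Qed.

Lemma L2Z (a : R) (Y : T -> R) : L2 Y -> L2 (fun w => a * Y w).
Proof.
move=> [mY iY]; split; first exact: measurable_funM.
under eq_fun do rewrite exprMn EFinM.
exact: integrableZl.
Qed.

Lemma L2D (Y Z : T -> R) : L2 Y -> L2 Z -> L2 (fun w => Y w + Z w).
Proof.
move=> hY hZ; have [mY iY] := hY; have [mZ iZ] := hZ.
split; first exact: measurable_funD.
have -> : (fun w => ((Y w + Z w) ^+ 2)%:E) =
    (fun w => (Y w ^+ 2)%:E + (2%:E * (Y w * Z w)%:E + (Z w ^+ 2)%:E))%E.
  by apply/funext => w; rewrite -EFinM -!EFinD; congr EFin; ring.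
apply: integrableD => //; apply: integrableD => //.
by apply: integrableZl => //; exact: L2_mul.
Qed.

Lemma second_moment_lincomb (a b : R) (Y Z : T -> R) : L2 Y -> L2 Z ->
  \int[P]_w (Y w * Z w) = 0 ->
  \int[P]_w ((a * Y w + b * Z w) ^+ 2) =
  a ^+ 2 * \int[P]_w (Y w ^+ 2) + b ^+ 2 * \int[P]_w (Z w ^+ 2).
Proof.
move=> hY hZ YZ0; have [mY iY] := hY; have [mZ iZ] := hZ.
have iYZ := L2_mul hY hZ.
have -> : (fun w => (a * Y w + b * Z w) ^+ 2) =
    (fun w => a ^+ 2 * Y w ^+ 2 + (2 * a * b * (Y w * Z w) + b ^+ 2 * Z w ^+ 2)).
  by apply/funext => w; ring.
have iZl c f : P.-integrable setT (EFin \o f) ->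
    P.-integrable setT (EFin \o (fun w => c * f w)).
  by move=> fi; rewrite /comp; under eq_fun do rewrite EFinM; exact: integrableZl.
rewrite RintegralD//; [|exact: iZl|]; last first.
  by rewrite /comp; under eq_fun do rewrite EFinD; apply: integrableD => //; exact: iZl.
rewrite RintegralD//; [|exact: iZl|exact: iZl].
by rewrite !RintegralZl// YZ0 mulr0 add0r.
Qed.

Lemma L2_Rintegral (Y : T -> R) : L2 Y ->
  ((\int[P]_w (Y w ^+ 2))%:E = \int[P]_w (Y w ^+ 2)%:E)%E.
Proof.
by move=> [mY iY]; rewrite /Rintegral fineK//; exact: integrable_fin_num.
Qed.

(* The joint laws of (Y, D) and (Y, - D) agree on rectangles, hence
   E[Y D] = - E[Y D]. *)
Lemma integral_mul_symmetric (Y D : T -> R) :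
  L2 Y -> L2 D ->
  (forall A B : set R, measurable A -> measurable B ->
    P (Y @^-1` A `&` D @^-1` B) = (P (Y @^-1` A) * P (D @^-1` B))%E) ->
  (forall B : set R, measurable B -> P ((fun w => - D w) @^-1` B) = P (D @^-1` B)) ->
  \int[P]_w (Y w * D w) = 0.
Proof.
move=> hY hD ind sym; have [mY iY] := hY; have [mD iD] := hD.
have mN : measurable_fun setT (fun w => - D w) by exact: measurableT_comp.
pose Ym : {mfun T >-> R} := HB.pack Y (isMeasurableFun.Build _ _ _ _ Y mY).
pose Dm : {mfun T >-> R} := HB.pack D (isMeasurableFun.Build _ _ _ _ D mD).
pose J1 w : R * R := (Y w, D w).
pose J2 w : R * R := (Y w, - D w).
have mJ1 : measurable_fun setT J1 by exact/measurable_fun_pairP.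
have mJ2 : measurable_fun setT J2 by exact/measurable_fun_pairP.
pose M1 : {mfun T >-> (R * R)%type} := HB.pack J1 (isMeasurableFun.Build _ _ _ _ J1 mJ1).
pose M2 : {mfun T >-> (R * R)%type} := HB.pack J2 (isMeasurableFun.Build _ _ _ _ J2 mJ2).
have E1 := @product_measure_unique _ _ _ _ R (distribution P Ym) (distribution P Dm)
  (distribution P M1) (fun A B mA mB => ind A B mA mB).
have ind2 A B : measurable A -> measurable B ->
    distribution P M2 (A `*` B) = (distribution P Ym A * distribution P Dm B)%E.
  move=> mA mB; rewrite /distribution /pushforward /=.
  have mNB : measurable (-%R @^-1` B : set R).
    by rewrite -[X in measurable X]setTI; exact: oppr_measurable.
  transitivity (P (Y @^-1` A `&` D @^-1` (-%R @^-1` B))); first by [].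
  by rewrite ind//; congr (_ * _)%E; exact: sym.
have E2 := @product_measure_unique _ _ _ _ R (distribution P Ym) (distribution P Dm)
  (distribution P M2) ind2.
have E12 A : measurable A -> distribution P M2 A = distribution P M1 A.
  by move=> mA; rewrite -E2// -E1.
pose f (z : R * R) := (z.1 * z.2)%:E.
have mf : measurable_fun setT f.
  by apply/measurable_EFinP; apply: measurable_funM.
have I12 : (\int[P]_w f (J1 w) = \int[P]_w f (J2 w))%E.
  rewrite -(integral_law (nu := distribution P M1) mJ1 (fun A _ => erefl) mf).
  rewrite -(integral_law (nu := distribution P M2) mJ2 (fun A _ => erefl) mf).
  by apply: eq_measure_integral => A mA _; exact/esym/E12.
have : \int[P]_w (Y w * D w) = \int[P]_w (-1 * (Y w * D w)).
  rewrite /Rintegral; congr fine; rewrite [LHS]I12.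
  by apply: eq_integral => w _; rewrite /f /= mulN1r mulrN.
by rewrite RintegralZl//; [lra|exact: L2_mul].
Qed.

End square_integrable_real.

(** * Increments of Wiener processes *)

Section filtration_measurable.
Context {R : realType} {d : measure_display} {Omega : measurableType d}.
Variable F : R -> set (set Omega).
Hypothesis filF : filtration F.

(** [measurable_at] speaks of the generated sigma-algebra, whereas independence of increments is
    stated for events of [F s]; the two coincide because [F s] is already a sigma-algebra. *)
Lemma filtration_gsigmaE (s : R) : 0 <= s <= 1 -> <<s F s >> = F s.
Proof.
move=> s01; apply/seteqP; split; last exact: sub_gen_smallest.
by apply: smallest_sub => //; exact: filtration_sigma filF _ s01.
Qed.

Context {d' : measure_display} {T : measurableType d'}.
Local Notation meas s Y := (measurable_fun setT (Y : g_sigma_algebraType (F s) -> T)).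

Lemma filtration_preimage (s : R) (Y : Omega -> T) (B : set T) : 0 <= s <= 1 ->
  meas s Y -> measurable B -> F s (Y @^-1` B).
Proof.
move=> s01 mY mB; have := mY measurableT _ mB.
by rewrite setTI /measurable /= filtration_gsigmaE.
Qed.

Lemma filtration_measurable_fun (s : R) (Y : Omega -> T) : 0 <= s <= 1 ->
  meas s Y -> measurable_fun setT (Y : Omega -> T).
Proof.
move=> s01 mY _ B mB; rewrite setTI.
by apply: (filtration_sub filF s01); exact: filtration_preimage.
Qed.

Lemma filtration_measurable_mono (s u : R) (Y : Omega -> T) :
  0 <= s -> s <= u -> u <= 1 -> meas s Y -> meas u Y.
Proof.
move=> s0 su u1 mY _ B mB; rewrite setTI.
rewrite /measurable /= filtration_gsigmaE ?u1 ?andbT ?(le_trans s0)//.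
apply: (filtration_incr filF s0 su u1).
by apply: filtration_preimage => //; rewrite s0 (le_trans su).
Qed.

End filtration_measurable.

Section wiener.
Context {R : realType} {d : measure_display} {Omega : measurableType d}.
Variables (P : probability Omega R) (F : R -> set (set Omega)).
Hypothesis filF : filtration F.
Context {N K : nat}.
Variables (S : 'M[R]_K) (W : R -> Omega -> 'M[R]_(N, K)).
Hypothesis wW : wiener_process P F S W.

Lemma wiener_coord_measurable_at (s : R) i j : 0 <= s <= 1 ->
  measurable_fun setT ((fun w => W s w i j) : g_sigma_algebraType (F s) -> R).
Proof.
move=> s01; have mW := wiener_adapted wW s01.
exact: measurableT_comp (mxcoord_measurable i j) mW.
Qed.

Lemma wiener_coord_measurable (s : R) i j : 0 <= s <= 1 ->
  measurable_fun setT (fun w => W s w i j).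
Proof. move=> s01; apply: filtration_measurable_fun s01 (wiener_coord_measurable_at i j s01) => //. Qed.

(** The Gaussian laws are given for linear functionals; multiples of a matrix unit isolate one
    coordinate. The factor [c] will be 1 or -1, to express the symmetry of the increment. *)
Let mdot_delta (c : R) (i : 'I_N) (j : 'I_K) (x : 'M[R]_(N, K)) :
  mdot (c *: delta_mx i j) x = c * x i j.
Proof.
rewrite /mdot (bigD1 i)//= [X in _ + X]big1 => [|k /negPf ki]; last first.
  by apply: big1 => l _; rewrite !mxE ki mulr0 mul0r.
rewrite addr0 (bigD1 j)//= [X in _ + X]big1 => [|l /negPf lj]; last first.
  by rewrite !mxE eqxx lj mulr0 mul0r.
by rewrite !mxE !eqxx mulr1 addr0.
Qed.

Let tr_delta (c : R) (i : 'I_N) (j : 'I_K) :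
  \tr (c *: delta_mx i j *m S *m (c *: delta_mx i j)^T) = c ^+ 2 * S j j.
Proof.
rewrite linearZ/= -!scalemxAl -scalemxAr !mxtraceZ mulrA -expr2; congr (_ * _).
rewrite /mxtrace (bigD1 i)//= [X in _ + X]big1 => [|k /negPf ki]; last first.
  rewrite mxE big1// => l _; rewrite [X in X * _]mxE big1 ?mul0r// => m _.
  by rewrite !mxE ki mul0r.
rewrite addr0 mxE (bigD1 j)//= [X in _ + X]big1 => [|l /negPf lj]; last first.
  by rewrite !mxE eqxx lj mulr0.
rewrite addr0 [X in X * _]mxE (bigD1 j)//= [X in _ + X]big1 => [|l /negPf lj].
  by rewrite !mxE !eqxx mulr1 mul1r addr0.
by rewrite !mxE lj andbF mul0r.
Qed.

Section increment.
Variables (s u : R) (i : 'I_N) (j : 'I_K).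
Hypotheses (s0 : 0 <= s) (su : s < u) (u1 : u <= 1).
Let D (w : Omega) : R := (W u w - W s w) i j.

Let s01 : 0 <= s <= 1. Proof. by rewrite s0 (le_trans (ltW su)). Qed.
Let u01 : 0 <= u <= 1. Proof. by rewrite u1 (le_trans s0 (ltW su)). Qed.

Lemma wiener_increment_measurable : measurable_fun setT D.
Proof.
rewrite /D; under eq_fun do rewrite !mxE.
by apply: measurable_funB; exact: wiener_coord_measurable.
Qed.

Let law (c : R) (B : set R) : c != 0 -> measurable B ->
  P ((fun w => c * D w) @^-1` B) =
  normal_prob 0 (Num.sqrt ((u - s) * (c ^+ 2 * S j j))) B.
Proof.
move=> c0 mB.
have cn0 : c *: delta_mx i j != 0 :> 'M[R]_(N, K).
  rewrite scaler_eq0 negb_or c0/=; apply/eqP => /matrixP/(_ i j).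
  by rewrite !mxE !eqxx => /eqP; rewrite oner_eq0.
rewrite -(tr_delta c i j) -(wiener_gaussian wW s0 su u1 cn0 mB).
by congr (P _); apply/funext => w /=; rewrite mdot_delta.
Qed.

Lemma wiener_increment_second_moment : 0 < S j j ->
  (\int[P]_w (D w ^+ 2)%:E <= ((u - s) * S j j)%:E)%E.
Proof.
move=> Sj.
have v0 : 0 < (u - s) * S j j by rewrite mulr_gt0// subr_gt0.
rewrite -(sqr_sqrtr (ltW v0)).
apply: le_trans (normal_prob_second_moment _); last by rewrite sqrtr_gt0.
set sg := Num.sqrt _.
have E B : measurable B -> P (D @^-1` B) = normal_prob 0 sg B.
  move=> mB; have := @law 1 B (oner_neq0 _) mB.
  rewrite expr1n mul1r => <-.
  by congr (P _); apply/funext => w /=; rewrite mul1r.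
have mf : measurable_fun setT (fun x : R => (x ^+ 2)%:E).
  by apply/measurable_EFinP; apply: continuous_measurable_fun; exact: exprn_continuous.
have f0 (x : R) : (0 <= (x ^+ 2)%:E)%E by rewrite lee_fin sqr_ge0.
by rewrite (ge0_integral_law (nu := normal_prob 0 sg) wiener_increment_measurable E mf f0).
Qed.

Lemma wiener_increment_L2 : 0 < S j j -> L2 P D.
Proof.
move=> Sj; apply: L2P; first exact: wiener_increment_measurable.
exact: le_lt_trans (wiener_increment_second_moment Sj) (ltry _).
Qed.

(** The laws for [c = 1] and [c = -1] have the same variance, so the increment is symmetric; with
    independence on events this yields orthogonality without computing any mean. *)
Lemma wiener_increment_orthogonal (Y : Omega -> R) : 0 < S j j ->
  measurable_fun setT (Y : g_sigma_algebraType (F s) -> R) -> L2 P Y ->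
  \int[P]_w (Y w * D w) = 0.
Proof.
move=> Sj mY hY; apply: integral_mul_symmetric => //.
- exact: wiener_increment_L2.
- move=> A B mA mB.
  have FA : F s (Y @^-1` A).
    exact (filtration_preimage filF s01 mY mA).
  pose B' : set (borel 'M[R]_(N, K)) := (fun M : 'M[R]_(N, K) => M i j) @^-1` B.
  have mB' : measurable B'.
    by rewrite -[B']setTI; exact: mxcoord_measurable.
  exact: (wiener_indep wW s0 (ltW su) u1 FA mB').
- move=> B mB.
  have := @law (-1) B _ mB; rewrite sqrrN -(law (oner_neq0 _) mB).
  rewrite oppr_eq0 oner_eq0 => /(_ isT).
  under eq_fun do rewrite mulN1r.
  by move=> ->; congr (P _); apply/funext => w /=; rewrite mul1r.
Qed.

End increment.

End wiener.

(** Functionals such as [G] take bundled probabilities, so agreement on sets has to become equality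
    of the structures, whose remaining fields are proofs. *)
Lemma probability_ext {R : realType} {d} {T : measurableType d}
  (mu nu : probability T R) : (forall A, mu A = nu A) -> mu = nu.
Proof.
case: mu => m cm; case: nu => n cn h.
have mn : m = n by apply/funext.
move: cm cn {h}; rewrite mn => cm cn; congr Probability.Pack.
case: cm => -[a1 a2] [a3] [a4] [a5] [a6] [a7] [a8].
case: cn => -[b1 b2] [b3] [b4] [b5] [b6] [b7] [b8].
move: a3 b3; rewrite (Prop_irrelevance a1 b1) (Prop_irrelevance a2 b2) => a3 b3.
by rewrite (Prop_irrelevance a3 b3) (Prop_irrelevance a4 b4)
  (Prop_irrelevance a5 b5) (Prop_irrelevance a6 b6) (Prop_irrelevance a7 b7)
  (Prop_irrelevance a8 b8).
Qed.

(** * Couplings and empirical measures *)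

Section W2_law.
Context {R : realType} {T : normedModType R}.
Variable nrm : T -> R.
Context {d : measure_display} {Omega : measurableType d}.
Variable P : probability Omega R.

Lemma W2_ge0 (mu nu : probability (borel T) R) : 0 <= W2 nrm mu nu.
Proof. exact: sqrtr_ge0. Qed.

(** The joint law of [X] and [Y] is a coupling. Measurability of the distance is a hypothesis
    because it refers to the product of the two Borel sigma-algebras, which may be smaller than the
    Borel sigma-algebra of the product. *)
Lemma W2_le_coupling (mu nu : probability (borel T) R) (X Y : Omega -> borel T)
    (c : R) :
  measurable_fun setT X -> measurable_fun setT Y ->
  has_law P X mu -> has_law P Y nu ->
  measurable_fun setT (fun z : (borel T * borel T)%type => nrm ((z.1 : T) - (z.2 : T))) ->
  (\int[P]_w (nrm ((X w : T) - (Y w : T)) ^+ 2)%:E <= c%:E)%E ->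
  W2 nrm mu nu <= Num.sqrt c.
Proof.
move=> mX mY lX lY mn Ic.
pose J w := (X w, Y w).
have mJ : measurable_fun setT J by exact/measurable_fun_pairP.
pose M : {mfun Omega >-> (borel T * borel T)%type} :=
  HB.pack J (isMeasurableFun.Build _ _ _ _ J mJ).
have cJ : coupling mu nu (distribution P M).
  move=> A mA; split.
  - rewrite -(lX _ mA) /distribution /pushforward /=; congr (P _).
    by apply/seteqP; split=> w /= => [[]|].
  - rewrite -(lY _ mA) /distribution /pushforward /=; congr (P _).
    by apply/seteqP; split=> w /= => [[]|].
have IJ : (\int[distribution P M]_z (nrm ((z.1 : T) - (z.2 : T)) ^+ 2)%:E =
    \int[P]_w (nrm ((X w : T) - (Y w : T)) ^+ 2)%:E)%E.
  rewrite (ge0_integral_law (mu := P) mJ)//.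
  - by apply/measurable_EFinP; exact: measurable_funX.
  - by move=> z; rewrite lee_fin sqr_ge0.
rewrite /W2 ler_wsqrtr//.
set I := ereal_inf _.
have I0 : (0 <= I)%E.
  apply: le_ereal_inf_tmp => _ [pi _ <-]; apply: integral_ge0 => z _.
  by rewrite lee_fin sqr_ge0.
have Ile : (I <= c%:E)%E.
  apply: le_trans Ic; rewrite -IJ; apply: ereal_inf_lbound.
  by exists (distribution P M).
by rewrite -lee_fin fineK// ge0_fin_numE// (le_lt_trans Ile) ?ltry.
Qed.

End W2_law.

Section euclidean_norm.
Context {R : realType} {m n : nat}.
Implicit Types x y : 'M[R]_(m, n).

Lemma mdot_ge0 x : 0 <= mdot x x.
Proof. by apply: sumr_ge0 => i _; apply: sumr_ge0 => j _; rewrite -expr2 sqr_ge0. Qed.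

Lemma mdotE x : mdot x x = \sum_i \sum_j x i j ^+ 2.
Proof. by apply: eq_bigr => i _; apply: eq_bigr => j _; rewrite expr2. Qed.

Lemma enorm_ge0 x : 0 <= enorm x. Proof. exact: sqrtr_ge0. Qed.

Lemma enorm_sqr x : enorm x ^+ 2 = mdot x x.
Proof. by rewrite sqr_sqrtr// mdot_ge0. Qed.

Lemma sqr_coord_le_mdot x i j : x i j ^+ 2 <= mdot x x.
Proof.
rewrite mdotE (bigD1 i)//= (bigD1 j)//= -addrA lerDl addr_ge0//.
  by apply: sumr_ge0 => l _; exact: sqr_ge0.
by apply: sumr_ge0 => k _; apply: sumr_ge0 => l _; exact: sqr_ge0.
Qed.

Lemma coord_le_enorm x i j : `|x i j| <= enorm x.
Proof.
by rewrite -sqrtr_sqr ler_wsqrtr// sqr_coord_le_mdot.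
Qed.

Lemma enorm_measurable {d} {T : measurableType d} (f : T -> borel 'M[R]_(m, n)) :
  measurable_fun setT f -> measurable_fun setT (fun w => enorm (f w : 'M[R]_(m, n))).
Proof.
move=> mf; apply: measurableT_comp (mdot_measurable mf mf).
exact: continuous_measurable_fun (@sqrt_continuous R).
Qed.

Lemma enorm_sub_measurable :
  measurable_fun setT (fun z : (borel 'M[R]_(m, n) * borel 'M[R]_(m, n))%type =>
    enorm ((z.1 : 'M[R]_(m, n)) - (z.2 : 'M[R]_(m, n)))).
Proof.
apply: enorm_measurable; apply: mx_measurable => i j.
under eq_fun do rewrite !mxE.
apply: measurable_funB; first exact: measurableT_comp (mxcoord_measurable i j) _.
exact: measurableT_comp (mxcoord_measurable i j) _.
Qed.

End euclidean_norm.

Lemma enormE_row {R : realType} {m n : nat} (x : 'M[R]_(m, n)) :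
  mdot x x = \sum_i enorm (row i x) ^+ 2.
Proof.
rewrite mdotE; apply: eq_bigr => i _; rewrite enorm_sqr mdotE big_ord1.
by apply: eq_bigr => j _; rewrite mxE.
Qed.

Section uniform_label.
Context {R : realType} {d : measure_display} {Omega : measurableType d}.
Variable P : probability Omega R.
Context {N : nat}.
Hypothesis N0 : (0 < N)%N.

(** A random particle index on the given [Omega]. It realises empirical measures by random variables
    on the very space on which the Lions derivative is tested. *)
Definition uniform_label (label : Omega -> 'I_N) : Prop := forall i,
  measurable (label @^-1` [set i]) /\ P (label @^-1` [set i]) = (N%:R^-1)%:E.

Variable label : Omega -> 'I_N.
Hypothesis ulabel : uniform_label label.

Lemma label_preimage_measurable (A : set 'I_N) : measurable (label @^-1` A).
Proof.
rewrite (_ : label @^-1` A = \bigcup_(i in A) label @^-1` [set i]).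
  by apply: fin_bigcup_measurable => [|i _]; [exact: finite_finset|have [] := ulabel i].
by apply/seteqP; split=> w /= => [Aw|[i Ai ->]]; first exists (label w).
Qed.

Lemma label_measurable {d'} {T : measurableType d'} (h : 'I_N -> T) :
  measurable_fun setT (h \o label).
Proof. by move=> _ B mB; rewrite setTI; exact: (label_preimage_measurable (h @^-1` B)). Qed.

Lemma integral_label (h : 'I_N -> R) :
  (\int[P]_w (h (label w))%:E = (N%:R^-1 * \sum_i h i)%:E)%E.
Proof.
have iA i : P.-integrable setT (fun w => (\1_(label @^-1` [set i]) w)%:E).
  by apply: integrable_indic => //; [have [] := ulabel i].
transitivity (\int[P]_w \sum_(i < N) ((h i)%:E * (\1_(label @^-1` [set i]) w)%:E))%E.
  apply: eq_integral => w _; rewrite (bigD1 (label w))//= big1 => [|i il].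
    by rewrite adde0 indicE mem_set//= mule1.
  by rewrite indicE memNset ?mule0//= => li; rewrite li eqxx in il.
rewrite integral_sum//; last by move=> i; exact: integrableZl.
rewrite mulr_sumr -sumEFin; apply: eq_bigr => i _.
have [mi Pi] := ulabel i.
rewrite integralZl// integral_indic// setIT mulrC EFinM.
by congr (_ * _)%E; exact: Pi.
Qed.

Lemma Rintegral_label (h : 'I_N -> R) :
  \int[P]_w h (label w) = N%:R^-1 * \sum_i h i.
Proof. by rewrite /Rintegral integral_label. Qed.

Context {K : nat}.
Implicit Types x y : 'M[R]_(N, K).

Definition label_row x (w : Omega) : borel 'rV[R]_K := row (label w) x.

Lemma label_row_measurable x : measurable_fun setT (label_row x).
Proof. exact: (label_measurable (fun i => row i x : borel 'rV[R]_K)). Qed.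

Definition label_mfun x : {mfun Omega >-> borel 'rV[R]_K} :=
  HB.pack (label_row x)
    (isMeasurableFun.Build _ _ Omega (borel 'rV[R]_K) _ (label_row_measurable x)).

(** Valid for every set, measurable or not, because the label takes finitely many values with
    measurable fibres. This generality is what [probability_ext] asks for. *)
Lemma label_row_law x (B : set (borel 'rV[R]_K)) :
  P (label_row x @^-1` B) = empirical x B.
Proof.
rewrite empiricalE// /sum_dirac.
have -> : P (label_row x @^-1` B) = (\int[P]_w (\1_B (label_row x w))%:E)%E.
  rewrite -[X in P X]setIT -(integral_indic P measurableT).
    by apply: eq_integral => w _; rewrite /= !indicE.
  exact: (label_preimage_measurable [set i | B (row i x)]).
rewrite (integral_label (fun i => \1_B (row i x))) EFinM; congr (_ * _)%E.
by rewrite -sumEFin; apply: eq_bigr => i _.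
Qed.

Lemma distribution_label_row x : 
  distribution P (label_mfun x) = empirical x :> probability (borel 'rV[R]_K) R.
Proof. by apply: probability_ext => B; exact: label_row_law. Qed.

Lemma label_row_has_law x : has_law P (label_row x) (empirical x).
Proof. by move=> B _; exact: label_row_law. Qed.

Lemma integral_empirical x (f : 'rV[R]_K -> R) :
  measurable_fun setT (f : borel 'rV[R]_K -> R) ->
  (\int[empirical x]_y (f y)%:E = (N%:R^-1 * \sum_i f (row i x))%:E)%E.
Proof.
move=> mf; rewrite (integral_law (label_row_measurable x) (label_row_has_law x)).
  exact: (integral_label (fun i => f (row i x))).
exact/measurable_EFinP.
Qed.

Lemma Rintegral_empirical x (f : 'rV[R]_K -> R) :
  measurable_fun setT (f : borel 'rV[R]_K -> R) ->
  \int[empirical x]_y f y = N%:R^-1 * \sum_i f (row i x).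
Proof. by move=> mf; rewrite /Rintegral integral_empirical. Qed.

Lemma enorm_sqr_measurable (k l : nat) :
  measurable_fun setT (fun y : borel 'M[R]_(k, l) => enorm (y : 'M[R]_(k, l)) ^+ 2).
Proof. by apply: measurable_funX; apply: enorm_measurable; exact: measurable_id. Qed.

Lemma P2_empirical x : P2 (@enorm R 1 K) (empirical x).
Proof. by rewrite /P2 integral_empirical ?ltry//; exact: enorm_sqr_measurable. Qed.

Lemma M2_empirical x : M2 (@enorm R 1 K) (empirical x) = N%:R^-1 * mdot x x.
Proof. by rewrite /M2 Rintegral_empirical ?enormE_row//; exact: enorm_sqr_measurable. Qed.

Lemma label_row_square_integrable x : square_integrable P (label_row x).
Proof.
by rewrite /square_integrable (integral_label (fun i => enorm (row i x) ^+ 2)) ltry.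
Qed.

Lemma label_rowB x y w : label_row y w - label_row x w = row (label w) (y - x).
Proof. by rewrite /label_row linearB. Qed.

Lemma L2norm_label_row x y :
  L2norm P (label_row y \- label_row x) = Num.sqrt (N%:R^-1 * mdot (y - x) (y - x)).
Proof.
rewrite /L2norm enormE_row -(Rintegral_label (fun i => enorm (row i (y - x)) ^+ 2)).
by congr (Num.sqrt _); apply: eq_Rintegral => w _; rewrite /= label_rowB.
Qed.

Lemma W2_empirical x y :
  W2 (@enorm R 1 K) (empirical x) (empirical y) <= Num.sqrt (N%:R^-1 * mdot (x - y) (x - y)).
Proof.
apply: (W2_le_coupling (label_row_measurable x) (label_row_measurable y)
  (label_row_has_law x) (label_row_has_law y)).
  exact: enorm_sub_measurable.
rewrite enormE_row -(integral_label (fun i => enorm (row i (x - y)) ^+ 2)).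
by rewrite le_eqVlt; apply/orP; left; apply/eqP; apply: eq_integral => w _;
  rewrite label_rowB.
Qed.

(** Continuity of the derivatives of the value is only assumed at support points of the measure, so
    each particle must be recognised as one. *)
Lemma msupport_empirical x i : msupport (empirical x) (row i x).
Proof.
move=> U oU Ui; rewrite empiricalE// mule_gt0 ?lte_fin ?invr_gt0 ?ltr0n//.
rewrite /sum_dirac (bigD1 i)//= diracE mem_set//.
by apply: (@lt_le_trans _ _ 1%E) => //; rewrite leeDl// sume_ge0.
Qed.

End uniform_label.

(** * Derivatives along lines and in time *)

Lemma is_derive_line {R : realType} {V W : normedModType R} (f : V -> W)
    (x v : V) (h : R) (df : W) :
  is_derive (h *: v + x) v f df <-> is_derive h (1 : R) (fun k : R => f (k *: v + x)) df.
Proof.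
have E : (fun k : R => k^-1 *: ((f \o shift (h *: v + x)) (k *: v) - f (h *: v + x)))
  = (fun k : R => k^-1 *: (((fun k : R => f (k *: v + x)) \o shift h) (k *: 1)
      - (fun k : R => f (k *: v + x)) h)).
  apply/funext => k /=; congr (_ *: (f _ - _)).
  by rewrite addrA -scalerDl [k *: 1]mulr1.
by split=> -[df1 df2]; split; move: df1 df2; rewrite /derivable /derive E.
Qed.

(** No continuity of the second derivative is assumed. If [c] were positive, [df] would be positive
    just to the right of 0, and by the mean value theorem [f] would exceed [f 0] there. *)
Lemma second_derivative_at_max {R : realType} (f df : R -> R) (c : R) :
  (forall h, is_derive h (1 : R) f (df h)) -> is_derive 0 (1 : R) df c ->
  (forall h, f h <= f 0) -> df 0 = 0 /\ c <= 0.
Proof.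
move=> f' f'' fmax.
have df0 : df 0 = 0.
  have d0 := f' 0.
  have : is_derive 0 (1 : R) f 0.
    have h1 : -1 <= (1 : R) by lra.
    have h2 : (0 : R) \in `]-1, 1[ by rewrite in_itv/= ltrN10 ltr01.
    by apply: (derive1_at_max h1) => // t _; have [] := f' t.
  by case=> _; have [_ <-] := d0.
split=> //; rewrite leNgt; apply/negP => c0.
have [dd0 ddE] := f''.
have cv : h^-1 * df h @[h --> (0 : R)^'] --> c.
  rewrite -ddE.
  have -> : (fun h : R => h^-1 * df h) =
      (fun h : R => h^-1 *: ((df \o shift 0) (h *: (1 : R)) - df 0)).
    by apply/funext => h; rewrite /= addr0 df0 subr0 [h *: 1]mulr1.
  exact: dd0.
have : \forall h \near (0 : R)^', 0 < h^-1 * df h by apply: cvgr_gt cv _ c0.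
move=> /nbhs_ballP[e /= e0 he].
have [||z zI fz] := @MVT R f df 0 (e / 2).
- by rewrite divr_gt0.
- apply: continuous_subspaceT => x; apply: differentiable_continuous.
  by apply/derivable1_diffP; have [] := f' x.
move: zI; rewrite in_itv/= => /andP[z0 ze].
have : 0 < z^-1 * df z.
  apply: he; last by rewrite gt_eqF.
  by rewrite /ball/= sub0r normrN gtr0_norm//; lra.
rewrite pmulr_rgt0 ?invr_gt0// => dfz.
have := fmax (e / 2); rewrite -subr_le0 fz subr0.
by rewrite leNgt mulr_gt0// divr_gt0.
Unshelve. all: by end_near. Qed.

(** The limits are taken along s > t only, which is possible at t = 0 as well; there the derivative
    is one-sided. *)
Lemma time_quotient_le {R : realType} (f g : R -> R) (t a b : R) :
  0 <= t < 1 ->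
  time_quotient f t @ within [set s | 0 <= s < 1] t^' --> a ->
  time_quotient g t @ within [set s | 0 <= s < 1] t^' --> b ->
  (forall s, 0 <= s < 1 -> f s - f t <= g s - g t) -> a <= b.
Proof.
move=> /andP[t0 t1] fa gb fg.
have sub : t^'+ `=>` within [set s | 0 <= s < 1] t^'.
  move=> A; rewrite /within /= => -[e /= e0 eA].
  exists (Num.min e (1 - t)) => /=; first by rewrite lt_min e0 subr_gt0.
  move=> s /=; rewrite lt_min => /andP[se st] ts; apply: eA => //=.
    by rewrite gt_eqF.
  rewrite (le_trans t0 (ltW ts))/=.
  by move: st; rewrite ltr_distlC => /andP[? ?]; lra.
have fa' : time_quotient f t @ t^'+ --> a := cvg_trans (cvg_app _ sub) fa.
have gb' : time_quotient g t @ t^'+ --> b := cvg_trans (cvg_app _ sub) gb.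
apply: (ler_cvg_to fa' gb'); near=> s.
rewrite /time_quotient ler_wpM2l//; last first.
  apply: fg; apply/andP; split.
    by rewrite (le_trans t0)//; near: s; exact: nbhs_right_ge.
  by near: s; exact: nbhs_right_lt.
by rewrite invr_ge0 subr_ge0; near: s; exact: nbhs_right_ge.
Unshelve. all: by end_near. Qed.

Lemma time_quotient_is_derive {R : realType} (f : R -> R) (t df : R) :
  is_derive t (1 : R) f df ->
  time_quotient f t @ within [set s | 0 <= s < 1] t^' --> df.
Proof.
move=> [d1 <-]; apply: (@cvg_trans _ (time_quotient f t @ t^')).
  by apply: cvg_app; exact: cvg_within.
have := d1; rewrite /derivable => d1'.
have E : (fun s => time_quotient f t s) = (fun h : R => h^-1 *: ((f \o shift t) (h *: 1) - f t)) \o (fun s => s - t).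
  apply/funext => s; rewrite /time_quotient /=; congr (_ * (f _ - _)).
  by rewrite [X in X + _]mulr1 subrK.
rewrite [X in X @ _]E; apply: cvg_comp d1'.
move=> A [e /= e0 eA]; exists e => //= s se st; apply: eA => /=.
  by rewrite sub0r normrN distrC.
by rewrite subr_eq0.
Qed.

Lemma mx_box_compact {R : realType} (m n : nat) (r : R) :
  compact [set x : 'M[R]_(m, n) | forall i j, `|x i j| <= r].
Proof.
pose A : set 'rV[R]_(m * n) := [set v | forall k, (`[- r, r]%classic : set R) (v ord0 k)].
have cA : compact A.
  apply: (@rV_compact R _ (fun=> `[- r, r]%classic)) => k; exact: segment_compact.
have cv : continuous (@vec_mx R m n).
  move=> v B /nbhs_ballP[eps /= eps0 epsB].
  apply/nbhs_ballP; exists eps => //= w [_ vw]; apply: epsB; split=> // i j.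
  by rewrite !mxE; exact: vw.
rewrite (_ : [set x | _] = @vec_mx R m n @` A); last first.
  apply/seteqP; split=> [x xr|_ [v Av <-] i j].
    exists (mxvec x); last exact: mxvecK.
    move=> k; case/mxvec_indexP: k => i j /=.
    by rewrite mxvecE in_itv/= -ler_norml.
  by have := Av (mxvec_index i j); rewrite /= in_itv/= -ler_norml mxE.
by apply: continuous_compact => //; exact: continuous_subspaceT.
Qed.

(** * A comparison principle *)

Section comparison.
Context {R : realType} {N K : nat}.
Implicit Types x : 'M[R]_(N, K).

Let rho x : R := 1 + mdot x x.

Let rho_ge1 x : 1 <= rho x. Proof. by rewrite lerDl mdot_ge0. Qed.

Lemma mdot_continuous : continuous (fun x => mdot x x).
Proof.
under eq_fun do rewrite mdotE.
apply: (@continuous_big R 'I_N +%R 0 xpredT) => [|i _]; first exact: add_continuous.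
apply: (@continuous_big R 'I_K +%R 0 xpredT) => [|j _ x]; first exact: add_continuous.
apply: (@cvg_comp _ _ _ (fun x : 'M[R]_(N, K) => x i j) (fun y => y ^+ 2)).
  exact: coord_continuous.
exact: exprn_continuous.
Qed.

Lemma mdot_line x i j (h : R) :
  mdot (h *: delta_mx i j + x) (h *: delta_mx i j + x) =
  mdot x x + 2 * h * x i j + h ^+ 2.
Proof.
have E k l : (h *: delta_mx i j + x) k l =
    x k l + h * ((k == i) && (l == j))%:R by rewrite !mxE addrC.
rewrite !mdotE (bigD1 i)//= [in RHS](bigD1 i)//=.
rewrite (bigD1 j)//= [in RHS](bigD1 j)//= E !eqxx/= mulr1.
rewrite (eq_bigr (fun l => x i l ^+ 2)) => [|l /negPf lj]; last first.
  by rewrite E lj andbF mulr0 addr0.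
rewrite [X in _ + X](eq_bigr (fun k => \sum_l x k l ^+ 2)) => [|k /negPf ki]; last first.
  by apply: eq_bigr => l _; rewrite E ki mulr0 addr0.
ring.
Qed.

Variables (lam : nat -> R) (eps L C : R) (v u vt ut : R -> 'M[R]_(N, K) -> R)
  (dv du ddv ddu : R -> 'M[R]_(N, K) -> 'I_N -> 'I_K -> R).
Hypotheses (lam0 : forall j, 0 <= lam j) (eps0 : 0 < eps).
Hypothesis cvu : {within [set z : R * 'M[R]_(N, K) | 0 <= z.1 <= 1],
  continuous (fun z => v z.1 z.2 - u z.1 z.2)}.
Hypothesis vu1 : forall x, v 1 x <= u 1 x.
Hypothesis vuC : forall (t : R) x, 0 <= t <= 1 -> v t x - u t x <= C * (1 + mdot x x).
Local Notation before1 t := (0 <= t < 1).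
Hypothesis v_t : forall (t : R) x, before1 t ->
  time_quotient (v ^~ x) t @ within [set s | 0 <= s < 1] t^' --> vt t x.
Hypothesis u_t : forall (t : R) x, before1 t ->
  time_quotient (u ^~ x) t @ within [set s | 0 <= s < 1] t^' --> ut t x.
Hypothesis v_x : forall (t : R) x (i : 'I_N) (j : 'I_K), before1 t -> is_derive x (delta_mx i j) (v t) (dv t x i j).
Hypothesis u_x : forall (t : R) x (i : 'I_N) (j : 'I_K), before1 t -> is_derive x (delta_mx i j) (u t) (du t x i j).
Hypothesis v_xx : forall (t : R) x (i : 'I_N) (j : 'I_K), before1 t ->
  is_derive x (delta_mx i j) (fun y => dv t y i j) (ddv t x i j).
Hypothesis u_xx : forall (t : R) x (i : 'I_N) (j : 'I_K), before1 t ->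
  is_derive x (delta_mx i j) (fun y => du t y i j) (ddu t x i j).
Hypothesis v_eq : forall (t : R) x, before1 t ->
  0 <= vt t x + 2^-1 * (\sum_(i < N) \sum_(j < K) lam j * ddv t x i j)
  - (2 * eps)^-1 * (\sum_(i < N) \sum_(j < K) lam j * dv t x i j ^+ 2).
Hypothesis u_eq : forall (t : R) x, before1 t ->
  ut t x + 2^-1 * (\sum_(i < N) \sum_(j < K) lam j * ddu t x i j)
  - (2 * eps)^-1 * (\sum_(i < N) \sum_(j < K) lam j * du t x i j ^+ 2) <= L / 2.
Hypothesis du_growth : forall (t : R) x (i : 'I_N) (j : 'I_K), before1 t ->
  `|du t x i j| <= C * (1 + enorm x).

(* kappa makes eta e^(kappa (1 - t)) (1 + |x|^2)^2 a strict supersolution of the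
   equation linearized at u, whose drift grows at most linearly. *)
Let kappa : R := \sum_(i < N) \sum_(j < K) lam j * (6 + 8 * `|C| / eps) + 1.

(** Fourth-order growth in x beats the quadratic upper bound on [v - u], so that the penalised
    difference is negative outside a compact set. *)
Let barrier (eta t : R) x : R := eta * expR (kappa * (1 - t)) * rho x ^+ 2.

Let Phi (eta t : R) x : R := v t x - u t x - L / 2 * (1 - t) - barrier eta t x.

(** At a maximum before time 1 the gradients of [v] and of [u] plus the barrier agree, the pure
    second derivatives are ordered, and the forward time derivative is nonpositive. Inserting this
    in the two equations contradicts the choice of [kappa]. *)
Let no_positive_max (eta t : R) x : 0 < eta -> before1 t ->
  (forall s y, 0 <= s <= 1 -> Phi eta s y <= Phi eta t x) -> False.
Proof.
move=> eta0 t1 tmax; have /andP[t0 tlt1] := t1.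
have t01 : 0 <= t <= 1 by rewrite t0 ltW.
pose b := eta * expR (kappa * (1 - t)).
have b0 : 0 < b by rewrite mulr_gt0// expR_gt0.
pose phi1 i j := 4 * rho x * x i j.
pose phi2 i j := 4 * rho x + 8 * x i j ^+ 2.
have spatial i j : dv t x i j = du t x i j + b * phi1 i j /\
    ddv t x i j <= ddu t x i j + b * phi2 i j.
  pose l (h : R) := h *: delta_mx i j + x.
  (* Along a coordinate line [rho] is this quadratic polynomial, so the barrier can be
     differentiated explicitly. *)
  pose q (h : R) := 1 + (mdot x x + 2 * h * x i j + h ^+ 2).
  pose f h := v t (l h) - u t (l h) - L / 2 * (1 - t) - b * q h ^+ 2.
  pose df h := dv t (l h) i j - du t (l h) i j - b * (2 * q h * (2 * x i j + 2 * h)).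
  have fE h : f h = Phi eta t (l h).
    by rewrite /f /Phi /barrier /rho mdot_line /q.
  have l0 : l 0 = x by rewrite /l scale0r add0r.
  have q' (h : R) : is_derive h (1 : R) q (2 * x i j + 2 * h).
    by apply: is_derive_eq; rewrite /GRing.scale/=; ring.
  have q0 : q 0 = rho x by rewrite /q /rho; ring.
  have [] := @second_derivative_at_max R f df
    (ddv t x i j - ddu t x i j - b * phi2 i j).
  - move=> h.
    have v' : is_derive h (1 : R) (fun k => v t (l k)) (dv t (l h) i j).
      exact: (is_derive_line (v t) x (delta_mx i j) h _).1 (v_x (l h) i j t1).
    have u' : is_derive h (1 : R) (fun k => u t (l k)) (du t (l h) i j).
      exact: (is_derive_line (u t) x (delta_mx i j) h _).1 (u_x (l h) i j t1).
    by apply: is_derive_eq; rewrite /GRing.scale/= /df; ring.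
  - have v'' : is_derive 0 (1 : R) (fun k => dv t (l k) i j) (ddv t x i j).
      apply: (is_derive_line (fun y => dv t y i j) x (delta_mx i j) 0 _).1.
      by rewrite -/(l 0) l0; exact: v_xx.
    have u'' : is_derive 0 (1 : R) (fun k => du t (l k) i j) (ddu t x i j).
      apply: (is_derive_line (fun y => du t y i j) x (delta_mx i j) 0 _).1.
      by rewrite -/(l 0) l0; exact: u_xx.
    have q'0 := q' 0.
    by apply: is_derive_eq; rewrite /GRing.scale/= /phi2 q0; ring.
  - by move=> h; rewrite !fE l0; exact: tmax.
  rewrite /df l0 q0 /phi1 => d1 d2; split; last by lra.
  by move/eqP: d1; rewrite subr_eq0 => /eqP d1; lra.
have expR' : is_derive t (1 : R) (fun s : R => eta * expR (kappa * (1 - s)) * rho x ^+ 2)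
    (- kappa * b * rho x ^+ 2).
  have e1 : is_derive t (1 : R) (fun s : R => kappa * (1 - s)) (- kappa).
    by apply: is_derive_eq; rewrite /GRing.scale/=; ring.
  have e2 := @is_derive1_comp _ (@expR R) _ t _ _ (is_derive_expR _) e1.
  rewrite /comp in e2.
  by apply: is_derive_eq; rewrite /GRing.scale/= /b; ring.
have lin' : is_derive t (1 : R) (fun s : R => L / 2 * (1 - s)) (- (L / 2)).
  by apply: is_derive_eq; rewrite /GRing.scale/=; ring.
have time : vt t x - ut t x + L / 2 <= - kappa * b * rho x ^+ 2.
  have := @time_quotient_le R
    (fun s => v s x - u s x - L / 2 * (1 - s)) (fun s => barrier eta s x) t
    (vt t x - ut t x + L / 2) (- kappa * b * rho x ^+ 2) t1.
  apply.
  - have E : time_quotient (fun s => v s x - u s x - L / 2 * (1 - s)) t =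
        time_quotient (v ^~ x) t - time_quotient (u ^~ x) t -
        time_quotient (fun s => L / 2 * (1 - s)) t.
      by apply/funext => s; rewrite !fctE /time_quotient; ring.
    rewrite E -[L / 2 in X in _ --> X]opprK.
    exact: cvgB (cvgB (@v_t t x t1) (@u_t t x t1)) (time_quotient_is_derive lin').
  - exact: time_quotient_is_derive.
  - move=> s /andP[s0 s1]; have := tmax s x; rewrite s0 (ltW s1) => /(_ isT).
    by rewrite /Phi; lra.
have H1 := @v_eq t x t1; have H2 := @u_eq t x t1.
have S1 : \sum_(i < N) \sum_(j < K) lam j * ddv t x i j <=
    \sum_(i < N) \sum_(j < K) lam j * ddu t x i j +
    b * \sum_(i < N) \sum_(j < K) lam j * phi2 i j.
  rewrite mulr_sumr -big_split/= ler_sum// => i _.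
  rewrite mulr_sumr -big_split/= ler_sum// => j _.
  rewrite [b * _]mulrCA -mulrDr ler_wpM2l//.
  by have [] := spatial i j.
(* Convexity of the Hamiltonian: dropping the square of [b * phi1] linearizes the gradient term at
   [u]. *)
have S2 : \sum_(i < N) \sum_(j < K) lam j * du t x i j ^+ 2 +
    2 * b * (\sum_(i < N) \sum_(j < K) lam j * (du t x i j * phi1 i j)) <=
    \sum_(i < N) \sum_(j < K) lam j * dv t x i j ^+ 2.
  rewrite mulr_sumr -big_split/= ler_sum// => i _.
  rewrite mulr_sumr -big_split/= ler_sum// => j _.
  rewrite [2 * b * _]mulrCA -mulrDr ler_wpM2l//.
  have [-> _] := spatial i j.
  by rewrite -subr_ge0; have := sqr_ge0 (b * phi1 i j); lra.
(* Origin of [kappa]: half of [phi2] is at most [6 * rho ^+ 2], and the drift contributes at most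
   [8 * |C| / eps * rho ^+ 2] because |x| (1 + |x|) <= 2 rho. The additional 1 in [kappa] leaves the
   strict margin. *)
have S3 : 2^-1 * (\sum_(i < N) \sum_(j < K) lam j * phi2 i j)
    - eps^-1 * (\sum_(i < N) \sum_(j < K) lam j * (du t x i j * phi1 i j))
    <= (kappa - 1) * rho x ^+ 2.
  rewrite /kappa addrK !mulr_sumr -sumrB mulr_suml ler_sum// => i _.
  rewrite !mulr_sumr -sumrB mulr_suml ler_sum// => j _.
  rewrite !(mulrCA _ (lam j)) -mulrBr -mulrA ler_wpM2l//.
  have := du_growth x i j t1.
  have := coord_le_enorm x i j; have := enorm_ge0 x.
  have : rho x = 1 + enorm x ^+ 2 by rewrite enorm_sqr.
  have := normr_ge0 C; have := ler_norm C.
  rewrite /phi2 /phi1; move: `|C| (rho x) (enorm x) (du t x i j) (x i j) (rho_ge1 x).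
  move=> c r en p y r1 Cc c0 rE en0 yen pen.
  have ien : 0 < eps^-1 by rewrite invr_gt0.
  have enr : en <= r by rewrite rE; have := sqr_ge0 (en - 1); rewrite sqrrB; nra.
  have y2 : y ^+ 2 <= en ^+ 2 by rewrite -[y ^+ 2]real_normK ?num_real// ler_pXn2r ?nnegrE.
  have pc : `|p| <= c * (1 + en) by apply: (le_trans pen); rewrite ler_wpM2r//; lra.
  have py : - (p * y) <= c * (2 * r).
    apply: (le_trans (ler_norm _)); rewrite normrN normrM.
    apply: (@le_trans _ _ (c * (1 + en) * en)); first by rewrite ler_pM.
    by rewrite -mulrA ler_wpM2l//; nra.
  have r2 : r <= r ^+ 2 by rewrite expr2; nra.
  have F1 : 2^-1 * (4 * r + 8 * y ^+ 2) <= 6 * r ^+ 2 by nra.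
  have F2 : - (eps^-1 * (p * (4 * r * y))) <= 8 * c / eps * r ^+ 2.
    have -> : - (eps^-1 * (p * (4 * r * y))) = eps^-1 * (4 * r * (- (p * y))) by ring.
    have -> : 8 * c / eps * r ^+ 2 = eps^-1 * (4 * r * (c * (2 * r))) by ring.
    by rewrite ler_pM2l// ler_wpM2l//; lra.
  lra.
have epsn : eps != 0 by rewrite gt_eqF.
have S2' : (2 * eps)^-1 * (\sum_(i < N) \sum_(j < K) lam j * du t x i j ^+ 2) +
    b * (eps^-1 * (\sum_(i < N) \sum_(j < K) lam j * (du t x i j * phi1 i j))) <=
    (2 * eps)^-1 * (\sum_(i < N) \sum_(j < K) lam j * dv t x i j ^+ 2).
  have := ler_wpM2l (_ : 0 <= (2 * eps)^-1) S2.
  rewrite invr_ge0 mulr_ge0 ?(ltW eps0)// => /(_ isT).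
  apply: le_trans; rewrite mulrDr lerD2l le_eqVlt; apply/orP; left; apply/eqP.
  by field.
have bS3 := ler_wpM2l (ltW b0) S3.
have r0 : 0 < b * rho x ^+ 2.
  by rewrite mulr_gt0// exprn_gt0// (lt_le_trans ltr01).
move: H1 H2 S1 S2' bS3 r0 time.
move: (\sum_i _) (\sum_i _) (\sum_i _) (\sum_i _) (\sum_i _) (\sum_i _).
move=> s1 s2 s3 s4 s5 s6; move: (rho x ^+ 2) (eps^-1) ((2 * eps)^-1) => r i1 i2.
move=> H1 H2 S1 S2' bS3 r0 time.
lra.
Unshelve. all: by end_near. Qed.

Lemma comparison x0 : v 0 x0 <= u 0 x0 + L / 2.
Proof.
rewrite leNgt; apply/negP => w0; pose w := v 0 x0 - u 0 x0 - L / 2.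
have {w0} w0 : 0 < w by rewrite /w; lra.
have rho_gt0 x : 0 < rho x := lt_le_trans ltr01 (rho_ge1 x).
have kappa0 : 0 <= kappa.
  apply: addr_ge0 => //; apply: sumr_ge0 => i _; apply: sumr_ge0 => j _.
  apply: mulr_ge0 => //; apply: addr_ge0 => //.
  by rewrite divr_ge0 ?(ltW eps0)// mulr_ge0.
(* Makes the barrier at [(0, x0)] equal to [w / 2], so that [Phi] is still positive there. *)
pose eta := w / (2 * expR kappa * rho x0 ^+ 2).
have den0 : 0 < 2 * expR kappa * rho x0 ^+ 2.
  by rewrite !mulr_gt0 ?expR_gt0// exprn_gt0.
have eta0 : 0 < eta by rewrite divr_gt0.
have Phi0 : 0 < Phi eta 0 x0.
  have -> : Phi eta 0 x0 = w - w / 2.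
    rewrite /Phi /barrier subr0 !mulr1 -/w; congr (_ - _); rewrite /eta.
    by field; rewrite !gt_eqF ?expR_gt0//.
  by lra.
pose C' := `|C| + `|L|.
have C'0 : 0 <= C' by rewrite addr_ge0.
have barrier_ge t x : 0 <= t <= 1 -> eta * rho x ^+ 2 <= barrier eta t x.
  move=> /andP[t0 t1]; rewrite /barrier ler_pM2r ?exprn_gt0//.
  rewrite ler_peMr ?(ltW eta0)//.
  by rewrite -[leLHS]expR0 ler_expR mulr_ge0// subr_ge0.
have Phi_le t x : 0 <= t <= 1 -> Phi eta t x <= C' * rho x - eta * rho x ^+ 2.
  move=> t01; rewrite /Phi; apply: lerB; last exact: barrier_ge.
  have h1 := vuC x t01.
  have h2 := ler_wpM2r (ltW (rho_gt0 x)) (ler_norm C).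
  have h3 : - (L / 2 * (1 - t)) <= `|L| * rho x.
    have := ler_norm (- L); rewrite normrN => h.
    have := rho_ge1 x; have := normr_ge0 L; have /andP[t0 t1] := t01; nra.
  by rewrite /C' mulrDl; rewrite -/(rho x) in h1; lra.
(* An entry larger than [r] forces [rho x > C' / eta], hence [C' * rho x - eta * rho x ^+ 2 < 0].
   All positive values of [Phi] are thus taken in the compact set [A]. *)
pose r := C' / eta + 1.
pose A := [set z : R * 'M[R]_(N, K) | 0 <= z.1 <= 1 /\ forall i j, `|z.2 i j| <= r].
have cA : compact A.
  rewrite (_ : A = `[0, 1]%classic `*` [set x : 'M[R]_(N, K) | forall i j, `|x i j| <= r]).
    by apply: compact_setX; [exact: segment_compact|exact: mx_box_compact].
  by apply/seteqP; split=> z [] /=; rewrite in_itv.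
have outside t x : 0 <= t <= 1 -> 0 < Phi eta t x -> A (t, x).
  move=> t01 Ppos; split=> //= i j; rewrite leNgt; apply/negP => rx.
  have rC : 0 <= C' / eta by rewrite divr_ge0// ltW.
  have x2 : C' / eta < rho x.
    have := sqr_coord_le_mdot x i j.
    have : r ^+ 2 <= x i j ^+ 2.
      by rewrite -[leRHS]real_normK ?num_real// ler_pXn2r ?nnegrE ?(ltW rx) /r ?addr_ge0.
    by rewrite /rho /r; nra.
  have := Phi_le t x t01; move: x2; rewrite ltr_pdivrMr// => x2.
  have := rho_gt0 x; nra.
have cPhi : {within A, continuous (fun z => Phi eta z.1 z.2)}.
  have cbar : continuous (fun z : R * 'M[R]_(N, K) =>
      L / 2 * (1 - z.1) + barrier eta z.1 z.2).
    move=> z; apply: cvgD.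
      by apply: cvgM; [exact: cvg_cst|apply: cvgB; [exact: cvg_cst|exact: cvg_fst]].
    apply: cvgM; first apply: cvgM; first exact: cvg_cst.
      apply: (@cvg_comp _ _ _ (fun z : R * 'M[R]_(N, K) => kappa * (1 - z.1)) expR).
        by apply: cvgM; [exact: cvg_cst|apply: cvgB; [exact: cvg_cst|exact: cvg_fst]].
      exact: continuous_expR.
    apply: (@cvg_comp _ _ _ (fun z : R * 'M[R]_(N, K) => rho z.2) (fun y => y ^+ 2)).
      apply: cvgD; first exact: cvg_cst.
      apply: (@cvg_comp _ _ _ snd (fun x => mdot x x)); first exact: cvg_snd.
      exact: mdot_continuous.
    exact: exprn_continuous.
  have E : (fun z : R * 'M[R]_(N, K) => Phi eta z.1 z.2) =
      (fun z => (v z.1 z.2 - u z.1 z.2) - (L / 2 * (1 - z.1) + barrier eta z.1 z.2)).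
    by apply/funext => z; rewrite /Phi opprD addrA.
  have cvuA : {within A, continuous (fun z => v z.1 z.2 - u z.1 z.2)}.
    by apply: continuous_subspaceW cvu => // z' [].
  rewrite E; apply/subspace_continuousP => z Az; apply: cvgB.
    by move/subspace_continuousP: cvuA; apply.
  by apply: cvg_within_filter; exact: cbar.
have A0 : A !=set0 by exists (0, x0); apply: outside; rewrite ?lexx ?ler01.
have [[t x] + tmax] := compact_EVT_max A0 cA cPhi.
rewrite inE => -[/= t01 _].
have gmax s y : 0 <= s <= 1 -> Phi eta s y <= Phi eta t x.
  move=> s01; have [Py|Py] := ltP 0 (Phi eta s y).
    by apply: (tmax (s, y)); rewrite inE; exact: outside.
  apply: (le_trans Py); apply: le_trans (tmax (0, x0) _); first exact: ltW.
  by rewrite inE; apply: outside; rewrite ?lexx ?ler01.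
have Ppos : 0 < Phi eta t x by apply: (lt_le_trans Phi0); apply: gmax; rewrite lexx ler01.
have /andP[t0 t1] := t01.
apply: (@no_positive_max eta t x eta0) => //.
(* The maximum is not at time 1: there [v <= u] and the barrier is positive, so [Phi] is
   negative. *)
rewrite t0 lt_neqAle t1 andbT; apply/eqP => t1E.
move: Ppos; rewrite t1E /Phi subrr mulr0 subr0.
have := vu1 x; have := @barrier_ge 1 x; rewrite lexx ler01 => /(_ isT).
have := mulr_gt0 eta0 (exprn_gt0 2 (rho_gt0 x)).
by lra.
Qed.

End comparison.

(** The form in which [is_lions_derivative] expresses differentiability, transferred to functions of
    one real variable. *)
Lemma is_derive0_epsilon {R : realType} (f : R -> R) (c : R) :
  (forall eta : R, 0 < eta -> exists2 delta : R, 0 < delta &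
    forall h, `|h| <= delta -> `|f h - f 0 - h * c| <= eta * `|h|) ->
  is_derive (0 : R) (1 : R) f c.
Proof.
move=> fc.
have cv : (fun h : R => h^-1 *: ((f \o shift 0) (h *: (1 : R)) - f 0)) @ (0 : R)^' --> c.
  apply/cvgrPdist_le => eta eta0.
  have [delta d0 H] := fc _ eta0.
  exists delta => //= h; rewrite /ball_/= sub0r normrN => hd h0.
  have {hd} := H h (ltW hd).
  have -> : h *: (1 : R) = h by exact: mulr1.
  rewrite addr0 => Hh.
  have -> : c - h^-1 *: (f h - f 0) = - (h^-1 * (f h - f 0 - h * c)).
    by rewrite /GRing.scale/=; field.
  rewrite normrN normrM normfV ler_pdivrMl ?normr_gt0//.
  by rewrite [_ * eta]mulrC.
split; first by apply/cvg_ex; exists c.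
by apply: cvg_lim => //; exact: cv.
Qed.

Lemma is_derive0_le_epsilon {R : realType} (f : R -> R) (c eta : R) :
  is_derive (0 : R) (1 : R) f c -> 0 < eta ->
  exists2 delta : R, 0 < delta &
    forall h, `|h| <= delta -> `|f h - f 0 - h * c| <= eta * `|h|.
Proof.
move=> [d1 d2] eta0.
have cv : (fun h : R => h^-1 *: ((f \o shift 0) (h *: (1 : R)) - f 0)) @ (0 : R)^' --> c.
  by rewrite -d2; exact: d1.
have /cvgrPdist_le/(_ _ eta0) := cv; move=> [delta /= d0 H].
exists (delta / 2); first by rewrite divr_gt0.
move=> h hd; have [->|h0] := eqVneq h 0; first by rewrite subrr mul0r subrr normr0 mulr0.
have := H h; rewrite /ball_/= sub0r normrN => /(_ ltac:(lra) h0).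
have -> : h *: (1 : R) = h by exact: mulr1.
rewrite addr0.
have -> : c - h^-1 *: (f h - f 0) = - (h^-1 * (f h - f 0 - h * c)).
  by rewrite /GRing.scale/=; field.
by rewrite normrN normrM normfV ler_pdivrMl ?normr_gt0// [_ * eta]mulrC.
Qed.

Lemma MVT_from0 {R : realType} (f df : R -> R) (h : R) :
  (forall k, is_derive k (1 : R) f (df k)) ->
  exists2 c, `|c| <= `|h| & f h - f 0 = df c * h.
Proof.
move=> f'.
have cf : continuous f.
  move=> x; apply: differentiable_continuous.
  by apply/derivable1_diffP; have [] := f' x.
have [h0|h0|->] := ltgtP h 0.
- have [c] := @MVT R f df h 0 h0 (fun x _ => f' x) (continuous_subspaceT cf).
  rewrite in_itv/= => /andP[hc c0] E; exists c; last by lra.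
  by rewrite !ltr0_norm//; lra.
- have [c] := @MVT R f df 0 h h0 (fun x _ => f' x) (continuous_subspaceT cf).
  rewrite in_itv/= => /andP[hc c0] E; exists c; last by lra.
  by rewrite !gtr0_norm//; lra.
- by exists 0; rewrite ?normr0// mulr0 subrr.
Qed.

Lemma mx_subE {R : realType} {m n : nat} (A B : 'M[R]_(m, n)) i j :
  (A - B) i j = A i j - B i j.
Proof. by rewrite !mxE. Qed.

Lemma first_order_remainder {R : realType} (a a0 D J J0 h eta : R) :
  `|J - J0| < eta / 2 -> `|a - a0 - h * D| <= eta / 2 * `|h| ->
  `|a + J * h - a0 - h * (J0 + D)| <= eta * `|h|.
Proof.
move=> HJ Ha.
have -> : a + J * h - a0 - h * (J0 + D) = (a - a0 - h * D) + (J - J0) * h by ring.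
apply: (le_trans (ler_normD _ _)); rewrite normrM.
have := ler_wpM2r (normr_ge0 h) (ltW HJ); lra.
Qed.

Section row_line.
Context {R : realType} {N K : nat}.

Lemma row_line (x : 'M[R]_(N, K)) (h : R) i j :
  row i (h *: delta_mx i j + x) = h *: delta_mx 0 j + row i x.
Proof. by apply/rowP => l; rewrite !mxE eqxx. Qed.

Lemma mdot_delta (i : 'I_N) (j : 'I_K) (h : R) :
  mdot (h *: delta_mx i j) (h *: delta_mx i j) = h ^+ 2.
Proof.
have := mdot_line 0 i j h; rewrite addr0 => ->.
by rewrite !mxE mulr0 addr0 mdotE big1 ?add0r// => k _; rewrite big1// => l _;
  rewrite mxE expr0n.
Qed.

Lemma enorm_delta (i : 'I_N) (j : 'I_K) (h : R) : enorm (h *: delta_mx i j) = `|h|.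
Proof. by rewrite /enorm mdot_delta sqrtr_sqr. Qed.

End row_line.

Section jacobian.
Context {R : realType} {K : nat}.
Variable f : 'rV[R]_K -> 'rV[R]_K.
Hypothesis df : forall x, differentiable f x.

Lemma jacobian_is_derive (x : 'rV[R]_K) (j : 'I_K) :
  is_derive x (delta_mx 0 j) (fun y => f y 0 j) (('J f x) j j).
Proof.
have dx := @diff_derivable _ _ _ f x (delta_mx 0 j) (df x).
split; first by move/derivable_mxP: dx; apply.
have := deriveEjacobian (delta_mx 0 j) (df x); rewrite derive_mx// => /rowP/(_ j).
by rewrite mxE => ->; rewrite -rowE mxE.
Qed.

(** A pointwise limit of difference quotients. Measurability is what turns the integral of the
    Jacobian term against an empirical measure into an average over particles. *)
Lemma jacobian_measurable (j : 'I_K) :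
  measurable_fun setT (f : borel 'rV[R]_K -> borel 'rV[R]_K) ->
  measurable_fun setT (fun x : borel 'rV[R]_K => ('J f (x : 'rV[R]_K)) j j).
Proof.
move=> mf.
have mfj : measurable_fun setT (fun x : borel 'rV[R]_K => (f x : 'rV[R]_K) 0 j).
  exact: measurableT_comp (mxcoord_measurable 0 j) mf.
apply: (@measurable_fun_cvg _ (borel 'rV[R]_K) R setT
  (fun n x => (n.+1%:R^-1)^-1 * (f (n.+1%:R^-1 *: delta_mx 0 j + x) 0 j - f x 0 j))).
- move=> n; apply: measurable_funM => //; apply: measurable_funB => //.
  apply: (measurableT_comp mfj); apply: mx_measurable => k l.
  under eq_fun do rewrite !mxE.
  by apply: measurable_funD => //; exact: mxcoord_measurable.
- move=> x _; have [d1 d2] := jacobian_is_derive x j.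
  have cv : n.+1%:R^-1 @[n --> \oo] --> (0 : R)^'.
    move=> A [e /= e0 eA].
    change (\forall n \near \oo, A (n.+1%:R^-1 : R)); near=> n; apply: eA.
      rewrite /= sub0r normrN gtr0_norm ?invr_gt0//.
      near: n; exact: near_infty_natSinv_lt (PosNum e0).
    by rewrite gt_eqF ?invr_gt0 ?ltr0n.
  rewrite -d2; exact: cvg_comp cv d1.
Unshelve. all: by end_near. Qed.

End jacobian.

(** * The mean-field value at empirical measures *)

Section lions_empirical.
Context {R : realType} {d : measure_display} {Omega : measurableType d}.
Variable P : probability Omega R.
Context {N K : nat}.
Hypothesis N0 : (0 < N)%N.
Variable label : Omega -> 'I_N.
Hypothesis ulabel : uniform_label P label.
Local Notation prob := (probability (borel 'rV[R]_K) R).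
Local Notation En := (@enorm R 1 K).

Lemma W2_empirical_line (x : 'M[R]_(N, K)) (h : R) i j :
  W2 En (empirical (h *: delta_mx i j + x)) (empirical x) <= `|h|.
Proof.
apply: (le_trans (W2_empirical N0 ulabel _ _)).
rewrite addrK mdot_delta -sqrtr_sqr ler_wsqrtr// ler_piMl ?sqr_ge0//.
by rewrite invf_le1 ?ltr0n// ler1n.
Qed.

(** Moving particle [i] by [h] changes the lifted random variable only where the label is [i], an
    event of probability 1/N: hence the factor in the derivative. The change has L2 norm at most
    |h|, so the Frechet remainder is of the right order. *)
Lemma lions_empirical (U : prob -> R) (x : 'M[R]_(N, K)) (g : 'rV[R]_K -> 'rV[R]_K) i j :
  is_lions_derivative P U (empirical x) g ->
  is_derive (0 : R) (1 : R) (fun h => U (empirical (h *: delta_mx i j + x)))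
    (N%:R^-1 * g (row i x) 0 j).
Proof.
case=> mg _ Ug; apply: is_derive0_epsilon => eta eta0.
have [delta d0 H] := Ug (label_mfun ulabel x) (label_row_has_law N0 ulabel x)
  (label_row_square_integrable ulabel x) _ eta0.
exists delta => // h hd.
pose y := h *: delta_mx i j + x.
have L2xy : L2norm P (label_row label y \- label_row label x) <= `|h|.
  rewrite (L2norm_label_row ulabel) /y addrK mdot_delta -sqrtr_sqr ler_wsqrtr//.
  by rewrite ler_piMl ?sqr_ge0// invf_le1 ?ltr0n// ler1n.
have := H (label_mfun ulabel y) (label_row_square_integrable ulabel y) (le_trans L2xy hd).
rewrite (distribution_label_row N0 ulabel) => Hy.
rewrite scale0r add0r.
have E : \int[P]_w mdot (g (label_row label x w)) (label_row label y w - label_row label x w) =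
    h * (N%:R^-1 * g (row i x) 0 j).
  transitivity (N%:R^-1 * \sum_k mdot (g (row k x)) (row k (y - x))).
    rewrite -(Rintegral_label ulabel (fun k => mdot (g (row k x)) (row k (y - x)))).
    by apply: eq_Rintegral => w _; rewrite label_rowB.
  rewrite mulrCA; congr (_ * _); rewrite /y addrK (bigD1 i)//= big1 ?addr0; last first.
    move=> k /negPf ki; rewrite /mdot big1// => a _; rewrite big1// => b _.
    by rewrite !mxE ki mulr0 mulr0.
  rewrite /mdot big_ord1 (bigD1 j)//= big1 ?addr0; last first.
    by move=> l /negPf lj; rewrite !mxE lj andbF !mulr0.
  by rewrite !mxE !eqxx mulr1 mulrC.
rewrite -E; apply: (le_trans Hy).
by rewrite ler_wpM2l// ltW.
Qed.

Section second.
Variables (V : R -> prob -> R) (dmu : R -> prob -> 'rV[R]_K -> 'rV[R]_K)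
  (d2mu : R -> prob -> 'rV[R]_K -> 'rV[R]_K -> 'M[R]_K).
Variables (t : R) (x : 'M[R]_(N, K)) (i : 'I_N) (j : 'I_K).
Hypothesis t01 : 0 <= t < 1.
Hypothesis dmu_diff : forall nu y, P2 En nu -> differentiable (dmu t nu) y.
Hypothesis dmu_lions : forall nu y, P2 En nu ->
  is_lions_derivative P (fun nu' => dmu t nu' y 0 j) nu
      (fun z => row j (d2mu t nu y z)).
Hypothesis Jcont : continuous_on_support (fun t nu y => 'J (dmu t nu) y).

(** Particle [i] enters twice, as the point and through the measure, and the increment is split
    accordingly. The spatial part is a mean value at the moved measure, so the Jacobian must be
    jointly continuous at the support point; the measure part, at a fixed point, is
    [lions_empirical] applied to [dmu] and produces the correction of order 1/N. *)
Lemma lions_empirical_second :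
  is_derive x (delta_mx i j) (fun y => dmu t (empirical y) (row i y) 0 j)
    (('J (dmu t (empirical x)) (row i x)) j j
     + N%:R^-1 * d2mu t (empirical x) (row i x) (row i x) j j).
Proof.
pose nu h := empirical (h *: delta_mx i j + x).
have P2nu h : P2 En (nu h) := P2_empirical N0 ulabel _.
have nu0 : nu 0 = empirical x by rewrite /nu scale0r add0r.
pose F := fun y : 'M[R]_(N, K) => dmu t (empirical y) (row i y) 0 j.
set c := (X in is_derive _ _ _ X).
suff Fl : is_derive (0 : R) (1 : R) (fun h : R => F (h *: delta_mx i j + x)) c.
  have := (is_derive_line F x (delta_mx i j) 0 c).2 Fl.
  by rewrite scale0r add0r.
apply: is_derive0_epsilon => eta eta0.
have eta2 : 0 < eta / 2 by rewrite divr_gt0.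
have [d1 d10 H1] := Jcont t01 (P2_empirical N0 ulabel x) (msupport_empirical N0 (x := x) (i := i)) eta2.
have G' := lions_empirical i j (dmu_lions (row i x) (P2_empirical N0 ulabel x)).
have [d2 d20 H2] : exists2 d2 : R, 0 < d2 & forall h : R, `|h| <= d2 ->
   `|dmu t (nu h) (row i x) 0 j - dmu t (nu 0) (row i x) 0 j -
     h * (N%:R^-1 * d2mu t (empirical x) (row i x) (row i x) j j)| <= eta / 2 * `|h|.
  rewrite mxE in G'; have [d2 d20 H2] := is_derive0_le_epsilon G' eta2.
  by exists d2.
exists (Num.min (d1 / 2) d2); first by rewrite lt_min d20 divr_gt0.
move=> h; rewrite le_min => /andP[hd1 hd2].
have {}hd1 : `|h| < d1 by apply: (le_lt_trans hd1); lra.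
have [k kh E] := @MVT_from0 R (fun k => dmu t (nu h) (k *: delta_mx 0 j + row i x) 0 j)
  (fun k => ('J (dmu t (nu h)) (k *: delta_mx 0 j + row i x)) j j) h
  (fun k => (is_derive_line (fun y => dmu t (nu h) y 0 j) (row i x) (delta_mx 0 j) k _).1
    (jacobian_is_derive (fun y => dmu_diff y (P2nu h)) _ j)).
have := H1 t (nu h) (k *: delta_mx 0 j + row i x) t01 (P2nu h).
rewrite subrr normr0 addrK enorm_delta => /(_ d10).
move=> /(_ (le_lt_trans (W2_empirical_line _ _ _ _) hd1) (le_lt_trans kh hd1)) HJ.
have := le_lt_trans (coord_le_enorm _ j j) HJ.
rewrite mx_subE => {}HJ.
have := H2 h hd2; rewrite /F row_line scale0r add0r -/(nu h) nu0.
move=> H2h; move: E; rewrite scale0r add0r => E.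
have -> : dmu t (nu h) (h *: delta_mx 0 j + row i x) 0 j =
  dmu t (nu h) (row i x) 0 j + ('J (dmu t (nu h)) (k *: delta_mx 0 j + row i x)) j j * h.
  by rewrite -E [RHS]addrC subrK.
exact: first_order_remainder HJ H2h.
Qed.

End second.

End lions_empirical.

(** * From the master equation to the particle equation *)

Section particle_vs_meanfield.
Context {R : realType} {d : measure_display} {Omega : measurableType d}.
Variable P : probability Omega R.
Context {N K : nat}.
Hypothesis N0 : (0 < N)%N.
Variable label : Omega -> 'I_N.
Hypothesis ulabel : uniform_label P label.
Local Notation prob := (probability (borel 'rV[R]_K) R).
Local Notation En := (@enorm R 1 K).
Variables (lam : nat -> R) (S : 'M[R]_K) (eps L : R) (g : prob -> R)
  (V : R -> prob -> R) (dmu : R -> prob -> 'rV[R]_K -> 'rV[R]_K)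
  (d2mu : R -> prob -> 'rV[R]_K -> 'rV[R]_K -> 'M[R]_K).
Hypotheses (lam0 : forall j, 0 <= lam j) (eps0 : 0 < eps).
Hypothesis SE : forall i j, S i j = lam j * (i == j)%:R.
Hypothesis VM : master_solution P lam S eps L g V dmu d2mu.

Lemma trace_diagonal_mul (A : 'M[R]_K) : \tr (S *m A) = \sum_(j < K) lam j * A j j.
Proof.
apply: eq_bigr => j _; rewrite mxE (bigD1 j)//= big1 ?addr0 => [|k /negPf kj].
  by rewrite SE eqxx mulr1.
by rewrite SE eq_sym kj mulr0 mul0r.
Qed.

Lemma enorm_QKsqrt (p : 'rV[R]_K) : enorm (QKsqrt lam p) ^+ 2 = \sum_(j < K) lam j * p 0 j ^+ 2.
Proof.
rewrite enorm_sqr mdotE big_ord1; apply: eq_bigr => j _.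
by rewrite mxE exprMn sqr_sqrtr.
Qed.

Let u (t : R) (x : 'M[R]_(N, K)) : R := N%:R * V t (empirical x).
Let P2x (x : 'M[R]_(N, K)) : P2 En (empirical x) := P2_empirical N0 ulabel x.
Let Nn0 : N%:R != 0 :> R. Proof. by rewrite pnatr_eq0 -lt0n. Qed.
Let NN0 : (0 : R) < N%:R. Proof. by rewrite ltr0n. Qed.

Let Dtu (t : R) (x : 'M[R]_(N, K)) := N%:R * Dt (V ^~ (empirical x)) t.
Let du (t : R) (x : 'M[R]_(N, K)) i j := dmu t (empirical x) (row i x) 0 j.
Let ddu (t : R) (x : 'M[R]_(N, K)) i j :=
  ('J (dmu t (empirical x)) (row i x)) j j
  + N%:R^-1 * d2mu t (empirical x) (row i x) (row i x) j j.

Lemma empirical_master_t (t : R) x : 0 <= t < 1 ->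
  time_quotient (u ^~ x) t @ within [set s | 0 <= s < 1] t^' --> Dtu t x.
Proof.
move=> t01; have := master_dt VM t01 (P2x x); rewrite /time_derivable => cV.
have -> : time_quotient (u ^~ x) t = (fun s => N%:R * time_quotient (V ^~ (empirical x)) t s).
  by apply/funext => s; rewrite /time_quotient /u; ring.
by apply: cvgM; [exact: cvg_cst|exact: cV].
Qed.

Lemma empirical_master_x (t : R) x i j : 0 <= t < 1 ->
  is_derive x (delta_mx i j) (u t) (du t x i j).
Proof.
move=> t01; have D := lions_empirical N0 ulabel i j (master_dmu VM t01 (P2x x)).
have D' : is_derive (0 : R) (1 : R) (fun h : R => u t (h *: delta_mx i j + x)) (du t x i j).
  have := @is_deriveM R R^o (cst (N%:R)) (fun h : R => V t (empirical (h *: delta_mx i j + x))) 0 1 0 _ (is_derive_cst _ _ _) D.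
  by move=> D'; apply: (is_derive_eq D'); rewrite /GRing.scale/= /du; field.
have := (is_derive_line (u t) x (delta_mx i j) 0 (du t x i j)).2 D'.
by rewrite scale0r add0r.
Qed.

Lemma empirical_master_xx (t : R) x i j : 0 <= t < 1 ->
  is_derive x (delta_mx i j) (fun y => du t y i j) (ddu t x i j).
Proof.
move=> t01; apply: (@lions_empirical_second _ _ _ P N K N0 label ulabel dmu d2mu t x i j t01).
- by move=> nu y P2nu; exact: (master_dxdmu VM).
- by move=> nu y P2nu; exact: (master_d2mu VM).
- exact: (master_dxdmu_cont VM).
Qed.

Lemma empirical_master_eq (t : R) x : 0 <= t < 1 ->
  Dtu t x + 2^-1 * (\sum_(i < N) \sum_(j < K) lam j * ddu t x i j)
  - (2 * eps)^-1 * (\sum_(i < N) \sum_(j < K) lam j * du t x i j ^+ 2) <= L / 2.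
Proof.
move=> t01; have P2e := P2x x.
have mdmu : measurable_fun setT (dmu t (empirical x) : borel 'rV[R]_K -> borel 'rV[R]_K).
  by have [] := master_dmu VM t01 P2e.
have I1 : \int[empirical x]_y \tr (S *m 'J (dmu t (empirical x)) y) =
    N%:R^-1 * \sum_(i < N) \sum_(j < K) lam j * ('J (dmu t (empirical x)) (row i x)) j j.
  under eq_Rintegral do rewrite trace_diagonal_mul.
  rewrite (Rintegral_empirical N0 ulabel x (f := fun y => \sum_(j < K) lam j * ('J (dmu t (empirical x)) y) j j))//.
  apply: measurable_sum => j; apply: measurable_funM => //.
  by apply: jacobian_measurable => // y; exact: (master_dxdmu VM).
have I2 : \int[empirical x]_y enorm (QKsqrt lam (dmu t (empirical x) y)) ^+ 2 =
    N%:R^-1 * \sum_(i < N) \sum_(j < K) lam j * du t x i j ^+ 2.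
  under eq_Rintegral do rewrite enorm_QKsqrt.
  rewrite (Rintegral_empirical N0 ulabel x (f := fun y => \sum_(j < K) lam j * dmu t (empirical x) y 0 j ^+ 2))//.
  apply: measurable_sum => j; apply: measurable_funM => //.
  by apply: measurable_funX; exact: measurableT_comp (mxcoord_measurable 0 j) mdmu.
have I3 : \int[empirical x]_y \tr (S *m d2mu t (empirical x) y y) =
    N%:R^-1 * \sum_(i < N) \sum_(j < K) lam j * d2mu t (empirical x) (row i x) (row i x) j j.
  rewrite (Rintegral_empirical N0 ulabel x (f := fun y => \tr (S *m d2mu t (empirical x) y y))).
    by congr (_ * _); apply: eq_bigr => i _; rewrite trace_diagonal_mul.
  apply/measurable_EFinP; exact: (measurable_int _ (master_d2mu_integrable VM t01 P2e)).
have := master_pde VM t01 P2e; rewrite I1 I2 => pde.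
have := master_d2mu_bound VM t01 P2e; rewrite I3 => /(le_trans (ler_norm _)).
have -> : \sum_(i < N) \sum_(j < K) lam j * ddu t x i j =
   \sum_(i < N) \sum_(j < K) lam j * ('J (dmu t (empirical x)) (row i x)) j j +
   N%:R^-1 * \sum_(i < N) \sum_(j < K) lam j * d2mu t (empirical x) (row i x) (row i x) j j.
  rewrite mulr_sumr -big_split/=; apply: eq_bigr => i _.
  rewrite mulr_sumr -big_split/=; apply: eq_bigr => j _.
  by rewrite /ddu; ring.
move: pde; rewrite /Dtu.
move: (\sum_i _) (\sum_i _) (\sum_i _) (Dt _ _) ((2 * eps)^-1) => s1 s2 s3 D c pde bd.
have Npde : N%:R * (D + 2^-1 * (N%:R^-1 * s3) - c * (N%:R^-1 * s2)) = 0 by rewrite pde mulr0.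
have : N%:R * D + 2^-1 * s3 - c * s2 = 0 by rewrite -Npde; field.
by lra.
Qed.

Lemma empirical_master_continuous :
  {within [set z : R * 'M[R]_(N, K) | 0 <= z.1 <= 1], continuous (fun z => u z.1 z.2)}.
Proof.
apply/subspace_continuousP => -[t x] /= t01.
apply: cvgM; first exact: cvg_cst.
apply/cvgrPdist_lt => eta eta0.
have [delta d0 H] := master_continuous VM t01 (P2x x) eta0.
(* The topology is that of the sup norm. Entries below [delta / k] give a Euclidean norm below
   [delta], since N K < k^2. *)
pose k : R := (N * K)%:R + 1.
have k0 : 0 < k by rewrite ltr_wpDl.
exists (ball (t, x).1 (delta / k), ball (t, x).2 (delta / k)) => /=.
  by split; apply: nbhsx_ballx; rewrite divr_gt0.
move=> [s y] [/= ts [_ xy]] s01; rewrite distrC; apply: H => //.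
  rewrite distrC; apply: (lt_le_trans ts).
  by rewrite ler_pdivrMr// ler_peMr ?(ltW d0)// lerDr.
apply: (le_lt_trans (W2_empirical N0 ulabel y x)).
have xyd i j : (y - x) i j ^+ 2 <= (delta / k) ^+ 2.
  rewrite mx_subE -[leLHS]real_normK ?num_real// ler_pXn2r ?nnegrE//; last first.
    by rewrite ltW// divr_gt0.
  by rewrite ltW// distrC; exact: xy.
have mdk : mdot (y - x) (y - x) <= (N * K)%:R * (delta / k) ^+ 2.
  rewrite mdotE natrM -mulrA.
  apply: (@le_trans _ _ (\sum_(i < N) \sum_(j < K) (delta / k) ^+ 2)).
    by apply: ler_sum => i _; apply: ler_sum => j _.
  by rewrite !sumr_const !card_ord !mulr_natl.
rewrite -[ltRHS](gtr0_norm d0) -sqrtr_sqr ltr_sqrt ?exprn_gt0//.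
apply: (@le_lt_trans _ _ (mdot (y - x) (y - x))).
  by rewrite ler_piMl ?mdot_ge0// invf_le1// ler1n.
apply: (le_lt_trans mdk); rewrite exprMn mulrCA gtr_pMr ?exprn_gt0//.
rewrite exprVn ltr_pdivrMr ?exprn_gt0// mul1r.
by rewrite /k; have := ler0n R (N * K); nra.
Qed.

(** If the set of norms had no supremum, [sup] would be 0 by convention, so boundedness need not be
    established. *)
Lemma opnorm_ge0 (A : 'M[R]_K) : 0 <= opnorm A.
Proof.
have E0 : [set enorm (w *m A) | w in [set w : 'rV[R]_K | enorm w <= 1]] 0.
  by exists 0; rewrite /= ?mul0mx /enorm mdotE big1 ?sqrtr0 ?ler01// => k _;
    rewrite big1// => l _; rewrite mxE expr0n.
have [hs|/sup_out] := pselect (has_sup [set enorm (w *m A) | w in [set w : 'rV[R]_K | enorm w <= 1]]).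
  by apply: ub_le_sup => //; have [] := hs.
by rewrite /opnorm => ->.
Qed.

Lemma enorm_row_le (x : 'M[R]_(N, K)) i : enorm (row i x) <= enorm x.
Proof.
rewrite /enorm ler_wsqrtr// [leRHS]enormE_row (bigD1 i)//= enorm_sqr lerDl.
by apply: sumr_ge0 => k _; exact: sqr_ge0.
Qed.

(** For the growth of [v - u] one-sided bounds suffice: a quadratic bound on [v] from above and a
    constant bound on [V] from below. *)
Lemma particle_le_meanfield (v : R -> 'M[R]_(N, K) -> R) (Cv CV : R) :
  HJB_classical_solution lam S eps g v ->
  (forall (t : R) x, 0 <= t <= 1 -> v t x <= Cv * (1 + mdot x x)) ->
  (forall (t : R) nu, 0 <= t <= 1 -> P2 En nu -> - CV <= V t nu) ->
  forall x, v 0 x <= N%:R * V 0 (empirical x) + L / 2.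
Proof.
move=> vHJB vC VC x.
have [C0 gr] := master_growth VM.
(* One constant for both growth conditions: [Cv] and [CV] bound the difference of values, while [C0]
   bounds the gradient, with factor 2 because 1 + |x_i| + M2^(1/2) <= 2 (1 + |x|). *)
pose C := 2 * `|C0| + `|Cv| + N%:R * `|CV|.
apply: (@comparison R N K lam eps L C v u (fun t x => Dt (v ^~ x) t) Dtu
  (fun t x i j => grad v t x i 0 j) du (fun t x i j => hess v t x i j j) ddu) => //.
- have cv := HJB_continuous vHJB; have cu := empirical_master_continuous.
  by move=> z; apply: cvgB; [exact: cv|exact: cu].
- by move=> y; rewrite (HJB_terminal vHJB) /u (master_terminal VM).
- move=> t y t01; have h1 := vC t y t01; have h2 := VC t _ t01 (P2x y).
  have q0 := mdot_ge0 y; have h3 := ler_norm Cv; have h4 := ler_norm CV.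
  have h5 := ler_wpM2l (ltW NN0) h2.
  have h6 := ler_wpM2l (ltW NN0) h4.
  have h7 := ler_wpM2r (addr_ge0 ler01 q0) h3.
  have h8 : 0 <= N%:R * `|CV| * mdot y y by rewrite !mulr_ge0.
  have h9 : 0 <= 2 * `|C0| * (1 + mdot y y) by rewrite !mulr_ge0// addr_ge0.
  rewrite /u /C !mulrDl; lra.
- by move=> t y t01; exact: (C12_dt (HJB_regular vHJB)).
- by move=> t y t01; exact: empirical_master_t.
- move=> t y i j t01; rewrite /grad mxE; apply: derivableP.
  exact: (C12_grad (HJB_regular vHJB)).
- by move=> t y i j t01; exact: empirical_master_x.
- move=> t y i j t01; rewrite /hess mxE; apply: derivableP.
  exact: (C12_hess (HJB_regular vHJB)).
- by move=> t y i j t01; exact: empirical_master_xx.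
- move=> t y t01; have := HJB_equation vHJB y t01.
  under eq_bigr do rewrite trace_diagonal_mul.
  under [X in _ - _ * X]eq_bigr do rewrite enorm_QKsqrt.
  by move=> ->.
- by move=> t y t01; exact: empirical_master_eq.
- move=> t y i j t01; have := gr t _ (row i y) t01 (P2x y).
  have := opnorm_ge0 ('J (dmu t (empirical y)) (row i y)).
  have := coord_le_enorm (dmu t (empirical y) (row i y)) 0 j.
  rewrite (M2_empirical N0 ulabel) -/(du t y i j) => h1 h2 h3.
  have h4 := enorm_row_le y i; have e0 := enorm_ge0 y; have er0 := enorm_ge0 (row i y).
  have h5 : Num.sqrt (N%:R^-1 * mdot y y) <= enorm y.
    by rewrite ler_wsqrtr// ler_piMl ?mdot_ge0// invf_le1// ler1n.
  have h6 := sqrtr_ge0 (N%:R^-1 * mdot y y).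
  have h7 : C0 * (1 + enorm (row i y) + Num.sqrt (N%:R^-1 * mdot y y)) <=
      `|C0| * (2 * (1 + enorm y)).
    apply: (@le_trans _ _ (`|C0| * (1 + enorm (row i y) + Num.sqrt (N%:R^-1 * mdot y y)))).
      by rewrite ler_wpM2r ?ler_norm//; lra.
    by rewrite ler_wpM2l//; lra.
  have h8 : 0 <= `|Cv| * (1 + enorm y) by rewrite mulr_ge0// addr_ge0.
  have h9 : 0 <= N%:R * `|CV| * (1 + enorm y) by rewrite !mulr_ge0// addr_ge0.
  by rewrite /C !mulrDl; lra.
Qed.

End particle_vs_meanfield.

Section integral_scale.
Local Open Scope ereal_scope.
Context {R : realType} {d : measure_display} {T : measurableType d}.
Variable mu : {measure set T -> \bar R}.
Import HBNNSimple.

(** For energies, whose measurability in the random parameter is not known. Rescaling the simple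
    functions below [c f] gives this direction, which is the one that bounds costs from above. *)
Lemma ge0_integralZ_le_nonmeasurable (c : R) (f : T -> \bar R) : (0 < c)%R ->
  (forall x, 0 <= f x) -> \int[mu]_x (c%:E * f x) <= c%:E * \int[mu]_x f x.
Proof.
move=> c0 f0.
have cf0 x : 0 <= c%:E * f x by rewrite mule_ge0// lee_fin ltW.
rewrite [leLHS]ge0_integralTE//; apply: ge_ereal_sup => _ [h /= hf <-].
have ci0 : (0 <= c^-1)%R by rewrite invr_ge0 ltW.
pose k := scale_nnsfun h ci0.
have kh : sintegral mu h = c%:E * sintegral mu k.
  rewrite /k /= sintegralrM muleA -EFinM mulfV ?mul1e// gt_eqF//.
rewrite kh lee_pmul2l//.
rewrite ge0_integralTE//; apply: ereal_sup_ubound; exists k => //= x.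
by rewrite EFinM lee_pdivrMl.
Qed.

End integral_scale.

(** Cauchy-Schwarz on an interval of length at most 1, obtained by integrating (f - c)^2 >= 0 with c
    the integral of f. When the right-hand side is infinite there is nothing to prove. *)
Lemma sqr_Rintegral_le {R : realType} (t : R) (f : R -> R) : 0 <= t <= 1 ->
  measurable_fun `[t, 1]%classic f ->
  (((\int[lebesgue_measure]_(s in `[t, 1]) f s) ^+ 2)%:E <=
   \int[lebesgue_measure]_(s in `[t, 1%R]) (f s ^+ 2)%:E)%E.
Proof.
move=> /andP[t0 t1] mf; set c := Rintegral _ _ _.
pose D : set R := `[t, 1]%classic.
have mD : measurable D by exact: measurable_itv.
have muD : lebesgue_measure D = (1 - t)%:E.
  rewrite /D lebesgue_measure_itv/= lte_fin; case: ltP => //.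
  move=> h; have ->  : t = 1 by apply/eqP; rewrite eq_le t1 h.
  by rewrite subrr.
have [foo|] := ltP (\int[lebesgue_measure]_(s in D) (f s ^+ 2)%:E)%E +oo%E; last first.
  by rewrite leye_eq => /eqP ->; rewrite leey.
have if2 : lebesgue_measure.-integrable D (EFin \o (fun s => f s ^+ 2)).
  apply/integrableP; split.
    by apply/measurable_EFinP; exact: measurable_funX.
  under eq_integral do rewrite /= ger0_norm ?sqr_ge0//.
  exact: foo.
have ic (a : R) : lebesgue_measure.-integrable D (EFin \o cst a).
  apply: continuous_compact_integrable; first exact: segment_compact.
  by apply: continuous_subspaceT => x; exact: cvg_cst.
have if1 : lebesgue_measure.-integrable D (EFin \o f).
  apply: (@le_integrable _ _ R lebesgue_measure D mD (EFin \o f) (EFin \o (fun s => 1 + f s ^+ 2))).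
  - exact/measurable_EFinP.
  - move=> s _; rewrite /= lee_fin [leRHS]ger0_norm; last by rewrite addr_ge0// sqr_ge0.
    rewrite -[f s ^+ 2]real_normK ?num_real//.
    by move: `|f s| (normr_ge0 (f s)) => y y0; have := sqr_ge0 (y - 1); rewrite sqrrB; nra.
  - by rewrite /comp; under eq_fun do rewrite EFinD; apply: integrableD => //; exact: (ic 1).
have if2c : lebesgue_measure.-integrable D (EFin \o (fun s => - (2 * c) * f s)).
  by rewrite /comp; under eq_fun do rewrite EFinM; exact: integrableZl.
have if2cc : lebesgue_measure.-integrable D (EFin \o (fun s => - (2 * c) * f s + c ^+ 2)).
  by rewrite /comp; under eq_fun do rewrite EFinD; apply: integrableD => //; exact: (ic (c ^+ 2)).
have : 0 <= \int[lebesgue_measure]_(s in D) (f s - c) ^+ 2.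
  by apply: Rintegral_ge0 => s _; exact: sqr_ge0.
have -> : (fun s => (f s - c) ^+ 2) = (fun s => f s ^+ 2 + (- (2 * c) * f s + c ^+ 2)).
  by apply/funext => s; ring.
rewrite RintegralD// RintegralD//; last exact: (ic (c ^+ 2)).
rewrite RintegralZl// Rintegral_cst//.
have -> : fine (lebesgue_measure D) = 1 - t by rewrite -[RHS]/(fine (1 - t)%:E) -muD.
rewrite -/c => h.
have fin : (\int[lebesgue_measure]_(s in D) (f s ^+ 2)%:E)%E \is a fin_num.
  exact: integrable_fin_num if2.
rewrite -(fineK fin) lee_fin.
move: h; rewrite {1}/Rintegral; move: (fine _) => I h.
have : 0 <= c ^+ 2 * t by rewrite mulr_ge0// sqr_ge0.
by move: h; rewrite -/D -/c; nra.
Qed.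

(** * Bounds on the values *)

Section inner_product.
Context {R : realType} {H : completeNormedModType R}.
Variables (dot : H -> H -> R) (e : nat -> H).
Hypothesis ip : is_inner_product dot.

Lemma dotDl x y z : dot (x + y) z = dot x z + dot y z.
Proof. by rewrite -[x]scale1r (dot_linear ip) mul1r scale1r. Qed.

Lemma dot0l z : dot 0 z = 0.
Proof. by have := dotDl 0 0 z; rewrite addr0 => h; lra. Qed.

Lemma dotZl (a : R) x z : dot (a *: x) z = a * dot x z.
Proof. by rewrite -[a *: x]addr0 (dot_linear ip) dot0l addr0. Qed.

Lemma dotNl x z : dot (- x) z = - dot x z.
Proof. by rewrite -scaleN1r dotZl mulN1r. Qed.

Lemma dotBl x y z : dot (x - y) z = dot x z - dot y z.
Proof. by rewrite dotDl dotNl. Qed.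

Lemma dotDr x y z : dot x (y + z) = dot x y + dot x z.
Proof. by rewrite !(dot_sym ip x) dotDl. Qed.

Lemma dot_suml (I : Type) (r : seq I) (F : I -> H) z :
  dot (\sum_(i <- r) F i) z = \sum_(i <- r) dot (F i) z.
Proof.
elim: r => [|i r IH]; first by rewrite !big_nil dot0l.
by rewrite !big_cons dotDl IH.
Qed.

Lemma sqr_normD x y : `|x + y| ^+ 2 = `|x| ^+ 2 + 2 * dot x y + `|y| ^+ 2.
Proof. by rewrite -!(dot_norm ip) dotDl !dotDr (dot_sym ip y x); ring. Qed.

Lemma dot_continuous z : continuous (dot ^~ z).
Proof.
(* Polarization reduces continuity of the inner product to that of the norm. *)
have -> : dot ^~ z = (fun x => (`|x + z| ^+ 2 - `|x| ^+ 2 - `|z| ^+ 2) / 2).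
  by apply/funext => x; rewrite sqr_normD; field.
have csq (y : H) : continuous (fun x : H => `|x + y| ^+ 2).
  move=> x; apply: (@cvg_comp _ _ _ (fun x : H => `|x + y|) (fun r => r ^+ 2)).
    apply: (@cvg_comp _ _ _ (fun x : H => x + y) Num.norm).
      by apply: cvgD; [exact: cvg_id|exact: cvg_cst].
    exact: norm_continuous.
  exact: exprn_continuous.
move=> x; apply: cvgM; last exact: cvg_cst.
apply: cvgB; last exact: cvg_cst.
apply: cvgB; first exact: csq.
have := csq 0; rewrite (_ : (fun x0 : H => _) = (fun x0 : H => `|x0| ^+ 2)); first exact.
by apply/funext => y; rewrite addr0.
Qed.

Lemma dot_measurable z : measurable_fun setT (fun x : borel H => dot (x : H) z).
Proof. exact: continuous_borel_measurable (@dot_continuous z). Qed.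

Lemma norm_borel_measurable : measurable_fun setT (fun x : borel H => `|x : H|).
Proof. exact: continuous_borel_measurable (@norm_continuous R H). Qed.

Hypothesis onb : orthonormal_basis dot e.

Lemma dot_embed K (c : 'rV[R]_K) (j : 'I_K) : dot (embed e c) (e j) = c 0 j.
Proof.
rewrite dot_suml (bigD1 j)//= big1 ?addr0 => [|i ij].
  by rewrite dotZl (basis_orthonormal onb) eqxx mulr1.
rewrite dotZl (basis_orthonormal onb).
by rewrite (_ : (i == j :> nat) = false) ?mulr0//; apply/negbTE.
Qed.

Lemma dot_embedl K (c : 'rV[R]_K) x : dot (embed e c) x = \sum_(j < K) c 0 j * dot x (e j).
Proof. by rewrite dot_suml; apply: eq_bigr => j _; rewrite dotZl (dot_sym ip). Qed.

Lemma sqr_norm_embed K (c : 'rV[R]_K) : `|embed e c| ^+ 2 = mdot c c.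
Proof.
rewrite -(dot_norm ip) dot_embedl /mdot big_ord1.
by apply: eq_bigr => j _; rewrite dot_embed.
Qed.

Lemma embedD K (c c' : 'rV[R]_K) : embed e (c + c') = embed e c + embed e c'.
Proof. by rewrite /embed -big_split/=; apply: eq_bigr => j _; rewrite mxE scalerDl. Qed.

(** Pythagoras: the residual of the projection is orthogonal to H_K. This separates the noise error
    from the truncation error in the Wasserstein estimate. *)
Lemma sqr_norm_embed_sub K (c : 'rV[R]_K) x :
  `|embed e (projHK dot e K x + c) - x| ^+ 2 =
  mdot c c + `|x - embed e (projHK dot e K x)| ^+ 2.
Proof.
set p := embed e (projHK dot e K x).
have -> : embed e (projHK dot e K x + c) - x = embed e c + (p - x).
  by rewrite embedD addrA [_ + p]addrC.
rewrite sqr_normD sqr_norm_embed (distrC p).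
have -> : dot (embed e c) (p - x) = 0.
  by rewrite dot_embedl big1// => j _; rewrite dotBl dot_embed mxE subrr mulr0.
by rewrite mulr0 addr0.
Qed.

Lemma mdot_projHK_le K x : mdot (projHK dot e K x) (projHK dot e K x) <= `|x| ^+ 2.
Proof.
have := sqr_norm_embed_sub (- projHK dot e K x) x.
rewrite subrr (_ : embed e 0 = 0); last first.
  by rewrite /embed big1// => j _; rewrite mxE scale0r.
rewrite sub0r normrN => ->.
have -> : mdot (- projHK dot e K x) (- projHK dot e K x) = mdot (projHK dot e K x) (projHK dot e K x).
  by rewrite !mdotE; apply: eq_bigr => i _; apply: eq_bigr => j _; rewrite mxE sqrrN.
by rewrite lerDl sqr_ge0.
Qed.

Lemma parseval x : series (fun j => dot x (e j) ^+ 2) @ \oo --> `|x| ^+ 2.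
Proof.
have E n : series (fun j => dot x (e j) ^+ 2) n =
    `|series (fun j => dot x (e j) *: e j) n| ^+ 2.
  rewrite /series /= !big_mkord.
  have -> : \sum_(j < n) dot x (e j) *: e j = embed e (projHK dot e n x).
    by rewrite /embed; apply: eq_bigr => j _; rewrite mxE.
  by rewrite sqr_norm_embed mdotE big_ord1; apply: eq_bigr => j _; rewrite mxE.
rewrite (_ : series _ = fun n => `|series (fun j => dot x (e j) *: e j) n| ^+ 2); last exact/funext.
apply: (@cvg_comp _ _ _ (fun n => `|series (fun j => dot x (e j) *: e j) n|) (fun r => r ^+ 2)); last exact: exprn_continuous.
apply: cvg_norm; exact: basis_total onb x.
Qed.

(** Continuity alone gives measurability for the Borel sets of the product, not for the product
    sigma-algebra. By Parseval the squared distance is a limit of finite sums of squared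
    coordinates, each of them product-measurable. *)
Lemma norm_sub_measurable :
  measurable_fun setT (fun z : (borel H * borel H)%type => `|(z.1 : H) - (z.2 : H)|).
Proof.
have msq : measurable_fun setT (fun z : (borel H * borel H)%type => `|(z.1 : H) - (z.2 : H)| ^+ 2).
  apply: (@measurable_fun_cvg _ _ _ setT
    (fun n (z : (borel H * borel H)%type) => series (fun j => dot ((z.1 : H) - (z.2 : H)) (e j) ^+ 2) n)).
    move=> n; rewrite /series /=; apply: measurable_sum => j.
    apply: measurable_funX; under eq_fun do rewrite dotBl.
    apply: measurable_funB.
      by apply: (measurableT_comp (dot_measurable (e j))); exact: measurable_fst.
    by apply: (measurableT_comp (dot_measurable (e j))); exact: measurable_snd.
  by move=> z _; exact: parseval.
rewrite (_ : (fun _ => _) = fun z : (borel H * borel H)%type => Num.sqrt (`|(z.1 : H) - (z.2 : H)| ^+ 2)); last first.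
  by apply/funext => z; rewrite sqrtr_sqr normr_id.
by apply: measurableT_comp msq; exact: continuous_measurable_fun (@sqrt_continuous R).
Qed.

Variables (Q : {linear H -> H}) (lam : nat -> R).
Hypothesis cov : covariance_operator dot Q e lam.

Lemma QKE K (i j : 'I_K) : QK dot Q e K i j = lam j * (i == j)%:R.
Proof.
rewrite mxE (cov_eigen cov) dotZl (basis_orthonormal onb) eq_sym.
by congr (_ * _%:R).
Qed.

Lemma trace_partial_le K : \sum_(j < K) lam j <= traceop dot Q e.
Proof.
have E j : dot (Q (e j)) (e j) = lam j.
  by rewrite (cov_eigen cov) dotZl (basis_orthonormal onb) eqxx mulr1.
rewrite (eq_bigr (fun j : 'I_K => dot (Q (e j)) (e j))) => [|j _]; last by rewrite E.
rewrite -(big_mkord xpredT (fun j => dot (Q (e j)) (e j))).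
apply: (nondecreasing_cvgn_le _ (cov_trace_class cov)).
apply/nondecreasing_seqP => n; rewrite /series/= big_nat_recr//= lerDl E.
by rewrite ltW// (cov_eigen_gt0 cov).
Qed.

End inner_product.

Section values.
Context {R : realType} {H : completeNormedModType R}.
Variables (dot : H -> H -> R) (Q : {linear H -> H}) (e : nat -> H) (lam : nat -> R).
Context {d : measure_display} {Omega : measurableType d}.
Variables (P : probability Omega R) (F : R -> set (set Omega))
  (W : forall N K : nat, R -> Omega -> 'M[R]_(N, K))
  (G : probability (borel H) R -> R) (L : R -> nat -> R).
Hypotheses (ip : is_inner_product dot) (onb : orthonormal_basis dot e)
  (cov : covariance_operator dot Q e lam) (sb : stochastic_basis dot Q e P F W)
  (mh : master_hypothesis dot Q e lam G P F W L).
Local Notation nrm := (fun x : H => `|x|).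

Let filF := basis_filtration sb.
Let lam_gt0 j : 0 < lam j := cov_eigen_gt0 cov j.
Let in01_0 : 0 <= (0 : R) <= 1. Proof. by rewrite lexx ler01. Qed.

Lemma QK_diag_gt0 K (j : 'I_K) : 0 < QK dot Q e K j j.
Proof. by rewrite (QKE ip onb cov) eqxx mulr1. Qed.

Lemma normQK_sqr K (h : 'rV[R]_K) : normQK lam h ^+ 2 = \sum_(j < K) (lam j)^-1 * h 0 j ^+ 2.
Proof.
rewrite /normQK enorm_sqr mdotE big_ord1; apply: eq_bigr => j _.
by rewrite mxE exprMn exprVn sqr_sqrtr// ltW.
Qed.

Lemma energy_ge0 N K (t : R) (theta : R -> Omega -> 'M[R]_(N, K)) w :
  (0 <= energy lam t theta w)%E.
Proof.
by apply: sume_ge0 => i _; apply: integral_ge0 => s _; rewrite lee_fin sqr_ge0.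
Qed.

Lemma V0_le mu : P2 nrm mu -> V0 G <= G mu.
Proof.
move=> Pmu; have [m Gm] := G_bounded_below mh.
apply: ge_inf; last by exists mu.
by exists m => _ [nu Pnu <-]; exact: Gm.
Qed.

Let norm_sqr_measurable :
  measurable_fun setT (fun y : borel H => (`|y : H| ^+ 2)%:E).
Proof.
by apply/measurable_EFinP; apply: measurable_funX; exact: norm_borel_measurable.
Qed.

Let norm_sqr_ge0 (y : borel H) : (0 <= (`|y : H| ^+ 2)%:E)%E.
Proof. by rewrite lee_fin sqr_ge0. Qed.

Lemma integral_norm_embed K (nu : probability (borel 'rV[R]_K) R) :
  (\int[distribution nu (@embed_mfun R H e K)]_y (`|y : H| ^+ 2)%:E =
   \int[nu]_y (enorm (y : 'rV[R]_K) ^+ 2)%:E)%E.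
Proof.
rewrite (ge0_integral_distribution (@embed_mfun R H e K) norm_sqr_measurable norm_sqr_ge0).
by apply: eq_integral => y _; rewrite /= (sqr_norm_embed ip onb) -enorm_sqr.
Qed.

Lemma P2_embed K (nu : probability (borel 'rV[R]_K) R) :
  P2 (@enorm R 1 K) nu -> P2 nrm (distribution nu (@embed_mfun R H e K)).
Proof. by rewrite /P2 integral_norm_embed. Qed.

Lemma M2_embed K (nu : probability (borel 'rV[R]_K) R) :
  M2 nrm (distribution nu (@embed_mfun R H e K)) = M2 (@enorm R 1 K) nu.
Proof. by rewrite /M2 /Rintegral integral_norm_embed. Qed.

Lemma GK_ge_V0 K (nu : probability (borel 'rV[R]_K) R) :
  P2 (@enorm R 1 K) nu -> V0 G <= GK e G nu.
Proof. by move=> P2nu; apply: V0_le; exact: P2_embed. Qed.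

(** [basis_rich] realises laws on H, so the uniform law on the integers below N is placed on
    multiples of [e 0] and read off through the inner product with [e 0]. *)
Lemma uniform_label_exists N : (0 < N)%N ->
  exists label : Omega -> 'I_N, uniform_label P label.
Proof.
move=> N0; pose x : 'M[R]_(N, 1) := \matrix_(i, j) i%:R.
have [xi xiF xilaw] := basis_rich sb (distribution (empirical x) (@embed_mfun R H e 1)).
have mxi : measurable_fun setT (xi : Omega -> borel H).
  exact: (filtration_measurable_fun filF in01_0 xiF).
pose zeta w := dot (xi w) (e 0).
have mzeta : measurable_fun setT zeta by exact: measurableT_comp (dot_measurable ip (e 0)) mxi.
have zetaE (i : 'I_N) : P (zeta @^-1` [set i%:R]) = (N%:R^-1)%:E.
  pose B : set (borel H) := (fun y : H => dot y (e 0)) @^-1` [set i%:R].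
  have mB : measurable B.
    by rewrite -[B]setTI; apply: (dot_measurable ip (e 0)).
  rewrite (_ : zeta @^-1` _ = xi @^-1` B)// xilaw//.
  rewrite /distribution /pushforward /= empiricalE// /sum_dirac.
  rewrite (bigD1 i)//= big1 ?adde0; last first.
    move=> k ki; rewrite diracE memNset//= /B /= -[e 0]/(e (ord0 : 'I_1)) /embed_mfun (dot_embed ip onb) !mxE.
    by move/eqP; rewrite eqr_nat; apply/negP.
  by rewrite diracE mem_set ?mule1//= /B /= -[e 0]/(e (ord0 : 'I_1)) /embed_mfun (dot_embed ip onb) !mxE.
have [i0 _] : exists i0 : 'I_N, true by exists (Ordinal N0).
(* The coordinate is one of the N integers almost surely only; elsewhere the label defaults to
   [i0]. *)
pose label w : 'I_N := odflt i0 [pick i : 'I_N | zeta w == i%:R].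
have labelE w (i : 'I_N) : zeta w = i%:R -> label w = i.
  rewrite /label; case: pickP => [k /eqP -> /eqP|/(_ i) + E]; last by rewrite E eqxx.
  by rewrite eqr_nat => /eqP/ord_inj.
have mz (i : 'I_N) : measurable (zeta @^-1` [set i%:R]).
  by rewrite -[X in measurable X]setTI; exact: mzeta.
have labelN (i : 'I_N) : i != i0 -> label @^-1` [set i] = zeta @^-1` [set i%:R].
  move=> ii0; apply/seteqP; split=> w /=; last exact: labelE.
  rewrite /label; case: pickP => [k /eqP -> /= -> //|_ /= E].
  by rewrite -E eqxx in ii0.
have E0 : label @^-1` [set i0] = zeta @^-1` [set i0%:R] `|`
    ~` (\bigcup_(i in [set: 'I_N]) zeta @^-1` [set i%:R]).
  apply/seteqP; split=> w /=.
    rewrite /label; case: pickP => [k /eqP zk /= <-|no _]; [left|right] => //.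
    by move=> [i _ /= zi]; have := no i; rewrite zi eqxx.
  case=> [|no]; first exact: labelE.
  by rewrite /label; case: pickP => //= k /eqP zk; case: no; exists k.
have ml (i : 'I_N) : measurable (label @^-1` [set i]).
  have [->|ii0] := eqVneq i i0; last by rewrite labelN//; exact: mz.
  rewrite E0; apply: measurableU; first exact: mz.
  apply: measurableC; apply: fin_bigcup_measurable => [|k _]; first exact: finite_finset.
  exact: mz.
exists label => i; split; first exact: ml.
have [->|ii0] := eqVneq i i0; last by rewrite labelN//; exact: zetaE.
(* The fibres partition [Omega], so the default label, whose fibre also contains the exceptional
   set, receives the mass left by the others. *)
have mU : measurable (\big[setU/set0]_(k < N) label @^-1` [set k]).
  by apply: bigsetU_measurable => k _; exact: ml.
have tl : trivIset [set: 'I_N] (fun k => label @^-1` [set k]).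
  by apply/trivIsetP => k l _ _ kl; apply/seteqP; split=> // w [/= -> lk]; rewrite lk eqxx in kl.
have := measure_semi_additive_ord P ml tl mU.
have -> : \big[setU/set0]_(k < N) label @^-1` [set k] = setT.
  apply/seteqP; split=> // w _; rewrite (bigD1 (label w))//=; by left.
rewrite (bigD1 i0)//= (eq_bigr (fun=> (N%:R^-1)%:E)); last first.
  by move=> k kn; rewrite (labelN _ kn); exact: zetaE.
rewrite sumEFin sumr_const cardC1 card_ord => PT.
have {PT} : (1 = P (label @^-1` [set i0]) + (N%:R^-1 *+ N.-1)%:E)%E.
  by rewrite -PT; apply/esym; exact: probability_setT.
have := fin_num_measure P _ (ml i0); move: (P _) => [p _| |]//.
rewrite -EFinD => -[] h; congr EFin.
have : N%:R^-1 *+ N.-1 + N%:R^-1 = 1 :> R.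
  by rewrite -mulrSr prednK// -[LHS]mulr_natr mulVf// pnatr_eq0 -lt0n.
by move: h; lra.
Qed.

End values.

Lemma mdotD_le {R : realType} {m n : nat} (x y : 'M[R]_(m, n)) :
  mdot (x + y) (x + y) <= 2 * mdot x x + 2 * mdot y y.
Proof.
rewrite !mdotE !mulr_sumr -big_split/=; apply: ler_sum => i _.
rewrite !mulr_sumr -big_split/=; apply: ler_sum => j _; rewrite mxE.
by have := sqr_ge0 (x i j - y i j); nra.
Qed.

Lemma integral_probability_cst {R : realType} {d} {T : measurableType d}
  (P : probability T R) (c : R) : (\int[P]_w c%:E = c%:E)%E.
Proof.
rewrite integral_cst// -[RHS]mule1; congr (_ * _)%E.
exact: probability_setT.
Qed.

Section value_bounds.
Context {R : realType} {H : completeNormedModType R}.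
Variables (dot : H -> H -> R) (Q : {linear H -> H}) (e : nat -> H) (lam : nat -> R).
Context {d : measure_display} {Omega : measurableType d}.
Variables (P : probability Omega R) (F : R -> set (set Omega))
  (W : forall N K : nat, R -> Omega -> 'M[R]_(N, K))
  (G : probability (borel H) R -> R) (L : R -> nat -> R).
Hypotheses (ip : is_inner_product dot) (onb : orthonormal_basis dot e)
  (cov : covariance_operator dot Q e lam) (sb : stochastic_basis dot Q e P F W)
  (mh : master_hypothesis dot Q e lam G P F W L).
Local Notation nrm := (fun x : H => `|x|).

Let filF := basis_filtration sb.
Let wW N K := basis_wiener sb N K.
Let lam_gt0 j : 0 < lam j := cov_eigen_gt0 cov j.
Let Sgt0 := QK_diag_gt0 ip onb cov.
Let in01_1 : 0 <= (1 : R) <= 1. Proof. by rewrite lexx ler01. Qed.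

Lemma wiener_increment_mx_measurable N K (t : R) : 0 <= t <= 1 ->
  measurable_fun setT (fun w => W N K 1 w - W N K t w : borel 'M[R]_(N, K)).
Proof.
move=> t01; apply: mx_measurable => i j; under eq_fun do rewrite mx_subE.
by apply: measurable_funB; apply: (wiener_coord_measurable filF (wW N K)).
Qed.

Lemma wiener_increment_mdot N K (t : R) : 0 <= t <= 1 ->
  (\int[P]_w (mdot (W N K 1%R w - W N K t w) (W N K 1%R w - W N K t w))%:E
   <= (N%:R * \sum_(j < K) lam j)%:E)%E.
Proof.
move=> /andP[t0]; rewrite le_eqVlt => /predU1P[->|t1].
  rewrite integral0_eq => [|w _]; last first.
    by rewrite subrr mdotE big1// => i _; rewrite big1// => j _; rewrite mxE expr0n.
  by rewrite lee_fin mulr_ge0// sumr_ge0// => j _; exact: ltW.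
have mD i j := wiener_increment_measurable filF (wW N K) i j t0 t1 (lexx 1).
under eq_integral do rewrite mdotE -sumEFin.
rewrite ge0_integral_sum//; last 2 first.
- by move=> i; apply/measurable_EFinP; apply: measurable_sum => j; apply: measurable_funX; exact: mD.
- by move=> i w _; rewrite lee_fin sumr_ge0// => j _; exact: sqr_ge0.
rewrite -[N in leRHS]card_ord mulr_natl -sumr_const -sumEFin.
apply: lee_sum => i _.
under eq_integral do rewrite -sumEFin.
rewrite ge0_integral_sum//; last 2 first.
- by move=> j; apply/measurable_EFinP; apply: measurable_funX; exact: mD.
- by move=> j w _; rewrite lee_fin sqr_ge0.
rewrite -sumEFin; apply: lee_sum => j _.
apply: (le_trans (wiener_increment_second_moment filF (wW N K) i t0 t1 (lexx 1) (Sgt0 j))).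
rewrite lee_fin (QKE ip onb cov) eqxx mulr1 ler_piMl ?(ltW (lam_gt0 _))//.
by rewrite gerBl.
Qed.

Section particle.
Variables (eps : R) (N K : nat).
Hypotheses (eps0 : 0 < eps) (N0 : (0 < N)%N).
Local Notation costs t x := [set (\int[P]_w ((N%:R * GK e G (empirical (state (W N K) t (cst x) theta 1 w)))%:E
                     + (eps / 2)%:E * energy lam t theta w))%E
      | theta in admissible P F lam t].

Lemma particle_cost_ge (t : R) x c : costs t x c -> ((N%:R * V0 G)%:E <= c)%E.
Proof.
have [label ul] := uniform_label_exists ip onb sb N0.
move=> [theta _ <-].
rewrite -(integral_probability_cst P).
apply: le_integral_nonmeasurable => w; rewrite -[leLHS]adde0 leeD//.
  rewrite lee_fin ler_wpM2l//.
  exact: (GK_ge_V0 ip onb mh (P2_empirical N0 ul _)).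
by rewrite mule_ge0 ?energy_ge0// lee_fin divr_ge0// ltW.
Qed.

(** Uses the zero control. Its cost makes the infimum finite, so that [fine] loses nothing in [vKN],
    and provides the quadratic growth that the comparison principle requires. *)
Lemma particle_cost_zero : exists Cv : R, forall (t : R) x, 0 <= t <= 1 ->
  exists2 c, costs t x c & (c <= (Cv * (1 + mdot x x))%:E)%E.
Proof.
have [label ul] := uniform_label_exists ip onb sb N0.
have [C gr] := G_growth mh.
pose T := N%:R * \sum_(j < K) lam j.
have T0 : 0 <= T by rewrite mulr_ge0// sumr_ge0// => j _; exact: ltW.
pose a := `|C|.
(* [a] comes from the growth of [G], the factor 2 from |x + D|^2 <= 2 |x|^2 + 2 |D|^2, and [T]
   bounds the second moment of the noise increment. *)
exists (N%:R * a + 2 * a + 2 * a * T) => t x t01.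
pose theta := (fun (_ : R) (_ : Omega) => 0 : 'M[R]_(N, K)).
have adm : admissible P F lam t theta.
  split; first by move=> s _; exact: measurable_cst.
  rewrite (_ : (fun w => energy lam t theta w) = cst 0%E) ?integral0 ?ltry//.
  apply/funext => w; rewrite /energy big1// => i _; apply: integral0_eq => s _.
  by rewrite (normQK_sqr cov) big1// => j _; rewrite !mxE expr0n mulr0.
have th0 w : energy lam t theta w = 0%E.
  rewrite /energy big1// => i _; apply: integral0_eq => s _.
  by rewrite (normQK_sqr cov) big1// => j _; rewrite !mxE expr0n mulr0.
eexists; first by exists theta.
pose D w := W N K 1 w - W N K t w.
have stE w : state (W N K) t (cst x) theta 1 w = x + D w.
  rewrite /state /= (_ : \matrix_(i, j) _ = 0) ?addr0//.
  by apply/matrixP => i j; rewrite [RHS]mxE mxE /Rintegral integral0_eq// => s _; rewrite mxE.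
have bound w : N%:R * GK e G (empirical (x + D w)) <=
    (N%:R * a + 2 * a * mdot x x) + 2 * a * mdot (D w) (D w).
  have P2e := P2_empirical N0 ul (x + D w).
  have := gr _ (P2_embed ip onb P2e); rewrite (M2_embed ip onb) (M2_empirical N0 ul).
  have NN0 : (0 : R) < N%:R by rewrite ltr0n.
  move=> /(le_trans (ler_norm _)) h1.
  have m0 := mdot_ge0 (x + D w).
  have h2 : C * (1 + N%:R^-1 * mdot (x + D w) (x + D w)) <= a * (1 + N%:R^-1 * mdot (x + D w) (x + D w)).
    by rewrite ler_wpM2r ?ler_norm// addr_ge0// mulr_ge0// invr_ge0 ltW.
  have h3 := ler_wpM2l (ltW NN0) (le_trans h1 h2).
  apply: (le_trans h3).
  have -> : N%:R * (a * (1 + N%:R^-1 * mdot (x + D w) (x + D w))) =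
    N%:R * a + a * mdot (x + D w) (x + D w) by field; rewrite gt_eqF.
  have := ler_wpM2l (normr_ge0 C) (mdotD_le x (D w)); rewrite -/a; lra.
apply: (@le_trans _ _ (\int[P]_w ((N%:R * a + 2 * a * mdot x x)%:E + (2 * a)%:E * (mdot (D w) (D w))%:E))%E).
  apply: le_integral_nonmeasurable => w.
  by rewrite th0 mule0 adde0 stE -EFinM -EFinD lee_fin.
have a0 : 0 <= a by exact: normr_ge0.
have mDD : measurable_fun setT (fun w => (mdot (D w) (D w))%:E).
  by apply/measurable_EFinP; apply: mdot_measurable; exact: wiener_increment_mx_measurable.
have c0 : 0 <= N%:R * a + 2 * a * mdot x x by rewrite addr_ge0// !mulr_ge0// mdot_ge0.
have a20 : (0 <= (2 * a)%:E)%E by rewrite lee_fin mulr_ge0.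
have D0 w : (0 <= (mdot (D w) (D w))%:E)%E by rewrite lee_fin mdot_ge0.
have c0E : (0 <= (N%:R * a + 2 * a * mdot x x)%:E)%E by rewrite lee_fin.
rewrite (ge0_integralD P measurableT (fun _ _ => c0E) (measurable_cst _)
  (fun w _ => mule_ge0 a20 (D0 w)) (measurable_funeM _ mDD)).
rewrite integral_probability_cst (ge0_integralZl P measurableT mDD (fun w _ => D0 w) a20).
apply: (@le_trans _ _ ((N%:R * a + 2 * a * mdot x x)%:E + (2 * a)%:E * T%:E)%E).
  rewrite leeD2l// lee_wpmul2l ?lee_fin ?mulr_ge0//.
  exact: wiener_increment_mdot.
rewrite -EFinM -EFinD lee_fin.
have q0 := mdot_ge0 x.
have h3 : 0 <= N%:R * a * mdot x x by rewrite !mulr_ge0.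
have h4 := mulr_ge0 (mulr_ge0 (mulr_ge0 (ler0n R 2) a0) T0) q0.
by lra.
Qed.

Lemma vKN_lower (t : R) x : 0 <= t <= 1 -> N%:R * V0 G <= vKN e lam G P F W eps (K := K) (N := N) t x.
Proof.
move=> t01; have [Cv Cvx] := particle_cost_zero; have [c cc cle] := Cvx t x t01.
rewrite /vKN /particle_value -lee_fin fineK; last first.
  rewrite fin_real//; apply/andP; split.
    apply: (@lt_le_trans _ _ (N%:R * V0 G)%:E); first exact: ltNyr.
    by apply: le_ereal_inf_tmp => ? /particle_cost_ge.
  by apply: (le_lt_trans (ereal_inf_lbound cc)); exact: le_lt_trans cle (ltry _).
by apply: le_ereal_inf_tmp => ? /particle_cost_ge.
Qed.

Lemma vKN_upper : exists Cv : R, forall (t : R) x, 0 <= t <= 1 ->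
  vKN e lam G P F W eps (K := K) (N := N) t x <= Cv * (1 + mdot x x).
Proof.
have [Cv Cvx] := particle_cost_zero; exists Cv => t x t01; have [c cc cle] := Cvx t x t01.
rewrite /vKN /particle_value -lee_fin fineK.
  by apply: le_trans cle; exact: ereal_inf_lbound.
rewrite fin_real//; apply/andP; split.
  apply: (@lt_le_trans _ _ (N%:R * V0 G)%:E); first exact: ltNyr.
  by apply: le_ereal_inf_tmp => ? /particle_cost_ge.
by apply: (le_lt_trans (ereal_inf_lbound cc)); exact: le_lt_trans cle (ltry _).
Qed.

End particle.

End value_bounds.

Section meanfield_bounds.
Context {R : realType} {H : completeNormedModType R}.
Variables (dot : H -> H -> R) (Q : {linear H -> H}) (e : nat -> H) (lam : nat -> R).
Context {d : measure_display} {Omega : measurableType d}.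
Variables (P : probability Omega R) (F : R -> set (set Omega))
  (W : forall N K : nat, R -> Omega -> 'M[R]_(N, K))
  (G : probability (borel H) R -> R) (L : R -> nat -> R).
Hypotheses (ip : is_inner_product dot) (onb : orthonormal_basis dot e)
  (cov : covariance_operator dot Q e lam) (sb : stochastic_basis dot Q e P F W)
  (mh : master_hypothesis dot Q e lam G P F W L).

Let filF := basis_filtration sb.
Let lam_gt0 j : 0 < lam j := cov_eigen_gt0 cov j.

Lemma progressive_section N K (t : R) (theta : R -> Omega -> 'M[R]_(N, K)) w i j :
  0 <= t <= 1 -> progressive F t theta ->
  measurable_fun `[t, 1]%classic (fun s => theta s w i j).
Proof.
move=> /andP[t0 t1] /(_ 1); rewrite t1 lexx => /(_ isT) mth.
have mth' := measurableT_comp (mxcoord_measurable i j) mth.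
apply: (measurable_comp _ _ mth' (_ : measurable_fun `[t, 1]%classic
  (fun s : R => (s, w) : R * g_sigma_algebraType (F 1)))).
- apply: measurableX => //.
- by move=> _ [s st <-].
- by apply: measurable_funTS; exact: measurable_pair2.
Qed.

(** Cauchy-Schwarz in each coordinate, weighted by [lam j]. The summand 1 keeps the factor positive
    for K = 0, as the scaling of nonmeasurable integrals demands. *)
Lemma sqr_drift_le_energy K (t : R) (theta : R -> Omega -> 'rV[R]_K) w :
  0 <= t <= 1 -> progressive F t theta ->
  ((\sum_(j < K) (\int[lebesgue_measure]_(r in `[t, 1]) theta r w 0 j) ^+ 2)%:E
   <= (1 + \sum_(j < K) lam j)%:E * energy lam t theta w)%E.
Proof.
move=> t01 pth; rewrite -sumEFin.
have mth j := progressive_section w 0 j t01 pth.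
have mn : measurable_fun `[t, 1]%classic (fun s => normQK lam (row 0 (theta s w)) ^+ 2).
  have -> : (fun s => normQK lam (row 0 (theta s w)) ^+ 2) =
      (fun s => \sum_(j < K) (lam j)^-1 * theta s w 0 j ^+ 2).
    apply/funext => s; rewrite (normQK_sqr cov).
    by apply: eq_bigr => j _; rewrite mxE.
  by apply: measurable_sum => j; apply: measurable_funM => //; exact: measurable_funX.
rewrite /energy big_ord1; set E := (X in (_ <= _ * X)%E).
have E0 : (0 <= E)%E by apply: integral_ge0 => s _; rewrite lee_fin sqr_ge0.
apply: (@le_trans _ _ (\sum_(j < K) (lam j)%:E * E)%E).
  apply: lee_sum => j _; apply: (le_trans (sqr_Rintegral_le t01 (mth j))).
  rewrite /E -ge0_integralZl//; last 3 first.
  - exact/measurable_EFinP.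
  - by move=> s _; rewrite lee_fin sqr_ge0.
  - by rewrite lee_fin ltW.
  have mf1 : measurable_fun `[t, 1]%classic (fun s => (theta s w 0 j ^+ 2)%:E).
    by apply/measurable_EFinP; apply: measurable_funX; exact: mth.
  have mf2 : measurable_fun `[t, 1]%classic
      (fun s => (lam j)%:E * (normQK lam (row 0 (theta s w)) ^+ 2)%:E)%E.
    by apply: measurable_funeM; exact/measurable_EFinP.
  apply: ge0_le_integral => //.
  - by move=> s _; rewrite lee_fin sqr_ge0.
  - move=> s _; rewrite -EFinM lee_fin (normQK_sqr cov) (bigD1 j)//= mulrDr.
    rewrite mulrA mulfV ?gt_eqF// mul1r mxE lerDl mulr_ge0 ?(ltW (lam_gt0 _))//.
    by rewrite sumr_ge0// => k _; rewrite mulr_ge0 ?sqr_ge0// invr_ge0 ltW.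
rewrite -ge0_sume_distrl; last by move=> j _; rewrite lee_fin ltW.
by rewrite sumEFin lee_wpmul2r// lee_fin lerDr.
Qed.

Section meanfield.
Variables (eps : R) (K : nat) (t : R) (nu : probability (borel 'rV[R]_K) R).
Hypotheses (eps0 : 0 < eps) (t01 : 0 <= t <= 1) (P2nu : P2 (@enorm R 1 K) nu).

(** Finite energy keeps the final law in the class over which [V0] is the infimum; only then can the
    terminal cost be compared with [V0]. *)
Lemma meanfield_P2 (xi : Omega -> 'rV[R]_K) (theta : R -> Omega -> 'rV[R]_K)
    (X1 : {mfun Omega >-> borel 'rV[R]_K}) :
  measurable_at F t xi -> has_law P xi nu -> admissible P F lam t theta ->
  (forall w, X1 w = state (W 1 K) t xi theta 1 w) ->
  P2 (@enorm R 1 K) (distribution P X1).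
Proof.
move=> xiF xilaw [pth Eth] X1E.
have mxi : measurable_fun setT (xi : Omega -> borel 'rV[R]_K).
  exact: (filtration_measurable_fun filF t01 xiF).
have mX1 : measurable_fun setT (X1 : Omega -> borel 'rV[R]_K) by [].
pose D w := W 1 K 1 w - W 1 K t w.
have mD : measurable_fun setT (D : Omega -> borel 'rV[R]_K).
  exact: (wiener_increment_mx_measurable sb).
pose I w : 'rV[R]_K := \matrix_(i, j) \int[lebesgue_measure]_(r in `[t, 1]) theta r w i j.
have X1D w : (X1 w : 'rV[R]_K) = xi w + I w + D w by rewrite X1E.
(* The integrated drift is the final state minus the initial state and the noise, all measurable, so
   no Fubini argument is needed. *)
have mI : measurable_fun setT (I : Omega -> borel 'rV[R]_K).
  have E : I = fun w => (X1 w : 'rV[R]_K) - xi w - D w.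
    by apply/funext => w; rewrite X1D; apply/matrixP => i j; rewrite !mxE; ring.
  rewrite E; apply: mx_measurable => i j; under eq_fun do rewrite 2!mx_subE.
  by apply: measurable_funB; first apply: measurable_funB;
    apply: measurableT_comp (mxcoord_measurable i j) _.
have sq_meas (f : Omega -> 'rV[R]_K) : measurable_fun setT (f : Omega -> borel 'rV[R]_K) ->
    measurable_fun setT (fun w => (mdot (f w) (f w))%:E).
  by move=> mf; apply/measurable_EFinP; exact: mdot_measurable.
have sq_ge0 (f : Omega -> 'rV[R]_K) w : (0 <= (mdot (f w) (f w))%:E)%E.
  by rewrite lee_fin mdot_ge0.
pose fsq (x : borel 'rV[R]_K) : \bar R := (enorm (x : 'rV[R]_K) ^+ 2)%:E.
have mfsq : measurable_fun setT fsq by apply/measurable_EFinP; exact: enorm_sqr_measurable.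
have fsq0 x : (0 <= fsq x)%E by rewrite lee_fin sqr_ge0.
have xioo : (\int[P]_w (mdot (xi w) (xi w))%:E < +oo)%E.
  have := P2nu; rewrite /P2 -/fsq.
  rewrite (@ge0_integral_law _ _ _ _ _ P nu (xi : Omega -> borel 'rV[R]_K) fsq mxi xilaw mfsq fsq0).
  by under eq_integral do rewrite /fsq enorm_sqr.
have Doo : (\int[P]_w (mdot (D w) (D w))%:E < +oo)%E.
  exact: le_lt_trans (wiener_increment_mdot ip onb cov sb 1 K t01) (ltry _).
have lmax0 : 0 < 1 + \sum_(j < K) lam j.
  by rewrite ltr_pwDl// sumr_ge0// => j _; exact: ltW.
have Ioo : (\int[P]_w (mdot (I w) (I w))%:E < +oo)%E.
  apply: (@le_lt_trans _ _ (\int[P]_w ((1 + \sum_(j < K) lam j)%:E * energy lam t theta w))%E).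
    apply: ge0_le_integral_nonmeasurable => // w.
    apply: le_trans (sqr_drift_le_energy w t01 pth).
    rewrite mdotE big_ord1 lee_fin; apply: ler_sum => j _; by rewrite mxE.
  apply: (le_lt_trans (ge0_integralZ_le_nonmeasurable _ lmax0 (energy_ge0 lam t theta))).
  by rewrite lte_mul_pinfty// lee_fin ltW.
rewrite /P2 -/fsq (ge0_integral_distribution X1 mfsq fsq0).
apply: (@le_lt_trans _ _ (\int[P]_w (4%:E * (mdot (xi w) (xi w))%:E +
    (4%:E * (mdot (I w) (I w))%:E + 2%:E * (mdot (D w) (D w))%:E)))%E).
  apply: ge0_le_integral_nonmeasurable => w /=; first by rewrite lee_fin sqr_ge0.
  rewrite /fsq enorm_sqr X1D -!EFinM -!EFinD lee_fin.
  by have := mdotD_le (xi w + I w) (D w); have := mdotD_le (xi w) (I w); lra.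
have c0 (c : R) (f : Omega -> 'rV[R]_K) w : 0 <= c -> (0 <= c%:E * (mdot (f w) (f w))%:E)%E.
  by move=> c0; rewrite mule_ge0.
have mc (c : R) (f : Omega -> 'rV[R]_K) : measurable_fun setT (f : Omega -> borel 'rV[R]_K) ->
   measurable_fun setT (fun w => c%:E * (mdot (f w) (f w))%:E)%E.
  by move=> mf; apply: measurable_funeM; exact: sq_meas.
have Zoo (c : R) (f : Omega -> 'rV[R]_K) : 0 <= c -> measurable_fun setT (f : Omega -> borel 'rV[R]_K) ->
  (\int[P]_w (mdot (f w) (f w))%:E < +oo)%E -> (\int[P]_w (c%:E * (mdot (f w) (f w))%:E) < +oo)%E.
  move=> c1 mf foo; rewrite ge0_integralZl//; last exact: sq_meas.
  by rewrite lte_mul_pinfty.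
rewrite (ge0_integralD P measurableT (fun w _ => c0 4 xi w (ler0n _ 4)) (mc 4 _ mxi)
  (fun w _ => adde_ge0 (c0 4 I w (ler0n _ 4)) (c0 2 D w (ler0n _ 2)))
  (emeasurable_funD (mc 4 _ mI) (mc 2 _ mD))).
rewrite (ge0_integralD P measurableT (fun w _ => c0 4 I w (ler0n _ 4)) (mc 4 _ mI)
  (fun w _ => c0 2 D w (ler0n _ 2)) (mc 2 _ mD)).
apply: lte_add_pinfty; first exact: (Zoo 4 xi (ler0n _ 4) mxi xioo).
apply: lte_add_pinfty; first exact: (Zoo 4 I (ler0n _ 4) mI Ioo).
exact: (Zoo 2 D (ler0n _ 2) mD Doo).
Qed.

Local Notation costs := [set c | exists (xi : Omega -> 'rV[R]_K) (theta : R -> Omega -> 'rV[R]_K)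
        (X1 : {mfun Omega >-> borel 'rV[R]_K}),
      [/\ measurable_at F t xi, has_law P xi nu, admissible P F lam t theta,
          (forall w, X1 w = state (W 1 K) t xi theta 1 w) &
          c = ((GK e G (distribution P X1))%:E
               + \int[P]_w ((eps / 2)%:E * energy lam t theta w))%E]].

Lemma meanfield_cost_ge c : costs c -> ((V0 G)%:E <= c)%E.
Proof.
move=> [xi [theta [X1 [xiF xilaw adm X1E ->]]]].
rewrite -[leLHS]adde0; apply: leeD.
  by rewrite lee_fin; exact: (GK_ge_V0 ip onb mh (meanfield_P2 xiF xilaw adm X1E)).
apply: integral_ge0 => w _; rewrite mule_ge0 ?energy_ge0//.
by rewrite lee_fin divr_ge0// ltW.
Qed.

Let VK := VK e lam G P F W eps (K := K) t nu.

(** The absolute value accounts for an infinite infimum, to which [fine] assigns 0. *)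
Lemma VK_lower : - `|V0 G| <= VK.
Proof.
rewrite /VK /Defs.VK /meanfield_value; set I := ereal_inf _.
have : ((V0 G)%:E <= I)%E by apply: le_ereal_inf_tmp => c /meanfield_cost_ge.
case: I => [r| |] /=; first by rewrite lee_fin => /(le_trans _); apply; rewrite lerNl ler_normr lexx orbT.
  by rewrite oppr_le0.
by rewrite leeNy_eq.
Qed.

Lemma VK_le_cost (c : R) : costs c%:E -> VK <= c.
Proof.
move=> cc; rewrite /VK /Defs.VK /meanfield_value -lee_fin fineK.
  exact: ereal_inf_lbound.
rewrite fin_real//; apply/andP; split.
  apply: (@lt_le_trans _ _ (V0 G)%:E); first exact: ltNyr.
  by apply: le_ereal_inf_tmp => ? /meanfield_cost_ge.
by apply: (le_lt_trans (ereal_inf_lbound cc)); exact: ltry.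
Qed.

End meanfield.

End meanfield_bounds.

(** * A control steering to the minimizer *)

Section grid.
Context {R : realType}.
Variables (n : nat) (delta : R).
Hypotheses (n0 : (0 < n)%N) (d0 : 0 < delta) (d1 : delta < 1).

(* Euler discretization of dB = - (1 - delta) / s(t) B dt + dW with
   s(t) = 1 - (1 - delta) t, for which Var B_t = s(t) t when W has unit variance. *)
Definition gridstep : R := n%:R^-1.
Definition gridt (k : nat) : R := k%:R / n%:R.
Definition grids (k : nat) : R := 1 - (1 - delta) * gridt k.
Definition gridgain (k : nat) : R := (1 - delta) / grids k.

Let nn0 : (0 : R) < n%:R. Proof. by rewrite ltr0n. Qed.
Local Notation h := gridstep.

Lemma gridstep_gt0 : 0 < h. Proof. by rewrite invr_gt0. Qed.

Lemma gridt0 : gridt 0 = 0. Proof. by rewrite /gridt mul0r. Qed.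

Lemma gridtn : gridt n = 1. Proof. by rewrite /gridt divff// gt_eqF. Qed.

Lemma gridtS k : gridt k.+1 = gridt k + h.
Proof. by rewrite /gridt /h -natr1 mulrDl mul1r. Qed.

Lemma gridt_ge0 k : 0 <= gridt k.
Proof. by rewrite divr_ge0// ltW. Qed.

Lemma gridt_le1 k : (k <= n)%N -> gridt k <= 1.
Proof. by move=> kn; rewrite ler_pdivrMr// mul1r ler_nat. Qed.

Lemma gridt_le k l : (k <= l)%N -> gridt k <= gridt l.
Proof. by move=> kl; rewrite ler_pM2r ?invr_gt0// ler_nat. Qed.

Lemma grids_ge k : (k <= n)%N -> delta <= grids k.
Proof.
move=> /gridt_le1 h1; rewrite /grids.
have : 0 <= (1 - delta) * (1 - gridt k) by rewrite mulr_ge0 ?subr_ge0// ltW.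
lra.
Qed.

Lemma grids_gt0 k : (k <= n)%N -> 0 < grids k.
Proof. by move=> /grids_ge; exact: lt_le_trans. Qed.

Lemma gridsS k : grids k.+1 = grids k - (1 - delta) * h.
Proof. by rewrite /grids gridtS; ring. Qed.

Lemma grid_contraction k : (k <= n)%N -> 1 - gridgain k * h = grids k.+1 / grids k.
Proof. by move=> /grids_gt0 s0; rewrite gridsS /gridgain; field; rewrite gt_eqF. Qed.

(** The loss of the Euler scheme, chosen so that [grids k <= rho * grids k.+1]; this uses that
    [grids] never falls below [delta]. *)
Let rho := 1 + h / delta.

(** Discrete form of the variance equation solved by s(t) t. Multiplied by [rho], that solution
    exceeds one Euler step by (h / s_k) (rho s_(k+1) - s_k), which is nonnegative by the choice of
    [rho]. *)
Lemma grid_variance_step k (v : R) : (k < n)%N ->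
  v <= rho * (grids k * gridt k) ->
  (1 - gridgain k * h) ^+ 2 * v + h <= rho * (grids k.+1 * gridt k.+1).
Proof.
move=> kn vle; have s0 := grids_gt0 (ltnW kn); have s1 := grids_gt0 kn.
have h0 := gridstep_gt0.
have ratio : grids k <= rho * grids k.+1.
  have sd := grids_ge kn.
  have -> : rho * grids k.+1 = grids k.+1 + h * (grids k.+1 / delta).
    by rewrite /rho; field; rewrite gt_eqF.
  have q1 : 1 <= grids k.+1 / delta by rewrite ler_pdivlMr// mul1r.
  have : h <= h * (grids k.+1 / delta) by rewrite ler_peMr// ltW.
  have : (1 - delta) * h <= h by rewrite ler_piMl ?(ltW h0)// gerBl ltW.
  by rewrite {1}(_ : grids k = grids k.+1 + (1 - delta) * h); [lra|rewrite gridsS; ring].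
rewrite grid_contraction ?(ltnW kn)//.
apply: (@le_trans _ _ ((grids k.+1 / grids k) ^+ 2 * (rho * (grids k * gridt k)) + h)).
  by rewrite lerD2r ler_wpM2l// sqr_ge0.
rewrite -subr_ge0.
have -> : rho * (grids k.+1 * gridt k.+1) -
    ((grids k.+1 / grids k) ^+ 2 * (rho * (grids k * gridt k)) + h) =
    h / grids k * (rho * grids k.+1 - grids k).
  rewrite gridtS; have E : grids k.+1 = grids k - (1 - delta) * h := gridsS k.
  have E2 : (1 - delta) * gridt k = 1 - grids k by rewrite /grids; ring.
  have -> : (grids k.+1 / grids k) ^+ 2 * (rho * (grids k * gridt k)) =
     rho * grids k.+1 * ((grids k.+1 * gridt k) / grids k) by field; rewrite gt_eqF.
  have -> : grids k.+1 * gridt k = grids k * gridt k - h * (1 - grids k).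
    by rewrite E -E2; ring.
  by field; rewrite gt_eqF.
by rewrite mulr_ge0 ?subr_ge0// divr_ge0// ltW.
Qed.

(** By t <= 1 and ln x <= x - 1 each term is at most [rho * (1 - delta)] times a decrement of
    [ln (grids k)], and the decrements telescope from [ln 1] to [ln delta]. The mesh condition gives
    [rho * (1 - delta) <= 1], so discretization costs nothing here. *)
Lemma grid_energy (v : nat -> R) : h <= delta ^+ 2 ->
  (forall k, (k < n)%N -> v k <= rho * (grids k * gridt k)) ->
  \sum_(k < n) h * (gridgain k ^+ 2 * v k) <= ln delta^-1.
Proof.
move=> hd vle; have h0 := gridstep_gt0.
have rb : rho * (1 - delta) <= 1.
  have : h / delta <= delta by rewrite ler_pdivrMr// -expr2.
  by rewrite /rho => hh; have := ler_wpM2r (_ : 0 <= 1 - delta) hh; rewrite subr_ge0 (ltW d1) => /(_ isT); nra.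
have rho0 : 0 <= rho by rewrite addr_ge0// divr_ge0// ltW.
have term k : (k < n)%N -> h * (gridgain k ^+ 2 * v k) <=
    rho * (1 - delta) * (ln (grids k) - ln (grids k.+1)).
  move=> kn; have s0 := grids_gt0 (ltnW kn); have s1 := grids_gt0 kn.
  apply: (@le_trans _ _ (h * (gridgain k ^+ 2 * (rho * (grids k * gridt k))))).
    by rewrite ler_pM2l// ler_wpM2l ?sqr_ge0//; exact: vle.
  have -> : h * (gridgain k ^+ 2 * (rho * (grids k * gridt k))) =
     rho * (1 - delta) * ((1 - delta) * h / grids k * gridt k).
    by rewrite /gridgain; field; rewrite gt_eqF.
  rewrite ler_wpM2l ?mulr_ge0 ?subr_ge0 ?(ltW d1)//.
  have q0 : 0 <= (1 - delta) * h / grids k.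
    by rewrite divr_ge0 ?(ltW s0)// mulr_ge0 ?(ltW h0)// subr_ge0 ltW.
  apply: (@le_trans _ _ ((1 - delta) * h / grids k)).
    by rewrite ler_piMr// gridt_le1// ltnW.
  have : ln (grids k.+1 / grids k) <= grids k.+1 / grids k - 1.
    have := @le_ln1Dx R (grids k.+1 / grids k - 1).
    by rewrite addrCA subrr addr0; apply; rewrite ltrBrDl subrr divr_gt0.
  rewrite lnM ?posrE ?invr_gt0// lnV ?posrE// gridsS.
  have -> : (grids k - (1 - delta) * h) / grids k - 1 = - ((1 - delta) * h / grids k).
    by field; rewrite gt_eqF.
  by lra.
apply: (@le_trans _ _ (\sum_(k < n) rho * (1 - delta) * (ln (grids k) - ln (grids k.+1)))).
  by apply: ler_sum => k _; exact: term.
rewrite -mulr_sumr.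
have -> : \sum_(k < n) (ln (grids k) - ln (grids k.+1)) = ln delta^-1.
  rewrite -(big_mkord xpredT (fun k => ln (grids k) - ln (grids k.+1))).
  have := telescope_sumr (fun k => - ln (grids k)) (leq0n n).
  rewrite /grids gridt0 gridtn mulr0 mulr1 subr0 ln1 oppr0 subr0 opprB addrCA subrr addr0.
  rewrite lnV ?posrE// => <-.
  by apply: eq_bigr => k _; rewrite opprK addrC.
by rewrite ler_piMl// ln_ge0// invf_ge1// ltW.
Qed.

(** At the last grid point s = [delta] and t = 1, and [rho <= 1 + delta < 2]. *)
Lemma grid_final_variance (v : R) : h <= delta ^+ 2 ->
  v <= rho * (grids n * gridt n) -> v <= 2 * delta.
Proof.
move=> hd /le_trans; apply; rewrite gridtn /grids gridtn mulr1 mulr1 opprB addrCA subrr addr0.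
have : h / delta <= delta by rewrite ler_pdivrMr// -expr2.
rewrite /rho; move: (h / delta) => x hh.
have := ler_wpM2r (ltW d0) hh; have := ler_wpM2r (ltW d0) (ltW d1); lra.
Qed.

Definition gridI (k : nat) : set R := `[gridt k, gridt k.+1[%classic.

(** The intervals are half-open, so the value at [s = 1] is 0; this affects no integral. *)
Definition stepf (c : nat -> R) (s : R) : R := \sum_(k < n) c k * \1_(gridI k) s.

Lemma gridI_inj k l s : gridI k s -> gridI l s -> k = l.
Proof.
rewrite /gridI /= !in_itv/= => /andP[k1 k2] /andP[l1 l2].
apply/eqP; rewrite eqn_leq; apply/andP; split; rewrite leqNgt; apply/negP => kl.
  by have := gridt_le kl; rewrite leNgt (le_lt_trans k1 l2).
by have := gridt_le kl; rewrite leNgt (le_lt_trans l1 k2).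
Qed.

Lemma stepf_in (c : nat -> R) (k : 'I_n) s : gridI k s -> stepf c s = c k.
Proof.
move=> ks; rewrite /stepf (bigD1 k)//= big1 ?addr0 => [|l lk].
  by rewrite indicE mem_set// mulr1.
rewrite indicE memNset ?mulr0// => ls.
by move/eqP: lk; apply; apply: val_inj; exact: gridI_inj ls ks.
Qed.

(** The condition [phi 0 = 0] takes care of the points outside all the intervals. *)
Lemma stepf_comp (phi : R -> R) (c : nat -> R) s : phi 0 = 0 ->
  phi (stepf c s) = stepf (phi \o c) s.
Proof.
move=> phi0; have [[k ks]|nk] := pselect (exists k : 'I_n, gridI k s).
  by rewrite !(stepf_in _ ks).
have E (c' : nat -> R) : stepf c' s = 0.
  rewrite /stepf big1// => k _; rewrite indicE memNset ?mulr0// => ks.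
  by apply: nk; exists k.
by rewrite !E.
Qed.

Lemma integral_stepf (c : nat -> R) :
  (\int[lebesgue_measure]_(s in `[0%R, 1%R]) (stepf c s)%:E = (\sum_(k < n) h * c k)%:E)%E.
Proof.
have mI k : measurable (gridI k) by exact: measurable_itv.
have mD : measurable (`[0, 1]%classic : set R) by exact: measurable_itv.
have muI k : (k < n)%N -> lebesgue_measure (gridI k `&` `[0, 1]%classic) = h%:E.
  move=> kn; rewrite setIidl; last first.
    move=> s; rewrite /gridI /= !in_itv/= => /andP[s0 s1].
    by rewrite (le_trans (gridt_ge0 k) s0) (ltW (lt_le_trans s1 (gridt_le1 kn))).
  rewrite /gridI lebesgue_measure_itv/= lte_fin gridtS ltrDl gridstep_gt0.
  by rewrite -EFinB addrC addKr.
have intI (k : 'I_n) :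
    (\int[lebesgue_measure]_(s in `[0%R, 1%R]) (\1_(gridI k) s : R)%:E = h%:E)%E.
  have E := integral_indic lebesgue_measure mD (mI k).
  by rewrite E; exact: muI.
have iI (k : 'I_n) : lebesgue_measure.-integrable `[0, 1]%classic
    (fun s => (\1_(gridI k) s : R)%:E).
  apply/integrableP; split; first by apply/measurable_EFinP; apply: measurable_indic; exact: mI.
  under eq_integral do rewrite gee0_abs ?lee_fin//.
  by rewrite intI ltry.
rewrite /stepf; under eq_integral do rewrite -sumEFin.
have iZ (k : 'I_n) : lebesgue_measure.-integrable `[0, 1]%classic
    (fun s => (c k * \1_(gridI k) s)%:E).
  have -> : (fun s => (c k * \1_(gridI k) s)%:E) =
      (fun s => (c k)%:E * (\1_(gridI k) s : R)%:E)%E by [].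
  by apply: integrableZl => //; exact: iI.
rewrite integral_sum//.
rewrite -sumEFin; apply: eq_bigr => k _; under eq_integral do rewrite EFinM.
rewrite integralZl//.
by rewrite intI -EFinM mulrC.
Qed.

End grid.

Section weighted_sum.
Context {R : realType} {d : measure_display} {T : measurableType d}.
Variable P : probability T R.

Lemma L2_sqr_integrable (Y : T -> R) : L2 P Y -> P.-integrable setT (EFin \o (fun w => Y w ^+ 2)).
Proof. by case. Qed.

Lemma integrable_weighted_sum (I : Type) (r : seq I) (b : I -> R) (f : I -> T -> R) :
  (forall i, P.-integrable setT (EFin \o f i)) ->
  P.-integrable setT (EFin \o (fun w => \sum_(i <- r) b i * f i w)).
Proof.
move=> fi; elim: r => [|i r IH].
  rewrite (_ : EFin \o _ = cst 0%E); first exact: integrable0.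
  by apply/funext => w /=; rewrite big_nil.
rewrite (_ : EFin \o _ = (fun w => (b i)%:E * (f i w)%:E +
    (EFin \o (fun w => \sum_(i <- r) b i * f i w)%R) w)%E); last first.
  by apply/funext => w /=; rewrite big_cons EFinD EFinM.
by apply: integrableD => //; apply: integrableZl => //; exact: fi.
Qed.

Lemma Rintegral_weighted_sum (I : Type) (r : seq I) (b : I -> R) (f : I -> T -> R) :
  (forall i, P.-integrable setT (EFin \o f i)) ->
  \int[P]_w (\sum_(i <- r) b i * f i w) = \sum_(i <- r) b i * \int[P]_w f i w.
Proof.
move=> fi; elim: r => [|i r IH].
  rewrite big_nil /Rintegral integral0_eq// => w _; by rewrite big_nil.
rewrite big_cons -IH -RintegralZl// -RintegralD//.
- by apply: eq_Rintegral => w _; rewrite big_cons.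
- by rewrite /comp; under eq_fun do rewrite EFinM; apply: integrableZl => //; exact: fi.
- exact: integrable_weighted_sum.
Qed.

End weighted_sum.

Section control.
Context {R : realType} {H : completeNormedModType R}.
Variables (dot : H -> H -> R) (Q : {linear H -> H}) (e : nat -> H) (lam : nat -> R).
Context {d : measure_display} {Omega : measurableType d}.
Variables (P : probability Omega R) (F : R -> set (set Omega))
  (W : forall N K : nat, R -> Omega -> 'M[R]_(N, K)).
Hypotheses (ip : is_inner_product dot) (onb : orthonormal_basis dot e)
  (cov : covariance_operator dot Q e lam) (sb : stochastic_basis dot Q e P F W).

Let filF := basis_filtration sb.
Let lam_gt0 j : 0 < lam j := cov_eigen_gt0 cov j.

Variables (K n : nat) (delta : R).
Hypotheses (n0 : (0 < n)%N) (d0 : 0 < delta) (d1 : delta < 1).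
Hypothesis hd : @gridstep R n <= delta ^+ 2.
Variables (X : Omega -> H) (mu : probability (borel H) R) (x0 : H).
Hypotheses (XF : measurable_at F 0 X) (Xlaw : has_law P X mu)
  (P2mu : P2 (fun x : H => `|x|) mu).

Let wW := basis_wiener sb 1 K.
Let Sgt0 := QK_diag_gt0 ip onb cov.
Local Notation h := (@gridstep R n).
Local Notation tk := (@gridt R n).
Local Notation gain := (gridgain n delta).
Local Notation Bk k w := (W 1 K (tk k) w).

(** The noise-driven part B of the state at grid times. Freezing the drift on each step makes it an
    explicit combination of Wiener increments. *)
Fixpoint bridge (k : nat) (w : Omega) : 'rV[R]_K :=
  if k is k'.+1 then (1 - gain k' * h) *: bridge k' w + (Bk k'.+1 w - Bk k' w)
  else 0.

Definition shift_to (w : Omega) : 'rV[R]_K := projHK dot e K (X w) - projHK dot e K x0.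

Definition feedback (w : Omega) (j : 'I_K) (k : nat) : R :=
  shift_to w 0 j - gain k * bridge k w 0 j.

Definition control (s : R) (w : Omega) : 'rV[R]_K := \row_j stepf n (feedback w j) s.

Let tk01 k : (k <= n)%N -> 0 <= tk k <= 1.
Proof. by move=> kn; rewrite gridt_ge0 gridt_le1. Qed.

Let tk_lt k : tk k < tk k.+1.
Proof. by rewrite gridtS ltrDl gridstep_gt0. Qed.

Let Xm : measurable_fun setT (X : Omega -> borel H).
Proof. by apply: (filtration_measurable_fun filF _ XF); rewrite lexx ler01. Qed.

Lemma bridgeS k w j : bridge k.+1 w 0 j =
  (1 - gain k * h) * bridge k w 0 j + (W 1 K (tk k.+1) w - W 1 K (tk k) w) 0 j.
Proof. by rewrite /= !mxE. Qed.

Lemma bridge_measurable_at k (j : 'I_K) : (k <= n)%N ->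
  measurable_fun setT ((fun w => bridge k w 0 j) : g_sigma_algebraType (F (tk k)) -> R).
Proof.
elim: k => [|k IH] kn.
  by rewrite /=; under eq_fun do rewrite mxE; exact: measurable_cst.
have up (Y : Omega -> R) : measurable_fun setT (Y : g_sigma_algebraType (F (tk k)) -> R) ->
    measurable_fun setT (Y : g_sigma_algebraType (F (tk k.+1)) -> R).
  apply: (filtration_measurable_mono filF); rewrite ?gridt_ge0 ?gridt_le1//.
  exact: ltW.
under eq_fun do rewrite bridgeS mx_subE.
apply: measurable_funD.
  by apply: measurable_funM => //; apply: up; apply: IH; exact: ltnW.
apply: measurable_funB; first exact: (wiener_coord_measurable_at wW 0 j (tk01 kn)).
by apply: up; exact: (wiener_coord_measurable_at wW 0 j (tk01 (ltnW kn))).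
Qed.

Lemma bridge_L2 k (j : 'I_K) : (k <= n)%N -> L2 P (fun w => bridge k w 0 j).
Proof.
elim: k => [|k IH] kn.
  by rewrite /=; under eq_fun do rewrite mxE; exact: L2_cst.
under eq_fun do rewrite bridgeS.
apply: L2D; first by apply: L2Z; apply: IH; exact: ltnW.
exact: (wiener_increment_L2 filF wW 0 (gridt_ge0 n k) (tk_lt k) (gridt_le1 n0 kn) (Sgt0 j)).
Qed.

Lemma bridge_variance k (j : 'I_K) : (k <= n)%N ->
  (lam j)^-1 * \int[P]_w (bridge k w 0 j ^+ 2) <=
  (1 + h / delta) * (grids n delta k * tk k).
Proof.
elim: k => [|k IH] kn.
  rewrite /Rintegral integral0_eq => [|w _]; last by rewrite /= mxE expr0n.
  by rewrite mulr0 gridt0 !mulr0.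
have hZ := bridge_L2 j (ltnW kn).
have hD := wiener_increment_L2 filF wW 0 (gridt_ge0 n k) (tk_lt k) (gridt_le1 n0 kn) (Sgt0 j).
have mZ := bridge_measurable_at j (ltnW kn).
have ort := wiener_increment_orthogonal filF wW 0 (gridt_ge0 n k) (tk_lt k) (gridt_le1 n0 kn) (Sgt0 j) mZ hZ.
have E : \int[P]_w (bridge k.+1 w 0 j ^+ 2) =
    (1 - gain k * h) ^+ 2 * \int[P]_w (bridge k w 0 j ^+ 2) +
    \int[P]_w ((W 1 K (tk k.+1) w - W 1 K (tk k) w) 0 j ^+ 2).
  have := second_moment_lincomb (1 - gain k * h) 1 hZ hD ort.
  rewrite expr1n mul1r => <-.
  by apply: eq_Rintegral => w _; rewrite bridgeS mul1r.
rewrite E mulrDr mulrCA.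
apply: le_trans (grid_variance_step n0 d0 d1 kn (IH (ltnW kn))).
rewrite lerD2l ler_pdivrMl//.
have := wiener_increment_second_moment filF wW 0 (gridt_ge0 n k) (tk_lt k) (gridt_le1 n0 kn) (Sgt0 j).
rewrite -(L2_Rintegral hD) lee_fin (QKE ip onb cov) eqxx mulr1 gridtS.
by rewrite [tk k + _]addrC addrK mulrC.
Qed.

Lemma shift_measurable_at (j : 'I_K) :
  measurable_fun setT ((fun w => shift_to w 0 j) : g_sigma_algebraType (F 0) -> R).
Proof.
rewrite /shift_to; under eq_fun do rewrite mx_subE !mxE.
apply: measurable_funB => //.
exact: (measurableT_comp (dot_measurable ip (e j)) XF).
Qed.

Let Xsq_lty : (\int[P]_w (`|X w| ^+ 2)%:E < +oo)%E.
Proof.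
have mf : measurable_fun setT (fun x : borel H => (`|x : H| ^+ 2)%:E).
  by apply/measurable_EFinP; apply: measurable_funX; exact: norm_borel_measurable.
have f0 (x : borel H) : (0 <= (`|x : H| ^+ 2)%:E)%E by rewrite lee_fin sqr_ge0.
by rewrite -(@ge0_integral_law _ _ _ _ _ P mu (X : Omega -> borel H) _ Xm Xlaw mf f0).
Qed.

Lemma proj_L2 (j : nat) : L2 P (fun w => dot (X w) (e j)).
Proof.
apply: L2P; first exact: measurableT_comp (dot_measurable ip (e j)) Xm.
apply: le_lt_trans Xsq_lty; apply: ge0_le_integral_nonmeasurable => w; rewrite lee_fin ?sqr_ge0//.
(* Bessel's inequality on the first [j.+1] coordinates, the last of which is the one along [e j]. *)
apply: le_trans (mdot_projHK_le ip onb j.+1 (X w)).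
have := sqr_coord_le_mdot (projHK dot e j.+1 (X w)) 0 ord_max.
by rewrite mxE.
Qed.

Lemma shift_L2 (j : 'I_K) : L2 P (fun w => shift_to w 0 j).
Proof.
rewrite /shift_to; under eq_fun do rewrite mx_subE !mxE.
by apply: L2D; [exact: proj_L2|exact: L2_cst].
Qed.

(** The target is known at time 0, so every later increment is orthogonal to it. The mean energy
    therefore has no cross term and splits into the Cameron-Martin part and the bridge part. *)
Lemma shift_bridge_orthogonal k (j : 'I_K) : (k <= n)%N ->
  \int[P]_w (shift_to w 0 j * bridge k w 0 j) = 0.
Proof.
elim: k => [|k IH] kn.
  by rewrite /Rintegral integral0_eq// => w _; rewrite (_ : bridge 0 w 0 j = 0) ?mulr0//= mxE.
have hZ := bridge_L2 j (ltnW kn).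
have hD := wiener_increment_L2 filF wW 0 (gridt_ge0 n k) (tk_lt k) (gridt_le1 n0 kn) (Sgt0 j).
have ms : measurable_fun setT ((fun w => shift_to w 0 j) : g_sigma_algebraType (F (tk k)) -> R).
  apply: (filtration_measurable_mono filF _ _ _ (shift_measurable_at j)) => //.
    exact: gridt_ge0.
  by rewrite gridt_le1// ltnW.
have ort := wiener_increment_orthogonal filF wW 0 (gridt_ge0 n k) (tk_lt k) (gridt_le1 n0 kn) (Sgt0 j) ms (shift_L2 j).
have iZ := L2_mul (shift_L2 j) hZ; have iD := L2_mul (shift_L2 j) hD.
transitivity (\int[P]_w ((1 - gain k * h) * (shift_to w 0 j * bridge k w 0 j) +
  shift_to w 0 j * (W 1 K (tk k.+1) w - W 1 K (tk k) w) 0 j)).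
  by apply: eq_Rintegral => w _; rewrite bridgeS; ring.
rewrite RintegralD//; last first.
  by rewrite /comp; under eq_fun do rewrite EFinM; exact: integrableZl.
by rewrite RintegralZl// (IH (ltnW kn)) mulr0 add0r; exact: ort.
Qed.

Lemma feedback_second_moment k (j : 'I_K) : (k <= n)%N ->
  \int[P]_w (feedback w j k ^+ 2) =
  \int[P]_w (shift_to w 0 j ^+ 2) + gain k ^+ 2 * \int[P]_w (bridge k w 0 j ^+ 2).
Proof.
move=> kn.
have := second_moment_lincomb 1 (- gain k) (shift_L2 j) (bridge_L2 j kn) (shift_bridge_orthogonal j kn).
rewrite expr1n mul1r sqrrN => <-.
by apply: eq_Rintegral => w _; rewrite /feedback mul1r mulNr.
Qed.

Lemma feedback_L2 k (j : 'I_K) : (k <= n)%N -> L2 P (fun w => feedback w j k).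
Proof.
move=> kn; rewrite /feedback; under eq_fun do rewrite -mulNr.
by apply: L2D; [exact: shift_L2|apply: L2Z; exact: bridge_L2].
Qed.

Lemma control_progressive : progressive F 0 control.
Proof.
move=> s /andP[s0 s1]; have s01 : 0 <= s <= 1 by rewrite s0.
have mI k : measurable (@gridI R n k) by exact: measurable_itv.
have mD : measurable (`[0, s]%classic `*` [set: g_sigma_algebraType (F s)] : set (R * g_sigma_algebraType (F s))).
  by apply: measurableX => //; exact: measurable_itv.
apply: mx_measurable_in => // i j.
rewrite (_ : (fun w => _) = (fun z : R * g_sigma_algebraType (F s) =>
    \sum_(k < n) feedback z.2 j k * \1_(@gridI R n k) z.1)); last first.
  by apply/funext => z; rewrite mxE.
apply: measurable_sum => k.
have [ks|sk] := leP (tk k) s.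
  apply: measurable_funTS; apply: measurable_funM; last first.
    have mi : measurable_fun setT (\1_(@gridI R n k) : R -> R).
      by apply: measurable_indic; exact: mI.
    exact: (measurableT_comp mi measurable_fst).
  have mf : measurable_fun setT ((fun w => feedback w j k) : g_sigma_algebraType (F s) -> R).
    have up u (Y : Omega -> R) : 0 <= u -> u <= s -> measurable_fun setT (Y : g_sigma_algebraType (F u) -> R) ->
        measurable_fun setT (Y : g_sigma_algebraType (F s) -> R).
      by move=> u0 us; exact: (filtration_measurable_mono filF).
    apply: measurable_funB; first by apply: up (shift_measurable_at j).
    apply: measurable_funM => //; apply: (up (tk k)) => //; first exact: gridt_ge0.
    by apply: bridge_measurable_at; rewrite ltnW.
  exact: (measurableT_comp mf measurable_snd).
(* For a grid time beyond [s] the feedback is not measurable at time [s], but its indicator vanishes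
   on [[0, s]]. *)
have E0 r w : 0 <= r <= s -> feedback w j k * \1_(@gridI R n k) r = 0.
  move=> /andP[r0 rs]; rewrite indicE memNset ?mulr0// /gridI /= in_itv/= => /andP[kr _].
  by have := lt_le_trans sk kr; rewrite ltNge rs.
move=> _ Y mY; have [Y0|nY0] := pselect (Y 0).
  rewrite setIidl// => -[r w] [/= + _]; rewrite in_itv/= => rs.
  by rewrite E0.
rewrite (_ : _ `&` _ = set0)//; apply/seteqP; split=> // -[r w] [[/= + _]].
by rewrite in_itv/= => rs; rewrite E0.
Qed.

Lemma energy_control w : energy lam 0 control w =
  (\sum_(k < n) h * \sum_(j < K) (lam j)^-1 * feedback w j k ^+ 2)%:E.
Proof.
rewrite /energy big_ord1 -(integral_stepf n0 (fun k => \sum_(j < K) (lam j)^-1 * feedback w j k ^+ 2)).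
apply: eq_integral => s _; congr EFin; rewrite (normQK_sqr cov).
rewrite /stepf; under [RHS]eq_bigr do rewrite mulr_suml.
rewrite exchange_big/=; apply: eq_bigr => j _; rewrite !mxE.
rewrite (stepf_comp n0 (phi := fun y => y ^+ 2)) ?expr0n//.
by rewrite /stepf mulr_sumr; apply: eq_bigr => k _; rewrite mulrA.
Qed.

Lemma mean_energy_control : (\int[P]_w energy lam 0 control w <=
  (D2_CM dot e lam x0 mu K + K%:R * ln delta^-1)%:E)%E.
Proof.
under eq_integral do rewrite energy_control.
have fi k j : (k < n)%N -> P.-integrable setT (EFin \o (fun w => feedback w j k ^+ 2)).
  by move=> kn; apply: L2_sqr_integrable; apply: feedback_L2; exact: ltnW.
have fi2 (k : 'I_n) : P.-integrable setT (EFin \o (fun w => \sum_(j < K) (lam j)^-1 * feedback w j k ^+ 2)).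
  by apply: integrable_weighted_sum => j; exact: fi.
have fi3 := integrable_weighted_sum (index_enum 'I_n) (fun=> h) fi2.
rewrite -(fineK (integrable_fin_num measurableT fi3)) lee_fin.
have -> : fine (\int[P]_w (EFin \o (fun w => \sum_(k < n) h * \sum_(j < K) (lam j)^-1 * feedback w j k ^+ 2)%R) w)%E
  = \sum_(k < n) h * \sum_(j < K) (lam j)^-1 * \int[P]_w (feedback w j k ^+ 2).
  rewrite -[LHS]/(\int[P]_w (\sum_(k < n) h * \sum_(j < K) (lam j)^-1 * feedback w j k ^+ 2)).
  rewrite (Rintegral_weighted_sum _ _ fi2); apply: eq_bigr => k _.
  by rewrite (Rintegral_weighted_sum _ _ (fun j => fi k j (ltn_ord k))).
have -> : \sum_(k < n) h * \sum_(j < K) (lam j)^-1 * \int[P]_w (feedback w j k ^+ 2) =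
  \sum_(j < K) ((lam j)^-1 * \int[P]_w (shift_to w 0 j ^+ 2) +
     \sum_(k < n) h * (gain k ^+ 2 * ((lam j)^-1 * \int[P]_w (bridge k w 0 j ^+ 2)))).
  under [LHS]eq_bigr do rewrite mulr_sumr.
  rewrite exchange_big/=; apply: eq_bigr => j _.
  under eq_bigr => k _ do rewrite (feedback_second_moment j (ltnW (ltn_ord k))).
  set M := Rintegral _ _ _; pose V k := \int[P]_w (bridge k w 0 j ^+ 2).
  rewrite (eq_bigr (fun k : 'I_n => h * ((lam j)^-1 * M) +
    h * (gain k ^+ 2 * ((lam j)^-1 * V k)))) => [|k _]; last by rewrite -/(V k); ring.
  (* The n steps of length h add up to 1, so the constant drift towards the target is counted
     once. *)
  rewrite big_split/= sumr_const card_ord -mulrnAl; congr (_ + _).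
  by rewrite -mulr_natr mulVf ?mul1r// gt_eqF// ltr0n.
rewrite big_split/= lerD//.
  rewrite /D2_CM ler_sum// => j _; rewrite ler_pM2l ?invr_gt0// le_eqVlt; apply/orP; left; apply/eqP.
  have mf : measurable_fun setT (fun x : borel H => ((dot (x : H) (e j) - dot x0 (e j)) ^+ 2)%:E).
    apply/measurable_EFinP; apply: measurable_funX; apply: measurable_funB => //.
    exact: dot_measurable.
  rewrite /Rintegral (integral_law Xm Xlaw mf); congr fine.
  by apply: eq_integral => w _; rewrite /shift_to mx_subE !mxE.
rewrite -[K in leRHS]card_ord mulr_natl -sumr_const ler_sum// => j _.
apply: (grid_energy n0 d0 d1 (v := fun k => (lam j)^-1 * \int[P]_w (bridge k w 0 j ^+ 2)) hd).
by move=> k kn; apply: bridge_variance; exact: ltnW.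
Qed.

End control.

Section control_value.
Context {R : realType} {H : completeNormedModType R}.
Variables (dot : H -> H -> R) (Q : {linear H -> H}) (e : nat -> H) (lam : nat -> R).
Context {d : measure_display} {Omega : measurableType d}.
Variables (P : probability Omega R) (F : R -> set (set Omega))
  (W : forall N K : nat, R -> Omega -> 'M[R]_(N, K)).
Hypotheses (ip : is_inner_product dot) (onb : orthonormal_basis dot e)
  (cov : covariance_operator dot Q e lam) (sb : stochastic_basis dot Q e P F W).
Local Notation nrm := (fun x : H => `|x|).

Let filF := basis_filtration sb.
Let lam_gt0 j : 0 < lam j := cov_eigen_gt0 cov j.

Variables (K n : nat) (delta : R).
Hypotheses (n0 : (0 < n)%N) (d0 : 0 < delta) (d1 : delta < 1).
Hypothesis hd : @gridstep R n <= delta ^+ 2.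
Variables (X : Omega -> H) (mu : probability (borel H) R) (x0 : H).
Hypotheses (XF : measurable_at F 0 X) (Xlaw : has_law P X mu) (P2mu : P2 nrm mu).

Local Notation h := (@gridstep R n).
Local Notation bridge := (bridge W K n delta).
Local Notation control := (control dot e W K n delta X x0).

Let in01_0 : 0 <= (0 : R) <= 1. Proof. by rewrite lexx ler01. Qed.

Let Xm : measurable_fun setT (X : Omega -> borel H).
Proof. exact: (filtration_measurable_fun filF in01_0 XF). Qed.

(** Integrated form of the recursion: the accumulated feedback is exactly what separates the bridge
    from the driving noise. Hence the controlled state at time 1 is the projected target plus the
    bridge, path by path. *)
Lemma bridge_telescope k w (j : 'I_K) :
  bridge k w 0 j + \sum_(l < k) h * (gridgain n delta l * bridge l w 0 j) =
  W 1 K (@gridt R n k) w 0 j - W 1 K 0 w 0 j.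
Proof.
elim: k => [|k IH]; first by rewrite big_ord0 /= mxE addr0 gridt0 subrr.
rewrite big_ord_recr/= bridgeS mx_subE.
move: IH; move: (\sum_(l < k) _) => s IH.
have -> : s = W 1 K (@gridt R n k) w 0 j - W 1 K 0 w 0 j - bridge k w 0 j.
  by rewrite -IH addrAC subrr add0r.
ring.
Qed.

Lemma control_state w :
  state (W 1 K) 0 (cst (projHK dot e K x0)) control 1 w = projHK dot e K (X w) + bridge n w.
Proof.
apply/matrixP => i j; rewrite (ord1 i) /state.
have -> : (cst (projHK dot e K x0) w + \matrix_(i0, j0) \int[lebesgue_measure]_(r in `[0, 1]) control r w i0 j0
   + (W 1 K 1 w - W 1 K 0 w)) 0 j =
   projHK dot e K x0 0 j + \int[lebesgue_measure]_(r in `[0, 1]) control r w 0 j + (W 1 K 1 w 0 j - W 1 K 0 w 0 j).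
  by rewrite [in LHS]mxE mx_subE; congr (_ + _); rewrite mxE; congr (_ + _); rewrite mxE.
have -> : \int[lebesgue_measure]_(r in `[0, 1]) control r w 0 j =
    \sum_(k < n) h * feedback dot e W n delta X x0 w j k.
  rewrite -[RHS]/(fine (\sum_(k < n) h * feedback dot e W n delta X x0 w j k)%:E).
  rewrite -(integral_stepf n0) /Rintegral; congr fine.
  by apply: eq_integral => s _; rewrite mxE.
rewrite -{1}(@gridtn R n n0) -(bridge_telescope n) /feedback [RHS]mxE.
rewrite (eq_bigr (fun k : 'I_n => h * shift_to dot e K X x0 w 0 j -
   h * (gridgain n delta k * bridge k w 0 j))) => [|k _]; last by rewrite mulrBr.
rewrite sumrB sumr_const card_ord -mulrnAl.
have -> : h *+ n = 1 by rewrite -mulr_natr mulVf// gt_eqF// ltr0n.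
rewrite mul1r /shift_to mx_subE.
move: (\sum_(k < n) _) => s; ring.
Qed.

Definition terminal (w : Omega) : borel 'rV[R]_K := projHK dot e K (X w) + bridge n w.

Lemma bridge_measurable (j : 'I_K) : measurable_fun setT (fun w => bridge n w 0 j).
Proof. by have [] := bridge_L2 ip onb cov sb delta n0 j (leqnn n). Qed.

Lemma terminal_measurable : measurable_fun setT terminal.
Proof.
apply: mx_measurable => i j; rewrite (ord1 i) /terminal.
under eq_fun do rewrite mxE.
apply: measurable_funD; last exact: bridge_measurable.
under eq_fun do rewrite mxE.
exact: measurableT_comp (dot_measurable ip (e j)) Xm.
Qed.

Definition terminal_mfun : {mfun Omega >-> borel 'rV[R]_K} :=
  HB.pack terminal (isMeasurableFun.Build _ _ Omega (borel 'rV[R]_K) _ terminal_measurable).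

Lemma bridge_mdot_measurable : measurable_fun setT (fun w => (mdot (bridge n w : 'rV[R]_K) (bridge n w))%:E).
Proof.
apply/measurable_EFinP; apply: (mdot_measurable (f := bridge n : Omega -> borel 'rV[R]_K) (g := bridge n : Omega -> borel 'rV[R]_K)).
- by apply: mx_measurable => i j; rewrite (ord1 i); exact: bridge_measurable.
- by apply: mx_measurable => i j; rewrite (ord1 i); exact: bridge_measurable.
Qed.

Lemma bridge_final_variance :
  (\int[P]_w (mdot (bridge n w : 'rV[R]_K) (bridge n w))%:E <= (2 * delta * traceop dot Q e)%:E)%E.
Proof.
under eq_integral do rewrite mdotE big_ord1 -sumEFin.
have mb (j : 'I_K) : measurable_fun setT (fun w => (bridge n w 0 j ^+ 2)%:E).
  by apply/measurable_EFinP; apply: measurable_funX; exact: bridge_measurable.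
rewrite ge0_integral_sum//; last by move=> j w _; rewrite lee_fin sqr_ge0.
apply: (@le_trans _ _ (\sum_(j < K) (2 * delta * lam j)%:E)%E); last first.
  rewrite sumEFin lee_fin -mulr_sumr ler_wpM2l ?mulr_ge0 ?(ltW d0)//.
  exact: (trace_partial_le ip onb cov).
apply: lee_sum => j _.
rewrite -(L2_Rintegral (bridge_L2 ip onb cov sb delta n0 j (leqnn n))) lee_fin.
have := grid_final_variance n0 d0 d1 hd (bridge_variance ip onb cov sb n0 d0 d1 j (leqnn n)).
by rewrite ler_pdivrMl// mulrC.
Qed.

Local Notation Delta := (Delta_proj dot e mu K).
Local Notation res x := (x - embed e (projHK dot e K x)).

Lemma residual_measurable : measurable_fun setT (fun x : borel H => (`|res (x : H)| ^+ 2)%:E).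
Proof.
apply/measurable_EFinP; apply: measurable_funX.
apply: continuous_borel_measurable => x.
apply: (@cvg_comp _ _ _ (fun x : H => res x) Num.norm); last exact: norm_continuous.
apply: cvgB; first exact: cvg_id.
rewrite /embed; apply: (@continuous_big H 'I_K +%R 0 xpredT) => [|j _]; first exact: add_continuous.
move=> y; apply: (@continuousZr_tmp _ _ _ (fun x : H => projHK dot e K x 0 j) (e j) y).
rewrite (_ : (fun x : H => _) = (fun x : H => dot x (e j))); first exact: dot_continuous.
by apply/funext => z; rewrite mxE.
Qed.

Lemma residual_le x : `|res x| ^+ 2 <= `|x| ^+ 2.
Proof.
have := sqr_norm_embed_sub ip onb (- projHK dot e K x) x.
rewrite subrr (_ : embed e 0 = 0); last first.
  by rewrite /embed big1// => j _; rewrite mxE scale0r.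
by rewrite sub0r normrN => ->; rewrite lerDr mdot_ge0.
Qed.

Lemma Delta_projE : ((Delta)%:E = \int[P]_w (`|res (X w)| ^+ 2)%:E)%E.
Proof.
have r0 (x : borel H) : (0 <= (`|res (x : H)| ^+ 2)%:E)%E by rewrite lee_fin sqr_ge0.
rewrite -(@ge0_integral_law _ _ _ _ _ P mu (X : Omega -> borel H) _ Xm Xlaw residual_measurable r0).
rewrite /Delta_proj /Rintegral fineK// ge0_fin_numE; last exact: integral_ge0.
apply: le_lt_trans P2mu; apply: ge0_le_integral_nonmeasurable => // x.
by rewrite lee_fin; exact: residual_le.
Qed.

Lemma Delta_proj_ge0 : 0 <= Delta.
Proof. by rewrite -lee_fin Delta_projE; apply: integral_ge0 => w _; rewrite lee_fin sqr_ge0. Qed.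

Let M2E : ((M2 nrm mu)%:E = \int[mu]_x (`|x : H| ^+ 2)%:E)%E.
Proof.
rewrite /M2 /Rintegral fineK// ge0_fin_numE; first exact: P2mu.
by apply: integral_ge0 => x _; rewrite lee_fin sqr_ge0.
Qed.

Lemma Delta_proj_le : Delta <= M2 nrm mu.
Proof.
rewrite -lee_fin M2E /Delta_proj /Rintegral fineK; last first.
  rewrite ge0_fin_numE; last by apply: integral_ge0 => x _; rewrite lee_fin sqr_ge0.
  apply: le_lt_trans P2mu; apply: ge0_le_integral_nonmeasurable => x; rewrite lee_fin ?sqr_ge0//.
  exact: residual_le.
apply: ge0_le_integral_nonmeasurable => x; rewrite lee_fin ?sqr_ge0//.
exact: residual_le.
Qed.

Local Notation nu1 := (distribution (distribution P terminal_mfun) (@embed_mfun R H e K)).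

(** The final state is coupled with the target [X] itself; by Pythagoras the squared distance is
    that of the bridge plus the truncation residual. *)
Lemma terminal_W2 : W2 nrm nu1 mu <= Num.sqrt (2 * (delta * traceop dot Q e + Delta)).
Proof.
have mE : measurable_fun setT ((@embed_mfun R H e K) \o terminal : Omega -> borel H).
  exact: measurableT_comp (@embed_measurable R H e K) terminal_measurable.
have lE : has_law P ((@embed_mfun R H e K) \o terminal) nu1 by move=> A mA.
apply: (W2_le_coupling mE Xm lE Xlaw (norm_sub_measurable ip onb)).
have bm := bridge_mdot_measurable.
have rm : measurable_fun setT (fun w => (`|res (X w)| ^+ 2)%:E).
  exact: (measurableT_comp residual_measurable Xm).
apply: (@le_trans _ _ (\int[P]_w ((mdot (bridge n w : 'rV[R]_K) (bridge n w))%:E + (`|res (X w)| ^+ 2)%:E))%E).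
  apply: ge0_le_integral_nonmeasurable => w; first by rewrite lee_fin sqr_ge0.
  by rewrite -EFinD lee_fin /= /terminal /embed_mfun (sqr_norm_embed_sub ip onb).
have b0 w : (0 <= (mdot (bridge n w : 'rV[R]_K) (bridge n w))%:E)%E by rewrite lee_fin mdot_ge0.
have r0 w : (0 <= (`|res (X w)| ^+ 2)%:E)%E by rewrite lee_fin sqr_ge0.
rewrite (ge0_integralD P measurableT (fun w _ => b0 w) bm (fun w _ => r0 w) rm) -Delta_projE.
apply: (le_trans (leeD2r _ bridge_final_variance)).
by rewrite -EFinD lee_fin; have := Delta_proj_ge0; lra.
Qed.

Lemma terminal_second_moment :
  (\int[P]_w (enorm (terminal w : 'rV[R]_K) ^+ 2)%:E <=
   (2 * M2 nrm mu + 4 * delta * traceop dot Q e)%:E)%E.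
Proof.
have bm := bridge_mdot_measurable.
have nm : measurable_fun setT (fun x : borel H => (`|x : H| ^+ 2)%:E).
  by apply/measurable_EFinP; apply: measurable_funX; exact: norm_borel_measurable.
have nX : measurable_fun setT (fun w => (`|X w| ^+ 2)%:E) := measurableT_comp nm Xm.
apply: (@le_trans _ _ (\int[P]_w (2%:E * (`|X w| ^+ 2)%:E + 2%:E * (mdot (bridge n w : 'rV[R]_K) (bridge n w))%:E))%E).
  apply: ge0_le_integral_nonmeasurable => w; first by rewrite lee_fin sqr_ge0.
  rewrite -!EFinM -EFinD lee_fin enorm_sqr /terminal.
  have := mdotD_le (projHK dot e K (X w)) (bridge n w).
  by have := mdot_projHK_le ip onb K (X w); lra.
have b0 w : (0 <= (mdot (bridge n w : 'rV[R]_K) (bridge n w))%:E)%E by rewrite lee_fin mdot_ge0.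
have r0 w : (0 <= (`|X w| ^+ 2)%:E)%E by rewrite lee_fin sqr_ge0.
have t0 : (0 <= 2%:E :> \bar R)%E by rewrite lee_fin.
rewrite (ge0_integralD P measurableT (fun w _ => mule_ge0 t0 (r0 w)) (measurable_funeM _ nX)
  (fun w _ => mule_ge0 t0 (b0 w)) (measurable_funeM _ bm)).
rewrite (ge0_integralZl P measurableT nX (fun w _ => r0 w) t0).
rewrite (ge0_integralZl P measurableT bm (fun w _ => b0 w) t0).
have f0 (x : borel H) : (0 <= (`|x : H| ^+ 2)%:E)%E by rewrite lee_fin sqr_ge0.
rewrite -(@ge0_integral_law _ _ _ _ _ P mu (X : Omega -> borel H) _ Xm Xlaw nm f0) -M2E.
apply: (@le_trans _ _ (2%:E * (M2 nrm mu)%:E + 2%:E * (2 * delta * traceop dot Q e)%:E)%E).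
  by rewrite leeD2l// lee_wpmul2l// bridge_final_variance.
by rewrite -!EFinM -EFinD lee_fin; lra.
Qed.

Lemma terminal_P2 : P2 (@enorm R 1 K) (distribution P terminal_mfun).
Proof.
have mf : measurable_fun setT (fun x : borel 'rV[R]_K => (enorm (x : 'rV[R]_K) ^+ 2)%:E).
  by apply/measurable_EFinP; exact: enorm_sqr_measurable.
have f0 (x : borel 'rV[R]_K) : (0 <= (enorm (x : 'rV[R]_K) ^+ 2)%:E)%E by rewrite lee_fin sqr_ge0.
rewrite /P2 (ge0_integral_distribution terminal_mfun mf f0).
exact: le_lt_trans terminal_second_moment (ltry _).
Qed.

Lemma terminal_M2 : M2 nrm nu1 <= 2 * M2 nrm mu + 4 * delta * traceop dot Q e.
Proof.
rewrite (M2_embed ip onb).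
have mf : measurable_fun setT (fun x : borel 'rV[R]_K => (enorm (x : 'rV[R]_K) ^+ 2)%:E).
  by apply/measurable_EFinP; exact: enorm_sqr_measurable.
have f0 (x : borel 'rV[R]_K) : (0 <= (enorm (x : 'rV[R]_K) ^+ 2)%:E)%E by rewrite lee_fin sqr_ge0.
rewrite -lee_fin /M2 /Rintegral fineK.
  rewrite (ge0_integral_distribution terminal_mfun mf f0).
  exact: terminal_second_moment.
by rewrite ge0_fin_numE; [exact: terminal_P2|apply: integral_ge0 => x _].
Qed.

Variables (G : probability (borel H) R -> R) (L : R -> nat -> R).
Hypothesis mh : master_hypothesis dot Q e lam G P F W L.

Lemma VK_le_terminal (eps : R) (nu : probability (borel 'rV[R]_K) R) : 0 < eps ->
  P2 (@enorm R 1 K) nu -> has_law P (cst (projHK dot e K x0)) nu ->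
  VK e lam G P F W eps (K := K) 0 nu <=
  G nu1 + eps / 2 * (D2_CM dot e lam x0 mu K + K%:R * ln delta^-1).
Proof.
move=> eps0 P2nu nulaw.
have en := mean_energy_control ip onb cov sb K n0 d0 d1 hd x0 XF Xlaw P2mu.
have e20 : 0 < eps / 2 by rewrite divr_gt0.
have en0 w : (0 <= energy lam 0 control w)%E by exact: energy_ge0.
have I0 : (0 <= \int[P]_w ((eps / 2)%:E * energy lam 0 control w))%E.
  by apply: integral_ge0 => w _; rewrite mule_ge0// lee_fin ltW.
have Ile : (\int[P]_w ((eps / 2)%:E * energy lam 0 control w) <=
    (eps / 2 * (D2_CM dot e lam x0 mu K + K%:R * ln delta^-1))%:E)%E.
  apply: (le_trans (ge0_integralZ_le_nonmeasurable P e20 en0)).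
  by rewrite (EFinM (eps / 2)) lee_wpmul2l// lee_fin ltW.
have Ifin : (\int[P]_w ((eps / 2)%:E * energy lam 0 control w))%E \is a fin_num.
  by rewrite ge0_fin_numE// (le_lt_trans Ile)// ltry.
apply: (@le_trans _ _ (G nu1 + fine (\int[P]_w ((eps / 2)%:E * energy lam 0 control w))%E)); last first.
  by rewrite lerD2l -lee_fin fineK.
apply: (VK_le_cost ip onb cov sb mh eps0 in01_0 P2nu).
exists (cst (projHK dot e K x0)), control, terminal_mfun; split => //.
- exact: measurable_cst.
- split; first exact: (control_progressive ip sb delta n0 x0 XF).
  exact: le_lt_trans en (ltry _).
- by move=> w; rewrite control_state.
- by rewrite EFinD fineK.
Qed.

End control_value.

(** * Choice of [delta] and conclusion *)

Section mean_field_gap.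
Context {R : realType}.

Lemma powR_sqrt (A a : R) : 0 <= A -> Num.sqrt A `^ a = A `^ (a / 2).
Proof. by move=> A0; rewrite -powR12_sqrt// -powRrM mulrC. Qed.

(** Since A <= T + M, the bound sqrt (2 A) <= 1 + 2 A makes the moment factor at most 2 + 6 T + 5 M,
    which is free of K and eps; only the power keeps the rate. The other 2 bounds 2^(a / 2). *)
Lemma holder_factor_le (T M A W M1 a : R) : 0 <= T -> 0 <= M -> 0 < a <= 1 ->
  0 <= A -> A <= T + M -> 0 <= W -> W <= Num.sqrt (2 * A) -> M1 <= 2 * M + 4 * T -> 0 <= M1 ->
  (1 + W + M1 + M) * W `^ a <= 2 * (2 + 6 * T + 5 * M) * A `^ (a / 2).
Proof.
move=> T0 M0 /andP[a0 a1] A0 AT W0 WA M1le M10.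
have A20 : 0 <= 2 * A by rewrite mulr_ge0.
have sA : Num.sqrt (2 * A) <= 1 + 2 * A.
  have := sqr_sqrtr A20; have := sqrtr_ge0 (2 * A); move: (Num.sqrt _) => s; nra.
have Wa : W `^ a <= 2 * A `^ (a / 2).
  apply: (@le_trans _ _ (Num.sqrt (2 * A) `^ a)).
    by apply: ge0_ler_powR; rewrite ?nnegrE ?sqrtr_ge0// ltW.
  rewrite powR_sqrt// powRM// ler_wpM2r ?powR_ge0//.
  have h : 2 `^ (a / 2) <= 2 `^ 1 :> R by apply: ler_powR; lra.
  by rewrite powRr1 in h.
rewrite (mulrC 2) -mulrA; apply: ler_pM => //; [lra|exact: powR_ge0|lra].
Qed.

End mean_field_gap.

Section mean_field_value.
Context {R : realType} {H : completeNormedModType R}.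
Variables (dot : H -> H -> R) (Q : {linear H -> H}) (e : nat -> H) (lam : nat -> R).
Context {d : measure_display} {Omega : measurableType d}.
Variables (P : probability Omega R) (F : R -> set (set Omega))
  (W : forall N K : nat, R -> Omega -> 'M[R]_(N, K)).
Variables (G : probability (borel H) R -> R) (L : R -> nat -> R)
  (mustar : probability (borel H) R) (alpha : R) (x0 : H).
Hypotheses (ip : is_inner_product dot) (onb : orthonormal_basis dot e)
  (cov : covariance_operator dot Q e lam) (sb : stochastic_basis dot Q e P F W)
  (mh : master_hypothesis dot Q e lam G P F W L) (mz : minimizer_hypothesis G mustar alpha).

Lemma traceop_ge0 : 0 <= traceop dot Q e.
Proof. by have := trace_partial_le ip onb cov 0; rewrite big_ord0. Qed.

Lemma VK_le : exists Cstar : R, forall (K : nat) (eps : R) (nu : probability (borel 'rV[R]_K) R),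
  0 < eps < 1 -> P2 (@enorm R 1 K) nu -> has_law P (cst (projHK dot e K x0)) nu ->
  VK e lam G P F W eps (K := K) 0 nu <= V0 G
    + Cstar * (eps `^ (2 / alpha) * traceop dot Q e + Delta_proj dot e mustar K) `^ (alpha / 2)
    + eps / 2 * D2_CM dot e lam x0 mustar K + eps * K%:R / alpha * ln (1 / eps).
Proof.
have [LG hold] := minimizer_holder mz.
have /andP[a0 a1] := minimizer_alpha mz.
have P2mu := minimizer_P2 mz.
have T0 := traceop_ge0.
have [X XF Xlaw] := basis_rich sb mustar.
set T := traceop dot Q e in T0 *; pose M := M2 (fun x : H => `|x|) mustar.
(* Depends only on G, on the trace of Q and on the second moment of [mustar]. *)
exists (`|LG| * (2 * (2 + 6 * T + 5 * M))) => K eps nu /andP[e0 e1] P2nu nulaw.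
pose delta := eps `^ (2 / alpha).
have d0 : 0 < delta by exact: powR_gt0.
have d1 : delta < 1.
  have <- : 1 `^ (2 / alpha) = 1 :> R by rewrite powR1.
  by apply: gt0_ltr_powR; rewrite ?nnegrE ?divr_gt0 ?ltW.
(* More than [delta ^- 2] steps, so that the mesh is at most [delta ^+ 2]; no constant of the result
   depends on [n]. *)
pose n := (Num.truncn (delta ^- 2)).+1.
have hd : @gridstep R n <= delta ^+ 2.
  rewrite /gridstep -[leRHS]invrK lef_pV2 ?posrE ?ltr0n// ?invr_gt0 ?exprn_gt0//.
  exact/ltW/truncnS_gt.
have n0 : (0 < n)%N by [].
have := VK_le_terminal ip onb cov sb n0 d0 d1 hd XF Xlaw P2mu mh e0 P2nu nulaw.
set nu1 : probability (borel H) R := (X in G X + _) => Vle.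
have W2le := terminal_W2 ip onb cov sb K n0 d0 d1 hd XF Xlaw P2mu.
have M1le := terminal_M2 ip onb cov sb K n0 d0 d1 hd XF Xlaw P2mu.
have P1 : P2 (fun x : H => `|x|) nu1.
  apply: (P2_embed ip onb).
  exact: (terminal_P2 ip onb cov sb K n0 d0 d1 hd XF Xlaw P2mu).
have D0 : 0 <= Delta_proj dot e mustar K by apply: Rintegral_ge0 => x _; exact: sqr_ge0.
have Dle := Delta_proj_le ip onb K P2mu.
have A0 : 0 <= delta * T + Delta_proj dot e mustar K by rewrite addr_ge0// mulr_ge0// ltW.
have M10 : 0 <= M2 (fun x : H => `|x|) nu1 by apply: Rintegral_ge0 => x _; exact: sqr_ge0.
have M0 : 0 <= M by apply: Rintegral_ge0 => x _; exact: sqr_ge0.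
have dT : delta * T <= T by rewrite ler_piMl// ltW.
have AT : delta * T + Delta_proj dot e mustar K <= T + M by exact: lerD.
have M1le' : M2 (fun x : H => `|x|) nu1 <= 2 * M + 4 * T.
  by apply: (le_trans M1le); rewrite lerD2l -mulrA ler_wpM2l.
have := holder_factor_le T0 M0 (minimizer_alpha mz) A0 AT (W2_ge0 _ _ _) W2le M1le' M10.
have := hold nu1 mustar P1 P2mu.
rewrite (minimizer_attains mz) -/delta -/T -/M -/nu1.
set w := W2 _ _ _; set M1 := M2 _ nu1; set Aa := _ `^ (alpha / 2) => Gle fle.
have Gle' : G nu1 <= V0 G + `|LG| * (2 * (2 + 6 * T + 5 * M)) * Aa.
  rewrite -lerBlDl; apply: (le_trans (ler_norm _)); apply: (le_trans Gle).
  rewrite -mulrA -mulrA; apply: (le_trans (ler_wpM2r _ (ler_norm LG))); last exact: ler_wpM2l.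
  rewrite mulr_ge0 ?powR_ge0//; have w0 : 0 <= w by exact: W2_ge0.
  by have : 0 <= M1 by []; lra.
have lnE : ln delta^-1 = 2 / alpha * ln (1 / eps).
  by rewrite div1r !lnV ?posrE// ln_powR mulrN.
apply: (le_trans Vle); rewrite lnE mulrDr addrA.
have -> : eps / 2 * (K%:R * (2 / alpha * ln (1 / eps))) = eps * K%:R / alpha * ln (1 / eps).
  by field; rewrite gt_eqF.
by rewrite !lerD2r.
Qed.

End mean_field_value.

(** With all particles at one point the empirical measure is a Dirac mass, so the mean-field problem
    starts from a deterministic state. *)
Lemma empirical_const_law {R : realType} {d : measure_display} {Omega : measurableType d}
    (P : probability Omega R) (N K : nat) (c : 'rV[R]_K) : (0 < N)%N ->
  has_law P (cst c) (empirical (\matrix_(i < N) c)).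
Proof.
move=> N0 A mA; rewrite (empiricalE _ _ N0) /sum_dirac.
rewrite (eq_bigr (fun=> (c \in A)%:R%:E)) => [|i _]; last by rewrite rowK diracE.
rewrite sumEFin sumr_const card_ord -EFinM -[_%:R *+ N]mulr_natl mulrA mulVf ?pnatr_eq0 -?lt0n// mul1r.
rewrite preimage_cst; case: (c \in A); first exact: probability_setT.
exact: measure0.
Qed.

Theorem theorem4p2 (R : realType) (H : completeNormedModType R)
  (dot : H -> H -> R) (Q : {linear H -> H}) (e : nat -> H) (lam : nat -> R)
  (d : measure_display) (Omega : measurableType d) (P : probability Omega R)
  (F : R -> set (set Omega)) (W : forall N K : nat, R -> Omega -> 'M[R]_(N, K))
  (G : probability (borel H) R -> R) (L : R -> nat -> R)
  (mustar : probability (borel H) R) (alpha : R) (x0 : H) :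
  is_inner_product dot ->
  separable (H := H) ->
  orthonormal_basis dot e ->
  covariance_operator dot Q e lam ->
  stochastic_basis dot Q e P F W ->
  master_hypothesis dot Q e lam G P F W L ->
  minimizer_hypothesis G mustar alpha ->
  exists Cstar : R,
    forall (K N : nat) (eps : R), (0 < K)%N -> (0 < N)%N -> 0 < eps < 1 ->
    let v := vKN e lam G P F W eps (K := K) (N := N) in
    HJB_classical_solution lam (QK dot Q e K) eps (GK e G (K := K)) v ->
    particle_regularity v ->
    let gap := v 0 (\matrix_(i < N) projHK dot e K x0) / N%:R - V0 G in
    0 <= gap /\
    gap <= L eps K / (2 * N%:R)
      + Cstar * (eps `^ (2 / alpha) * traceop dot Q e
                 + Delta_proj dot e mustar K) `^ (alpha / 2)
      + eps / 2 * D2_CM dot e lam x0 mustar K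
      + eps * K%:R / alpha * ln (1 / eps).
Proof.
move=> ip _ onb cov sb mh mz.
have [Cstar VKle] := VK_le x0 ip onb cov sb mh mz.
exists Cstar => K N eps K0 N0 e01 v vHJB _ gap.
have /andP[e0 _] := e01.
have NN0 : 0 < N%:R :> R by rewrite ltr0n.
have in01_0 : 0 <= (0 : R) <= 1 by rewrite lexx ler01.
split; first by rewrite subr_ge0 ler_pdivlMr// mulrC; exact: (vKN_lower ip onb cov sb mh e0 N0).
have [Cv vle] := vKN_upper ip onb cov sb mh K e0 N0.
have [label ulabel] := uniform_label_exists ip onb sb N0.
have [dmu [d2mu VM]] := G_master mh e0 K0.
set x := \matrix_(i < N) projHK dot e K x0 in gap *.
have vV := particle_le_meanfield N0 ulabel (fun j => ltW (cov_eigen_gt0 cov j)) e0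
  (@QKE _ _ _ _ ip onb _ _ cov K) VM vHJB vle (fun t nu t01 P2nu => VK_lower ip onb cov sb mh e0 t01 P2nu) x.
have := VKle K eps (empirical x) e01 (P2_empirical N0 ulabel x) (empirical_const_law P _ N0).
set V := VK _ _ _ _ _ _ _ _ in vV *; move: (_ * _ `^ _) => b.
rewrite /gap lerBlDr ler_pdivrMr//.
move: (eps / 2 * _) (_ * ln _) => b2 b3 Vle.
have -> : L eps K / (2 * N%:R) = L eps K / 2 / N%:R by field; rewrite gt_eqF.
(* Division by N turns the defect L / 2 of the comparison into L / (2 N). *)
apply: (le_trans vV); rewrite -ler_pdivrMr// mulrDl (mulrC N%:R) mulfK ?gt_eqF//; lra.
Qed.
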